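(* Let $\mathfrak{g}$ be a finite-dimensional complex Lie algebra. For every $s\in\mathbb{C}\cup\{\infty\}$ the two-parameter family $\overline{\mathcal{G}}_{(e_1,e_2)}$ defines by restriction to the line $D_s$ a one-dimensional family of Lie algebras $\overline{\mathcal{G}}^s_{(e)}$, which is a deformation of the classical current algebra $\overline{\mathfrak{g}}=\mathfrak{g}\otimes\mathbb{C}[z^{-1},z]$ (corresponding to $e=0$) over the affine line $\mathbb{C}$, respectively over the algebra $\mathbb{C}[e]$. For $s\neq\infty$ the family is given by $$[x\otimes A_n,y\otimes A_m]=\begin{cases}[x,y]\otimes A_{n+m},& n\text{ or }m\text{ even},\\ [x,y]\otimes A_{n+m}+3e[x,y]\otimes A_{n+m-2}+e^2(1-s)(2+s)[x,y]\otimes A_{n+m-4},& n\text{ and }m\text{ both odd},\end{cases}$$ and for $s=\infty$ it is given by $$[x\otimes A_n,y\otimes A_m]=\begin{cases}[x,y]\otimes A_{n+m},& n\text{ or }m\text{ even},\\ [x,y]\otimes A_{n+m}-e[x,y]\otimes A_{n+m-4},& n\text{ and }m\text{ both odd}.\end{cases}$$ If $s\neq 1,-1/2,-2$, the algebras $\overline{\mathcal{G}}^s_{(e)}$, $e\neq0$, are elliptic current algebras. In any case, for fixed $s$ we have $\overline{\mathcal{G}}^s_{(e)}\cong\overline{\mathcal{G}}^s_{(e')}$ as long as both $e,e'\neq0$.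
   Context: For $e_1,e_2\in\mathbb{C}$, $\overline{\mathcal{G}}_{(e_1,e_2)}$ is the Lie algebra $\mathfrak{g}\otimes V$, where $V$ has basis $\{A_n\mid n\in\mathbb{Z}\}$, with bracket $[x\otimes A_n,y\otimes A_m]=[x,y]\otimes A_{n+m}$ if $n$ or $m$ is even, and $[x\otimes A_n,y\otimes A_m]=[x,y]\otimes\big(A_{n+m}+3e_1A_{n+m-2}+(e_1-e_2)(2e_1+e_2)A_{n+m-4}\big)$ if $n,m$ are both odd ($x,y\in\mathfrak{g}$). $D_s:=\{(e_1,e_2)\in\mathbb{C}^2\mid e_2=se_1\}$ for $s\in\mathbb{C}$ and $D_\infty:=\{(0,e_2)\in\mathbb{C}^2\}$. The parameter is $e:=e_1$ on $D_s$ for $s\neq\infty$, and $e:=e_2^2$ for $s=\infty$. The classical current algebra has bracket $[x\otimes z^n,y\otimes z^m]=[x,y]\otimes z^{n+m}$ and is identified with the algebra at $e=0$ via $A_n=z^n$. An elliptic current algebra is $\mathfrak{g}\otimes\mathcal{A}$ with bracket $[x\otimes f,y\otimes g]=[x,y]\otimes fg$, where for $e_1,e_2,e_3=-(e_1+e_2)$ pairwise distinct $\mathcal{A}$ is the algebra of meromorphic functions on the elliptic curve $Y^2Z=4(X-e_1Z)(X-e_2Z)(X-e_3Z)$ holomorphic outside $\infty=(0:1:0)$ and the point with affine coordinates $(e_1,0)$. A deformation of a Lie algebra $\mathcal{L}$ with base $\mathbb{C}[e]$ (at $e=0$) is a Lie $\mathbb{C}[e]$-algebra structure on $\mathbb{C}[e]\otimes_{\mathbb{C}}\mathcal{L}$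 such that evaluation at $e=0$ is a Lie algebra homomorphism onto $\mathcal{L}$. *)

(* Defs.v *)
From HB Require Import structures.
From mathcomp Require Import all_boot all_order all_algebra.
From mathcomp Require Import all_classical all_reals all_analysis.
From mathcomp Require Import complex ring.
(* The notations of monalg clash with those of the analysis library. *)
From mathcomp Require Import finmap.
From mathcomp Require Import -(notations) monalg.

Set Implicit Arguments.
Unset Strict Implicit.
Unset Printing Implicit Defensive.

Import Order.TTheory GRing.Theory Num.Theory.
Import numFieldNormedType.Exports.

Local Open Scope classical_set_scope.
Local Open Scope ring_scope.

Record lie_bracket (K : comNzRingType) (L : lmodType K) (br : L -> L -> L)
    : Prop := LieBracket {
  lie_linear_l : forall y, linear (br^~ y);
  lie_linear_r : forall x, linear (br x);
  lie_alternating : forall x, br x x = 0;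
  lie_jacobi : forall x y z,
    br x (br y z) + br y (br z x) + br z (br x y) = 0 }.

Definition lie_isomorphic (K : comNzRingType) (L1 L2 : lmodType K)
    (br1 : L1 -> L1 -> L1) (br2 : L2 -> L2 -> L2) : Prop :=
  exists2 phi : {linear L1 -> L2}, bijective phi &
    forall u v, phi (br1 u v) = br2 (phi u) (phi v).

(* The tensor product of two K-modules: the free module on U * V modulo the
   submodule that makes (u, v) |-> u (x) v bilinear. *)
Section Tensor.
Variables (K : comNzRingType) (U V : lmodType K).
Implicit Types (u : U) (v : V) (a b : malg (U * V)%type K).

Let gen u v : malg (U * V)%type K := mkmalgU (u, v) 1.

Inductive tensor_rel : malg (U * V)%type K -> Prop :=
| TensorRel0 : tensor_rel 0
| TensorRelP c a b : tensor_rel a -> tensor_rel b -> tensor_rel (c *: a + b)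
| TensorRelL c u1 u2 v :
    tensor_rel (gen (c *: u1 + u2) v - (c *: gen u1 v + gen u2 v))
| TensorRelR c u v1 v2 :
    tensor_rel (gen u (c *: v1 + v2) - (c *: gen u v1 + gen u v2)).

Definition tensor_null : {pred malg (U * V)%type K} :=
  fun a => `[< tensor_rel a >].

Fact tensor_null_zmod_closed : zmod_closed tensor_null.
Proof.
split=> [|a b /asboolP ra /asboolP rb]; apply/asboolP; first exact: TensorRel0.
by rewrite addrC -scaleN1r; apply: TensorRelP.
Qed.

HB.instance Definition _ :=
  GRing.isZmodClosed.Build (malg (U * V)%type K) tensor_null
    tensor_null_zmod_closed.

Definition tensor : Type := Quotient.quot tensor_null.

HB.instance Definition _ := GRing.Zmodule.on tensor.

Definition tensor_proj a : tensor := (\pi_(Quotient.quot tensor_null) a)%qT.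
Definition tensor_repr (t : tensor) : malg (U * V)%type K :=
  repr (t : Quotient.quot tensor_null).

Lemma tensor_reprK : cancel tensor_repr tensor_proj.
Proof. exact: reprK. Qed.

Lemma tensor_projP a b : tensor_proj a = tensor_proj b <-> tensor_rel (a - b).
Proof.
split=> [/eqP|r]; last apply/eqP; rewrite -Quotient.idealrBE.
  by move/asboolP.
exact/asboolP.
Qed.

Lemma tensor_projD : {morph tensor_proj : a b / a + b}.
Proof. exact: Quotient.pi_add. Qed.

Definition tensor_scale (c : K) (t : tensor) : tensor :=
  tensor_proj (c *: tensor_repr t).

Lemma tensor_scale_proj c a : tensor_scale c (tensor_proj a) = tensor_proj (c *: a).
Proof.
apply/tensor_projP; rewrite -scalerBr -[_ *: _]addr0.
apply: TensorRelP; last exact: TensorRel0.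
by apply/tensor_projP; rewrite tensor_reprK.
Qed.

Fact tensor_scaleA c d t : tensor_scale c (tensor_scale d t) = tensor_scale (c * d) t.
Proof. by rewrite -[t]tensor_reprK !tensor_scale_proj scalerA. Qed.

Fact tensor_scale1 : left_id 1 tensor_scale.
Proof. by move=> t; rewrite -[t]tensor_reprK tensor_scale_proj scale1r. Qed.

Fact tensor_scaleDr : right_distributive tensor_scale +%R.
Proof.
move=> c s t; rewrite -[s]tensor_reprK -[t]tensor_reprK -tensor_projD.
by rewrite !tensor_scale_proj -tensor_projD scalerDr.
Qed.

Fact tensor_scaleDl t : {morph tensor_scale^~ t : c d / c + d}.
Proof.
move=> c d; rewrite -[t]tensor_reprK /= !tensor_scale_proj.
by rewrite -tensor_projD scalerDl.
Qed.

HB.instance Definition _ := GRing.Zmodule_isLmodule.Build K tensor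
  tensor_scaleA tensor_scale1 tensor_scaleDr tensor_scaleDl.

Lemma tensor_proj_linear : linear tensor_proj.
Proof. by move=> c a b; rewrite tensor_projD -tensor_scale_proj. Qed.

Lemma tensor_proj0 : tensor_proj 0 = 0.
Proof. by apply: (addrI (tensor_proj 0)); rewrite -tensor_projD !addr0. Qed.

Definition tens u v : tensor := tensor_proj (gen u v).

Lemma tens_linear_l v : linear (tens^~ v).
Proof.
move=> c u1 u2; rewrite -tensor_proj_linear.
exact/tensor_projP/TensorRelL.
Qed.

Lemma tens_linear_r u : linear (tens u).
Proof.
move=> c v1 v2; rewrite -tensor_proj_linear.
exact/tensor_projP/TensorRelR.
Qed.

Lemma tensor_ind (P : tensor -> Prop) :
  (forall u v, P (tens u v)) -> (forall c s t, P s -> P t -> P (c *: s + t)) ->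
  forall t, P t.
Proof.
move=> Ppure Plin.
have P0 : P 0 by rewrite -[0](addNr (tens 0 0)) -scaleN1r; apply: Plin.
move=> t; rewrite -[t]tensor_reprK [tensor_repr t]monalgE.
elim: (enum_fset _) => [|[u v] r IHr].
  by rewrite big_nil tensor_proj0.
rewrite big_cons; set c := mcoeff _ _.
suff -> : mkmalgU (u, v) c = c *: gen u v :> malg _ K.
  by rewrite tensor_proj_linear; exact: Plin (Ppure u v) IHr.
by apply/malgP => k; rewrite mcoeffZ !mcoeffU mulr_natr.
Qed.

(* The linear map induced by b; meaningful when b is bilinear. *)
Definition tensor_lift (W : lmodType K) (b : U -> V -> W) (t : tensor) : W :=
  \sum_(k <- msupp (tensor_repr t)) mcoeff k (tensor_repr t) *: b k.1 k.2.

Section Lift.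
Variables (W : lmodType K) (b : U -> V -> W).
Hypotheses (bl : forall v, linear (b^~ v)) (br : forall u, linear (b u)).

Let lift0 a : W := \sum_(k <- msupp a) mcoeff k a *: b k.1 k.2.

Let lift0Ew a (d : {fset (U * V)}) :
  (msupp a `<=` d)%fset ->
  lift0 a = \sum_(k <- d) mcoeff k a *: b k.1 k.2.
Proof.
move=> le; apply: big_fset_incl => // k _ kn.
by rewrite mcoeff_outdom ?scale0r.
Qed.

Let lift0_linear : linear lift0.
Proof.
move=> c a1 a2; set d := (msupp a1 `|` msupp a2)%fset.
have s1 : fsubset (msupp a1) d by apply: fsubsetUl.
have s2 : fsubset (msupp a2) d by apply: fsubsetUr.
rewrite (lift0Ew s1) (lift0Ew s2) (@lift0Ew _ d); last first.
  apply: (fsubset_trans (msuppD_le _ _)).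
  apply: fsetUSS; last by [].
  exact: msuppZ_le.
rewrite scaler_sumr -big_split; apply: eq_bigr => k _ /=.
by rewrite mcoeffD mcoeffZ scalerDl scalerA.
Qed.

Let lift0_gen u v : lift0 (gen u v) = b u v.
Proof.
rewrite /lift0 msuppU oner_eq0 big_seq_fset1 mcoeffUU.
by rewrite scale1r.
Qed.

Let lift0_rel a : tensor_rel a -> lift0 a = 0.
Proof.
have l0 : lift0 0 = 0 by rewrite /lift0 msupp0 big_seq_fset0.
have lB x y : lift0 (x - y) = lift0 x - lift0 y.
  have -> : x - y = (-1) *: y + x by rewrite scaleN1r addrC.
  by rewrite lift0_linear scaleN1r addrC.
elim=> [|c x y _ hx _ hy|c u1 u2 v|c u v1 v2].
- exact: l0.
- by rewrite lift0_linear hx hy scaler0 addr0.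
- by rewrite lB lift0_linear !lift0_gen bl subrr.
- by rewrite lB lift0_linear !lift0_gen br subrr.
Qed.

Let lift_proj a : tensor_lift b (tensor_proj a) = lift0 a.
Proof.
rewrite /tensor_lift -/(lift0 _).
set r := tensor_repr _; have /tensor_projP/lift0_rel : tensor_proj r = tensor_proj a.
  by rewrite tensor_reprK.
have -> : r - a = (-1) *: a + r by rewrite scaleN1r addrC.
by rewrite lift0_linear scaleN1r addrC => /subr0_eq.
Qed.

Lemma tensor_lift_linear : linear (tensor_lift b).
Proof.
move=> c s t; rewrite -[s]tensor_reprK -[t]tensor_reprK -tensor_proj_linear.
by rewrite !lift_proj lift0_linear.
Qed.

Lemma tensor_lift_tens u v : tensor_lift b (tens u v) = b u v.
Proof. by rewrite lift_proj lift0_gen. Qed.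

End Lift.
End Tensor.

Arguments tens {K U V} u v.

Notation "x ⊗ y" := (tens x y) (at level 40, left associativity) : ring_scope.

(* Extension of scalars: S acts on the left factor of S (x)_K L. *)
Section ScalarExtension.
Variables (K : comNzRingType) (S : comAlgType K) (L : lmodType K).

Definition scalar_ext : Type := tensor S L.
HB.instance Definition _ := GRing.Zmodule.on scalar_ext.

Definition ext_scale (p : S) : scalar_ext -> scalar_ext :=
  tensor_lift (fun (q : S) (l : L) => (p * q) ⊗ l : tensor S L).

Let ext_l p l : linear (fun q : S => (p * q) ⊗ l : tensor S L).
Proof. by move=> c q1 q2; rewrite mulrDr -scalerAr tens_linear_l. Qed.

Let ext_r p q : linear (fun l : L => (p * q) ⊗ l : tensor S L).
Proof. exact: tens_linear_r. Qed.

Lemma ext_scale_tens p (q : S) (l : L) : ext_scale p (q ⊗ l) = (p * q) ⊗ l.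
Proof. by rewrite /ext_scale tensor_lift_tens. Qed.

Let ext_scale_linear p : linear (ext_scale p : tensor S L -> tensor S L).
Proof. exact: tensor_lift_linear. Qed.

Fact ext_scaleA p q t : ext_scale p (ext_scale q t) = ext_scale (p * q) t.
Proof.
elim/tensor_ind: t => [r l|c s t hs ht]; first by rewrite !ext_scale_tens mulrA.
by rewrite !ext_scale_linear hs ht.
Qed.

Fact ext_scale1 : left_id 1 ext_scale.
Proof.
elim/tensor_ind => [r l|c s t hs ht]; first by rewrite !ext_scale_tens mul1r.
by rewrite !ext_scale_linear hs ht.
Qed.

Fact ext_scaleDr : right_distributive ext_scale +%R.
Proof.
by move=> p s t; have := ext_scale_linear p 1 s t; rewrite !scale1r.
Qed.

Fact ext_scaleDl t : {morph ext_scale^~ t : p q / p + q}.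
Proof.
move=> p q; elim/tensor_ind: t => [r l|c s t hs ht] /=.
  rewrite !ext_scale_tens mulrDl.
  by have := tens_linear_l l 1 (p * r) (q * r); rewrite !scale1r.
by rewrite !ext_scale_linear hs ht scalerDr addrACA.
Qed.

HB.instance Definition _ := GRing.Zmodule_isLmodule.Build S scalar_ext
  ext_scaleA ext_scale1 ext_scaleDr ext_scaleDl.

End ScalarExtension.

Fact scaler_linear (K : comNzRingType) (L : lmodType K) (b : K) :
  linear (fun l : L => b *: l).
Proof. by move=> c l1 l2; rewrite scalerDr !scalerA mulrC. Qed.

(* Evaluation at e = a, from K[e] (x) L to L. *)
Definition eval_at (K : comNzRingType) (L : lmodType K) (a : K) :
    scalar_ext {poly K} L -> L :=
  tensor_lift (fun (p : {poly K}) (l : L) => p.[a] *: l).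

Lemma eval_at_linear (K : comNzRingType) (L : lmodType K) (a : K) :
  linear (@eval_at K L a : tensor {poly K} L -> L).
Proof.
apply: tensor_lift_linear => [l c p q|p]; last exact: scaler_linear.
by rewrite hornerD hornerZ scalerDl scalerA.
Qed.

Lemma eval_at_tens (K : comNzRingType) (L : lmodType K) (a : K)
    (p : {poly K}) (l : L) : eval_at a (p ⊗ l) = p.[a] *: l.
Proof.
apply: tensor_lift_tens => [l' c p1 p2|p']; last exact: scaler_linear.
by rewrite hornerD hornerZ scalerDl scalerA.
Qed.

Record is_deformation (K : comNzRingType) (L : lmodType K) (br : L -> L -> L)
    (B : scalar_ext {poly K} L -> scalar_ext {poly K} L ->
         scalar_ext {poly K} L) : Prop := IsDeformation {
  deformation_lie : lie_bracket B;
  deformation_hom : forall u v,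
    eval_at 0 (B u v) = br (eval_at 0 u) (eval_at 0 v);
  deformation_onto : forall l : L, exists u, eval_at 0 u = l }.

Fact scale_swap (K : comNzRingType) (W : lmodType K) (c d : K) (a b a' b' : W) :
  d *: (c *: a + b) + (c *: a' + b') = c *: (d *: a + a') + (d *: b + b').
Proof. by rewrite !scalerDr !scalerA mulrC addrACA. Qed.

(* The bilinear bracket on g (x) V determined by
   [x (x) f, y (x) h] = [x, y] (x) (f * h). *)
Section TensorBracket.
Variables (K : comNzRingType) (g V : lmodType K).
Variables (br : g -> g -> g) (mul : V -> V -> V).

Definition tensor_bracket (s t : tensor g V) : tensor g V :=
  tensor_lift (fun x f => tensor_lift (fun y h => br x y ⊗ mul f h) t) s.

Hypotheses (br_l : forall y, linear (br^~ y)) (br_r : forall x, linear (br x)).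
Hypotheses (mul_l : forall h, linear (mul^~ h)) (mul_r : forall f, linear (mul f)).

Let inner_l x f h : linear (fun y => br x y ⊗ mul f h).
Proof. by move=> c y1 y2; rewrite br_r tens_linear_l. Qed.

Let inner_r x f y : linear (fun h => br x y ⊗ mul f h).
Proof. by move=> c h1 h2; rewrite mul_r tens_linear_r. Qed.

Let outer_l t f :
  linear (fun x => tensor_lift (fun y h => br x y ⊗ mul f h) t).
Proof.
have lin x := tensor_lift_linear (inner_l x f) (inner_r x f).
move=> c x1 x2; elim/tensor_ind: t => [y h|d s t hs ht].
  have val x := tensor_lift_tens (inner_l x f) (inner_r x f) y h.
  by rewrite !val br_l tens_linear_l.
rewrite (lin x1) (lin x2) (lin (c *: x1 + x2)) hs ht.
exact: scale_swap.
Qed.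

Let outer_r t x :
  linear (fun f => tensor_lift (fun y h => br x y ⊗ mul f h) t).
Proof.
have lin f := tensor_lift_linear (inner_l x f) (inner_r x f).
move=> c f1 f2; elim/tensor_ind: t => [y h|d s t hs ht].
  have val f := tensor_lift_tens (inner_l x f) (inner_r x f) y h.
  by rewrite !val mul_l tens_linear_r.
rewrite (lin f1) (lin f2) (lin (c *: f1 + f2)) hs ht.
exact: scale_swap.
Qed.

Lemma tensor_bracket_linear_l t : linear (tensor_bracket^~ t).
Proof. exact: tensor_lift_linear (outer_l t) (outer_r t). Qed.

Lemma tensor_bracket_linear_r s : linear (tensor_bracket s).
Proof.
move=> c t1 t2; elim/tensor_ind: s => [x f|d s1 s2 h1 h2].
  rewrite /tensor_bracket !(tensor_lift_tens (outer_l _) (outer_r _)).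
  exact: tensor_lift_linear.
have lin t := tensor_bracket_linear_l t d s1 s2.
rewrite (lin t1) (lin t2) (lin (c *: t1 + t2)) h1 h2.
exact: scale_swap.
Qed.

Lemma tensor_bracket_tens x f y h :
  tensor_bracket (x ⊗ f) (y ⊗ h) = br x y ⊗ mul f h.
Proof.
rewrite /tensor_bracket (tensor_lift_tens (outer_l _) (outer_r _)).
exact: tensor_lift_tens.
Qed.

End TensorBracket.

(* The space with basis (A_n), n in Z; also C[z^-1, z], with A_n = z^n. *)
Section BasisAlgebra.
Variable K : comNzRingType.
Local Notation V := (malg int K).

Definition A (n : int) : V := mkmalgU n 1.

(* The bilinear product with A_n * A_m = c n m. *)
Definition basis_mul (c : int -> int -> V) (f h : V) : V :=
  \sum_(n <- msupp f) \sum_(m <- msupp h) (mcoeff n f * mcoeff m h) *: c n m.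

Definition oddz (n : int) : bool := odd `|n|%N.

Definition classical_table (n m : int) : V := A (n + m).

Definition family_table (e1 e2 : K) (n m : int) : V :=
  if oddz n && oddz m then
    A (n + m) + (3 * e1) *: A (n + m - 2)
    + ((e1 - e2) * (2 * e1 + e2)) *: A (n + m - 4)
  else A (n + m).

Let basis_mulEw c f h (d d' : {fset int}) :
  (msupp f `<=` d)%fset -> (msupp h `<=` d')%fset ->
  basis_mul c f h =
    \sum_(n <- d) \sum_(m <- d') (mcoeff n f * mcoeff m h) *: c n m.
Proof.
move=> sd sd'; rewrite /basis_mul.
transitivity (\sum_(n <- msupp f) \sum_(m <- d') (mcoeff n f * mcoeff m h) *: c n m).
  apply: eq_bigr => n _; apply: big_fset_incl => // m _ mn.
  by rewrite [X in _ * X]mcoeff_outdom // mulr0 scale0r.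
apply: big_fset_incl => // n _ nn; apply: big1 => m _.
by rewrite mcoeff_outdom // mul0r scale0r.
Qed.

Lemma basis_mulA c n m : basis_mul c (A n) (A m) = c n m.
Proof.
by rewrite /basis_mul !msuppU oner_eq0 !big_seq_fset1 !mcoeffUU mulr1 scale1r.
Qed.

Lemma basis_mul_linear_l c h : linear (basis_mul c ^~ h).
Proof.
move=> a f1 f2; set d := (msupp f1 `|` msupp f2)%fset.
have s1 : (msupp f1 `<=` d)%fset by apply: fsubsetUl.
have s2 : (msupp f2 `<=` d)%fset by apply: fsubsetUr.
have s : (msupp (a *: f1 + f2) `<=` d)%fset.
  by apply: (fsubset_trans (msuppD_le _ _)); apply: fsetUSS => //; exact: msuppZ_le.
have s' := fsubset_refl (msupp h).
rewrite (basis_mulEw _ s s') (basis_mulEw _ s1 s') (basis_mulEw _ s2 s').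
rewrite scaler_sumr -big_split; apply: eq_bigr => n _ /=.
rewrite scaler_sumr -big_split; apply: eq_bigr => m _ /=.
by rewrite mcoeffD mcoeffZ mulrDl scalerDl scalerA mulrA.
Qed.

Lemma basis_mul_linear_r c f : linear (basis_mul c f).
Proof.
move=> a h1 h2; set d := (msupp h1 `|` msupp h2)%fset.
have s1 : (msupp h1 `<=` d)%fset by apply: fsubsetUl.
have s2 : (msupp h2 `<=` d)%fset by apply: fsubsetUr.
have s : (msupp (a *: h1 + h2) `<=` d)%fset.
  by apply: (fsubset_trans (msuppD_le _ _)); apply: fsetUSS => //; exact: msuppZ_le.
have s' := fsubset_refl (msupp f).
rewrite (basis_mulEw _ s' s) (basis_mulEw _ s' s1) (basis_mulEw _ s' s2).
rewrite scaler_sumr -big_split; apply: eq_bigr => n _ /=.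
rewrite scaler_sumr -big_split; apply: eq_bigr => m _ /=.
by rewrite mcoeffD mcoeffZ mulrDr scalerDl scalerA mulrCA.
Qed.

End BasisAlgebra.

Arguments A {K} n.

Definition classical_bracket (K : comNzRingType) (g : lmodType K)
    (br : g -> g -> g) :=
  tensor_bracket br (basis_mul (@classical_table K)).

Definition family_bracket (K : comNzRingType) (g : lmodType K)
    (br : g -> g -> g) (e1 e2 : K) :=
  tensor_bracket br (basis_mul (family_table e1 e2)).

(* The lines D_s, with None for s = infinity, and their parameters. *)
Definition line (K : comNzRingType) (s : option K) (e1 e2 : K) : Prop :=
  if s is Some s then e2 = s * e1 else e1 = 0.

Definition line_param (K : comNzRingType) (s : option K) (e1 e2 : K) : K :=
  if s is Some _ then e1 else e2 ^+ 2.

(* [f], extended at a point where the coordinate [t] takes the value [t0] by the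
   value [c], is complex differentiable there with respect to [t]; [F] is the
   filter of punctured neighbourhoods of the point. *)
Definition differentiable_in (C : numClosedFieldType) (T : Type)
    (F : set_system T) (t : T -> C) (t0 : C) (f : T -> C) (c : C) : Prop :=
  exists d : C, (f q - c) / (t q - t0) @[q --> F] --> d.

Fact eq_differentiable_in (C : numClosedFieldType) (T : Type)
    (F : set_system T) (t : T -> C) (t0 : C) (f g : T -> C) (c : C) :
  f =1 g -> differentiable_in F t t0 f c -> differentiable_in F t t0 g c.
Proof. by move=> /funext ->. Qed.

Definition local_coord (C : numClosedFieldType) (T : Type)
    (F : set_system T) (t : T -> C) (t0 : C) : Prop :=
  t @ F --> t0 /\ \forall q \near F, t q != t0.

Section DifferentiableIn.
Variables (C : numClosedFieldType) (T : Type) (F : set_system T).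
Variables (t : T -> C) (t0 : C).
Context {FF : Filter F}.
Local Notation diff := (differentiable_in F t t0).

Let cvg_eq_near (f g : T -> C) (l : C) :
  (\forall q \near F, f q = g q) -> f @ F --> l -> g @ F --> l.
Proof.
by move=> fg fl; apply: cvg_trans fl; apply: near_eq_cvg; apply: filterS fg.
Qed.

Lemma differentiable_in_lin a f1 c1 f2 c2 :
  diff f1 c1 -> diff f2 c2 -> diff (a *: f1 + f2) (a * c1 + c2).
Proof.
move=> [d1 h1] [d2 h2]; exists (a * d1 + d2).
apply: cvg_eq_near (cvgD (cvgM (cvg_cst a) h1) h2).
apply: nearW => q.
rewrite -[LHS]/(a * ((f1 q - c1) / (t q - t0)) + (f2 q - c2) / (t q - t0)).
rewrite -[(_ + _) q]/(a * f1 q + f2 q) mulrA -mulrDl; congr (_ / _).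
by rewrite mulrBr opprD addrACA.
Qed.

Hypothesis tF : local_coord F t t0.

Lemma differentiable_in_cvg f c : diff f c -> f @ F --> c.
Proof.
move=> [d hd]; case: tF => tt nt.
have ht : (t q - t0) @[q --> F] --> t0 - t0 by apply: cvgB => //; exact: cvg_cst.
have := cvgD (cvgM hd ht) (cvg_cst c); rewrite subrr mulr0 add0r.
move=> /(_ _ _ _) lim; apply: cvg_eq_near lim; near=> q.
rewrite -[LHS]/((f q - c) / (t q - t0) * (t q - t0) + c).
by rewrite divfK ?subrK // subr_eq0; near: q.
Unshelve. all: by end_near. Qed.

Lemma differentiable_inM f1 c1 f2 c2 :
  diff f1 c1 -> diff f2 c2 -> diff (f1 * f2) (c1 * c2).
Proof.
move=> h1 h2; have [d1 k1] := h1; have [d2 k2] := h2.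
have l2 := differentiable_in_cvg h2.
exists (d1 * c2 + c1 * d2).
apply: cvg_eq_near (cvgD (cvgM k1 l2) (cvgM (cvg_cst c1) k2)).
apply: nearW => q.
rewrite -[LHS]/((f1 q - c1) / (t q - t0) * f2 q + c1 * ((f2 q - c2) / (t q - t0))).
rewrite -[(_ * _) q]/(f1 q * f2 q) mulrAC mulrA -mulrDl; congr (_ / _).
by rewrite mulrBl mulrBr addrA subrK.
Qed.

Lemma differentiable_in_cst a : diff (cst a) a.
Proof.
exists 0; rewrite (_ : (fun _ => _) = cst 0); first exact: cvg_cst.
by apply/funext => q; rewrite /= subrr mul0r.
Qed.

Lemma differentiable_in_coord : diff t t0.
Proof.
exists 1; apply: cvg_eq_near (cvg_cst (1 : C)).
case: tF => _; apply: filterS => q h.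
by rewrite divff // subr_eq0.
Qed.

Lemma differentiable_inX n : diff (fun q => t q ^+ n) (t0 ^+ n).
Proof.
elim: n => [|n IHn]; first by rewrite expr0; exact: differentiable_in_cst.
rewrite exprS (_ : (fun _ => _) = t * (fun q => t q ^+ n)).
  exact: differentiable_inM differentiable_in_coord IHn.
by apply/funext => q; rewrite exprS.
Qed.

End DifferentiableIn.

(* Some t ^ n * f extends holomorphically to the point t = 0. *)
Definition meromorphic_in (C : numClosedFieldType) (T : Type)
    (F : set_system T) (t f : T -> C) : Prop :=
  exists (n : nat) (c : C), differentiable_in F t 0 (fun q => t q ^+ n * f q) c.

Section MeromorphicIn.
Variables (C : numClosedFieldType) (T : Type) (F : set_system T) (t : T -> C).
Context {FF : Filter F}.
Hypothesis tF : local_coord F t 0.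

Lemma meromorphic_in_lin a f1 f2 :
  meromorphic_in F t f1 -> meromorphic_in F t f2 ->
  meromorphic_in F t (a *: f1 + f2).
Proof.
move=> [n1 [c1 h1]] [n2 [c2 h2]]; exists (n2 + n1)%N.
exists (a * (0 ^+ n2 * c1) + 0 ^+ n1 * c2).
apply: eq_differentiable_in (differentiable_in_lin a
  (differentiable_inM tF (differentiable_inX tF n2) h1)
  (differentiable_inM tF (differentiable_inX tF n1) h2)) => q.
rewrite -[LHS]/(a * (t q ^+ n2 * (t q ^+ n1 * f1 q))
  + t q ^+ n1 * (t q ^+ n2 * f2 q)).
rewrite -[(_ + _) q]/(a * f1 q + f2 q) exprD mulrDr.
by congr (_ + _); [rewrite [RHS]mulrCA !mulrA|rewrite mulrCA mulrA].
Qed.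

Lemma meromorphic_inM f1 f2 :
  meromorphic_in F t f1 -> meromorphic_in F t f2 ->
  meromorphic_in F t (f1 * f2).
Proof.
move=> [n1 [c1 h1]] [n2 [c2 h2]]; exists (n1 + n2)%N, (c1 * c2).
have h := differentiable_inM (FF := FF) tF h1 h2.
apply: eq_differentiable_in h => q.
by rewrite -[(f1 * f2) q]/(f1 q * f2 q) exprD mulrACA.
Qed.

Lemma meromorphic_in_cst a : meromorphic_in F t (cst a).
Proof.
exists 0%N, a; have h := differentiable_in_cst (FF := FF) t 0 a.
apply: eq_differentiable_in h => q.
by rewrite expr0 mul1r.
Qed.

End MeromorphicIn.

(* The meromorphic functions on the elliptic curve
   Y^2 Z = 4 (X - e1 Z) (X - e2 Z) (X - e3 Z), e3 = - (e1 + e2), that are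
   holomorphic outside (0 : 1 : 0) and (e1 : 0 : 1), as functions on the
   remaining points of the curve, all of which are affine. *)
Section EllipticAlgebra.
Variables (C : numClosedFieldType) (e1 e2 : C).
Local Notation e3 := (- (e1 + e2)).

Definition on_curve (p : C * C) : bool :=
  p.2 ^+ 2 == 4 * (p.1 - e1) * (p.1 - e2) * (p.1 - e3).

Definition curve_point : Type := {p : C * C | on_curve p && (p != (e1, 0))}.

Definition Xc (q : curve_point) : C := (val q).1.
Definition Yc (q : curve_point) : C := (val q).2.

(* Punctured neighbourhoods, on the curve, of its affine point p; p = (e1, 0)
   is allowed. *)
Definition curve_dnbhs (p : C * C) : set_system curve_point :=
  filter_from p^' (fun U => [set q | U (val q)]).

Definition curve_infty : set_system curve_point :=
  filter_from [set M : C | 0 < M] (fun M => [set q | M < `|Xc q|]).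

(* X is a local coordinate at the affine points with Y <> 0, Y at those with
   Y = 0, and X / Y at (0 : 1 : 0). *)
Definition curve_coord (q : curve_point) : curve_point -> C :=
  if Yc q == 0 then Yc else Xc.

Definition holomorphic (f : curve_point -> C) : Prop := forall q,
  differentiable_in (curve_dnbhs (val q)) (curve_coord q) (curve_coord q q)
    f (f q).

Definition elliptic_fun (f : curve_point -> C) : Prop :=
  [/\ holomorphic f,
      meromorphic_in (curve_dnbhs (e1, 0)) Yc f
    & meromorphic_in curve_infty (fun q => Xc q / Yc q) f].

#[local] Instance curve_dnbhs_filter p : Filter (curve_dnbhs p).
Proof.
apply: filter_from_filter; first by exists setT; exact: filterT.
by move=> U V hU hV; exists (U `&` V) => //; exact: filterI.
Qed.

#[local] Instance curve_infty_filter : Filter curve_infty.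
Proof.
apply: filter_from_filter; first by exists 1; exact: ltr01.
move=> M N /= M0 N0; exists (M + N); first exact: addr_gt0.
move=> q /= h; split=> /=; apply: le_lt_trans h.
  by rewrite lerDl ltW.
by rewrite lerDr ltW.
Qed.

Let curveE (q : curve_point) :
  Yc q ^+ 2 = 4 * (Xc q - e1) * (Xc q - e2) * (Xc q - e3).
Proof. by have /andP[/eqP] := valP q. Qed.

Let curve_ne (q : curve_point) : val q != (e1, 0).
Proof. by have /andP[] := valP q. Qed.

Let val_eq q (p : C * C) : Xc q = p.1 -> Yc q = p.2 -> val q = p.
Proof. by case: p => x y /= <- <-; exact: surjective_pairing. Qed.

Let Xc_cvg p : Xc @ curve_dnbhs p --> p.1.
Proof.
move=> U /= hU; exists (fst @^-1` U) => //.
by apply: nbhs_dnbhs; exact: cvg_fst.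
Qed.

Let Yc_cvg p : Yc @ curve_dnbhs p --> p.2.
Proof.
move=> U /= hU; exists (snd @^-1` U) => //.
by apply: nbhs_dnbhs; exact: cvg_snd.
Qed.

Let near_neq p : \forall q \near curve_dnbhs p, val q != p.
Proof.
exists [set x | x != p] => //=.
by apply: filterS (nbhs_dnbhs_neq p) => q.
Qed.

Let Yc0 (q : curve_point) : Yc q = 0 -> [|| Xc q == e1, Xc q == e2 | Xc q == e3].
Proof.
move=> Y0; have := curveE q; rewrite Y0 expr0n /= => /esym/eqP.
by rewrite !mulf_eq0 pnatr_eq0 /= !subr_eq0 -!orbA.
Qed.

Let near_Xc p (e : C) : p.1 != e -> \forall q \near curve_dnbhs p, Xc q != e.
Proof.
move=> pe.
have l : (Xc q - e) @[q --> curve_dnbhs p] --> p.1 - e.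
  by apply: cvgB; [exact: Xc_cvg|exact: cvg_cst].
have pe0 : p.1 - e != 0 by rewrite subr_eq0.
by apply: filterS (cvgr_neq0 _ l pe0) => q; rewrite subr_eq0.
Qed.

Let near_Yc p : p.2 = 0 -> \forall q \near curve_dnbhs p, Yc q != 0.
Proof.
move=> p2.
have ne (e : C) : \forall q \near curve_dnbhs p, p.1 != e -> Xc q != e.
  case: (eqVneq p.1 e) => [_|pe]; first exact: nearW.
  by apply: filterS (near_Xc pe).
apply: filterS
  (filterI (near_neq p) (filterI (ne e1) (filterI (ne e2) (ne e3)))) => q.
move=> [qp [n1 [n2 n3]]]; apply/eqP => Y0; case/eqP: qp.
apply: val_eq; last by rewrite Y0.
case/or3P: (Yc0 Y0) => /eqP Xe; apply/esym/eqP; apply: contraT;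
  rewrite Xe; [move/n1|move/n2|move/n3]; by rewrite Xe eqxx.
Qed.

Let local_coord_e1 : local_coord (curve_dnbhs (e1, 0)) Yc 0.
Proof. by split; [exact: Yc_cvg|exact: near_Yc]. Qed.

Let local_coord_point q0 :
  local_coord (curve_dnbhs (val q0)) (curve_coord q0) (curve_coord q0 q0).
Proof.
rewrite /curve_coord; case: ifPn => [/eqP Y0|Y0].
  split; first exact: Yc_cvg.
  by rewrite Y0; exact: near_Yc.
split; first exact: Xc_cvg.
have l : (Yc q + Yc q0) @[q --> curve_dnbhs (val q0)] --> Yc q0 + Yc q0.
  by apply: cvgD; [exact: Yc_cvg|exact: cvg_cst].
have s0 : Yc q0 + Yc q0 != 0 by rewrite -mulr2n mulrn_eq0.
apply: filterS (filterI (near_neq (val q0)) (cvgr_neq0 _ l s0)) => q [qq0 s].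
apply/eqP => Xq; case/eqP: qq0.
apply: val_eq => //.
have /eqP := curveE q; rewrite Xq -curveE eqf_sqr => /orP[/eqP //|].
by rewrite -addr_eq0 (negPf s).
Qed.

Let local_coord_infty : local_coord curve_infty (fun q => Xc q / Yc q) 0.
Proof.
pose k := `|e1| + `|e2| + `|e3|.
have k0 : 0 <= k by rewrite !addr_ge0.
have e1k : `|e1| <= k by rewrite /k -addrA lerDl addr_ge0.
have e2k : `|e2| <= k by rewrite /k addrAC lerDr addr_ge0.
have e3k : `|e3| <= k by rewrite /k lerDr addr_ge0.
have dist q e : `|e| <= k -> 2 * k + 1 < `|Xc q| -> `|Xc q| / 2 <= `|Xc q - e|.
  move=> ek kq; apply: le_trans (lerB_dist _ _).
  rewrite lerBrDl -lerBrDr {1}(splitr `|Xc q|) addrK.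
  rewrite ler_pdivlMr ?ltr0n //; apply: le_trans (ltW kq).
  by rewrite mulrC ler_wpDr // ler_wpM2l.
have big q : 2 * k + 1 < `|Xc q| -> `|Xc q| ^+ 3 / 2 <= `|Yc q| ^+ 2.
  move=> kq; rewrite -[leRHS]normrX curveE !normrM.
  pose x := `|Xc q|; have x2 : 0 <= x / 2.
    by apply: divr_ge0; [exact: normr_ge0|exact: ler0n].
  have -> : x ^+ 3 / 2 = 4 * (x / 2) * (x / 2) * (x / 2).
    by field.
  have d1 := dist q _ e1k kq; have d2 := dist q _ e2k kq.
  have d3 := dist q _ e3k kq.
  have x4 : 0 <= 4 * (x / 2) by apply: mulr_ge0 x2; exact: ler0n.
  rewrite normr_nat; apply: ler_pM => //; first exact: mulr_ge0.
  by apply: ler_pM => //; apply: ler_wpM2l => //; exact: ler0n.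
split.
  apply/cvgr0Pnorm_lt => r r0 /=.
  exists (2 * k + 1 + 2 / r ^+ 2).
    by rewrite /= ltr_wpDl ?divr_gt0 ?exprn_gt0 // addr_ge0 // mulr_ge0.
  move=> q /= h.
  have kq : 2 * k + 1 < `|Xc q|.
    by apply: le_lt_trans h; rewrite lerDl divr_ge0 // exprn_ge0 // ltW.
  have rq : 2 / r ^+ 2 < `|Xc q|.
    by apply: le_lt_trans h; rewrite lerDr addr_ge0 // mulr_ge0.
  have X0 : 0 < `|Xc q| by apply: lt_trans rq; rewrite divr_gt0 // exprn_gt0.
  have Y0 : 0 < `|Yc q| ^+ 2.
    by apply: lt_le_trans (big _ kq); rewrite divr_gt0 // exprn_gt0.
  rewrite -(@ltr_pXn2r _ 2) ?nnegrE ?normr_ge0 ?(ltW r0) //.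
  rewrite normrM normfV exprMn exprVn ltr_pdivrMr //.
  have r2 : 0 < r ^+ 2 by rewrite exprn_gt0.
  rewrite -ltr_pdivrMl //; apply: lt_le_trans (big _ kq).
  rewrite exprS mulrAC ltr_pM2r ?exprn_gt0 //.
  by rewrite ltr_pdivlMr ?ltr0n // mulrC.
exists (2 * k + 1) => /=; first by rewrite ltr_wpDl // mulr_ge0.
move=> q /= kq.
have X0 : 0 < `|Xc q| by apply: le_lt_trans kq; rewrite addr_ge0 // mulr_ge0.
have Y0 : 0 < `|Yc q| ^+ 2.
  by apply: lt_le_trans (big _ kq); rewrite divr_gt0 // exprn_gt0.
rewrite mulf_neq0 // ?invr_eq0; first by rewrite -normr_gt0.
by apply: contraTneq Y0 => ->; rewrite normr0 expr0n ltxx.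
Qed.

Fact elliptic_fun_lin a f1 f2 :
  elliptic_fun f1 -> elliptic_fun f2 -> elliptic_fun (a *: f1 + f2).
Proof.
move=> [h1 p1 i1] [h2 p2 i2]; split.
- move=> q; exact: differentiable_in_lin (h1 q) (h2 q).
- exact: (meromorphic_in_lin local_coord_e1).
- exact: (meromorphic_in_lin local_coord_infty).
Qed.

Fact elliptic_funM f1 f2 :
  elliptic_fun f1 -> elliptic_fun f2 -> elliptic_fun (f1 * f2).
Proof.
move=> [h1 p1 i1] [h2 p2 i2]; split.
- move=> q; exact: (differentiable_inM (local_coord_point q)) (h1 q) (h2 q).
- exact: (meromorphic_inM local_coord_e1).
- exact: (meromorphic_inM local_coord_infty).
Qed.

Fact elliptic_fun_cst a : elliptic_fun (cst a).
Proof.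
split.
- move=> q; exact: differentiable_in_cst.
- exact: meromorphic_in_cst.
- exact: meromorphic_in_cst.
Qed.

Definition elliptic_pred : {pred curve_point -> C} :=
  fun f => `[< elliptic_fun f >].

Fact elliptic_submod_closed : submod_closed elliptic_pred.
Proof.
split=> [|a f1 f2 /asboolP h1 /asboolP h2]; apply/asboolP.
  exact: (elliptic_fun_cst 0).
exact: elliptic_fun_lin.
Qed.

HB.instance Definition _ :=
  GRing.isSubmodClosed.Build C (curve_point -> C) elliptic_pred
    elliptic_submod_closed.

Record elliptic_algebra : Type := EllipticAlgebra {
  elliptic_val :> curve_point -> C;
  elliptic_valP : elliptic_val \in elliptic_pred }.

HB.instance Definition _ := [isSub for elliptic_val].
HB.instance Definition _ := [Choice of elliptic_algebra by <:].
HB.instance Definition _ := [SubChoice_isSubLmodule of elliptic_algebra by <:].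

Fact elliptic_mul_subproof (f h : elliptic_algebra) :
  (elliptic_val f * elliptic_val h) \in elliptic_pred.
Proof.
by apply/asboolP/elliptic_funM; apply/asboolP; exact: elliptic_valP.
Qed.

Definition elliptic_mul (f h : elliptic_algebra) : elliptic_algebra :=
  EllipticAlgebra (elliptic_mul_subproof f h).

End EllipticAlgebra.

Definition is_elliptic_current_algebra (C : numClosedFieldType) (g : lmodType C)
    (br : g -> g -> g) (L : lmodType C) (brL : L -> L -> L) : Prop :=
  exists e1 e2 : C,
    [/\ e1 != e2, e1 != - (e1 + e2), e2 != - (e1 + e2)
      & lie_isomorphic brL (tensor_bracket br (@elliptic_mul C e1 e2))].

(* Main.v *)
Require Import Defs.
From HB Require Import structures.
From mathcomp Require Import all_boot all_order all_algebra.
From mathcomp Require Import all_classical all_reals all_analysis.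
From mathcomp Require Import complex finmap ring lra zify.
From mathcomp Require Import -(notations) monalg.

(** The bracket of [family_bracket] is the current bracket of the product on the
    span of the A_n in which A_n A_m is A_(n+m), corrected for n, m both odd by
    c1 A_(n+m-2) + c2 A_(n+m-4).  Everything is proved for this bracket with
    arbitrary coefficients c1, c2 ([current_bracket]); on the line D_s they are
    polynomials in the parameter e.

    Lie algebras and deformation.  An iterated bracket of x A_n, y A_m, z A_k is
    [x, [y, z]] times a combination of A_(n+m+k), A_(n+m+k-2), A_(n+m+k-4) that
    is symmetric in n, m, k, so the Jacobi identity is that of g
    ([current_lie_bracket]).  The computation holds over any ring of
    coefficients; over C[e] it gives the deformation, whose evaluations are the
    members of the family ([poly_bracket_deformation], [poly_bracket_eval]).

    Isomorphisms.  The map A_n |-> l^n A_n multiplies c1 by l^-2 and c2 by l^-4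
    ([current_rescale]).  On D_s with s finite, c1 is linear and c2 quadratic in
    e; for s = infinity, c1 = 0 and c2 is linear.  So l^2 = e / e', respectively
    l^4 = e / e', carries the parameter e to e'.

    Elliptic members.  Put w = X - e1.  The product rule of the A_n is the
    equation Y^2 = 4 w (w + e1 - e2) (w + e1 - e3) of the curve, once A_2k is
    read as w^k and A_(2k+1) as Y w^(k-1) / 2 ([elliptic_map_mul]).  It remains
    to see that these functions form a basis of the elliptic algebra.  They are
    independent because (X, Y) and (X, - Y) have the same w ([elliptic_map_inj]).
    They span by [elliptic_fun_laurent]: split f into an even and an odd part
    under Y |-> - Y.  The even part is a function h of X alone; by the local
    behaviour of f at the points of the curve, w^m h extends continuously to
    the whole complex line, is complex differentiable except perhaps at e1, e2
    and e3, and grows polynomially; hence it is a polynomial.  The odd part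
    times Y is even, and its polynomial vanishes at e2 and e3, so that it is
    divisible by Y^2 / w.

    The analysis behind the word hence is [liouville].  Only pointwise
    differentiability off a finite set is assumed, so it starts from Goursat's
    subdivision argument ([goursat]).  If f tends to 0 at infinity, then
    (f z - f b) / (z - b) has integral 0 over large squares around b, while on
    them it is close to - f b / (z - b), whose integral is not 0 unless f b = 0
    ([holomorphic_vanish_at]).  Polynomial growth is reduced to this case by
    repeated divided differences; each of them creates an exceptional point,
    where the quotient is still continuous. *)

Set Implicit Arguments.
Unset Strict Implicit.
Unset Printing Implicit Defensive.

Import Order.TTheory GRing.Theory Num.Theory.
Import numFieldNormedType.Exports.

Local Open Scope ring_scope.

(** * Integrals of continuous real functions over segments *)

Section SegmentIntegral.
Variable R : realType.
Implicit Types (u v : R -> R) (a b c m : R).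
Local Open Scope classical_set_scope.

Definition segint u a b : R := (\int[@lebesgue_measure R]_(t in `[a, b]) u t)%R.

Let integrable_seg u a b : continuous u ->
  (@lebesgue_measure R).-integrable `[a, b] (EFin \o u).
Proof.
move=> cu; apply: continuous_compact_integrable; first exact: segment_compact.
exact: continuous_subspaceT.
Qed.

Lemma segint_cat u a b c : continuous u -> a <= b -> b <= c ->
  segint u a c = segint u a b + segint u b c.
Proof.
move=> cu ab bc; rewrite /segint.
have := @Rintegral_itvB _ u (BLeft a) (BRight c) b (integrable_seg a c cu).
rewrite !bnd_simp => /(_ ab bc).
rewrite Rintegral_itv_obnd_cbnd => [<-|]; first by rewrite addrC subrK.
apply: integrableS (integrable_seg b c cu) => //.
by apply: subset_itvr; rewrite bnd_simp.
Qed.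

Lemma segintB u v a b : continuous u -> continuous v ->
  segint (fun t => u t - v t) a b = segint u a b - segint v a b.
Proof. by move=> cu cv; apply: RintegralB => //; exact: integrable_seg. Qed.

Lemma segint_cst m a b : a <= b -> segint (fun=> m) a b = m * (b - a).
Proof.
move=> ab; rewrite /segint Rintegral_cst //.
rewrite /= lebesgue_measure_itv /= lte_fin; case: (ltgtP a b) ab => [lab _|//|-> _].
  by rewrite EFinN.
by rewrite subrr.
Qed.

Lemma segint_ge u m a b : continuous u -> a <= b ->
  (forall t, a <= t <= b -> m <= u t) -> m * (b - a) <= segint u a b.
Proof.
move=> cu ab mu; rewrite -segint_cst //; apply: le_Rintegral => //.
  by apply: integrable_seg => x; exact: cvg_cst.
exact: integrable_seg.
Qed.

Lemma segint_le u m a b : continuous u -> a <= b ->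
  (forall t, a <= t <= b -> u t <= m) -> segint u a b <= m * (b - a).
Proof.
move=> cu ab mu; rewrite -segint_cst //; apply: le_Rintegral => //.
  exact: integrable_seg.
by apply: integrable_seg => x; exact: cvg_cst.
Qed.

End SegmentIntegral.

(** * Contour integrals over squares *)

Local Notation Re := complex.Re.
Local Notation Im := complex.Im.

(** The topology that R[i] carries as a numeric field, made available on the
    concrete type. *)
HB.instance Definition _ (R : realType) :=
  PseudoPointedMetric.copy R[i] (R[i]^o).
HB.instance Definition _ (R : realType) := NormedModule.copy R[i] (R[i]^o).

Section Square.
Variable R : realType.
Local Notation C := R[i].
Implicit Types (f : C -> C) (x y l eta : R) (z : C) (S : seq C).
Local Open Scope classical_set_scope.

Lemma ReB z w : Re (z - w) = Re z - Re w.
Proof. by case: z w => [a b] [c d]; reflexivity. Qed.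

Lemma ImB z w : Im (z - w) = Im z - Im w.
Proof. by case: z w => [a b] [c d]; reflexivity. Qed.

Lemma normc_real (a : R) : `|a%:C%C| = `|a|%:C%C :> C.
Proof. by rewrite normc_def /= expr0n /= addr0 sqrtr_sqr. Qed.

Lemma normc_i : `|'i%C| = 1 :> C.
Proof. by rewrite normc_def /= expr0n /= add0r expr1n sqrtr1. Qed.

Lemma abs_Re_le z (m : R) : `|z| <= m%:C%C -> `|Re z| <= m.
Proof. by move=> zm; rewrite -lecR; apply: le_trans (normc_ge_Re z) zm. Qed.

Lemma abs_Im_le z (m : R) : `|z| <= m%:C%C -> `|Im z| <= m.
Proof.
move=> zm; have := @abs_Re_le (z * 'i%C) m; rewrite ReiNIm normrN; apply.
by rewrite normrM normc_i mulr1.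
Qed.

Lemma norm_le_ReIm z : `|z| <= (`|Re z| + `|Im z|)%:C%C.
Proof.
rewrite {1}[z]complexE; apply: le_trans (ler_normD _ _) _.
by rewrite normrM normc_i mul1r !normc_real -rmorphD.
Qed.

Lemma near_dist z (e : R) : 0 < e -> \forall w \near z, `|z - w| <= e%:C%C.
Proof.
move=> e0; have e0' : (0 : C) < e%:C%C by rewrite ltcR.
exact: (@cvgr_dist_le C C C (nbhs z) _ id z (@cvg_id _ (nbhs z)) _ e0').
Qed.

Lemma continuous_Re : continuous (@Re R : C -> R).
Proof.
move=> z; apply/(@cvgrPdist_le _ _ _ (nbhs z)) => e e0; near=> w; rewrite -ReB abs_Re_le //.
by near: w; exact: near_dist.
Unshelve. all: by end_near. Qed.

Lemma continuous_Im : continuous (@Im R : C -> R).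
Proof.
move=> z; apply/(@cvgrPdist_le _ _ _ (nbhs z)) => e e0; near=> w; rewrite -ImB abs_Im_le //.
by near: w; exact: near_dist.
Unshelve. all: by end_near. Qed.

Lemma ltc_real z : 0 < z -> exists2 e : R, 0 < e & z = e%:C%C.
Proof. by case: z => a b; rewrite ltcE /= => /andP[/eqP -> a0]; exists a. Qed.

Lemma continuous_hor y : continuous (fun t : R => (t +i* y)%C : C).
Proof.
move=> t; apply/(@cvgrPdist_le _ _ _ (nbhs t)) => _ /ltc_real[e e0 ->]; near=> s.
apply: le_trans (norm_le_ReIm _) _; rewrite /= subrr normr0 addr0 lecR.
by near: s; exact: (@cvgr_dist_le R R R (nbhs t) _ id t (@cvg_id _ (nbhs t))).
Unshelve. all: by end_near. Qed.

Lemma continuous_ver x : continuous (fun t : R => (x +i* t)%C : C).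
Proof.
move=> t; apply/(@cvgrPdist_le _ _ _ (nbhs t)) => _ /ltc_real[e e0 ->]; near=> s.
apply: le_trans (norm_le_ReIm _) _; rewrite /= subrr normr0 add0r lecR.
by near: s; exact: (@cvgr_dist_le R R R (nbhs t) _ id t (@cvg_id _ (nbhs t))).
Unshelve. all: by end_near. Qed.

Definition horint f y a b := segint (fun t => Re (f (t +i* y)%C)) a b.
Definition verint f x a b := segint (fun t => Im (f (x +i* t)%C)) a b.

(** The real part of the integral of f over the boundary of the square with lower
    left corner (x, y) and side l; the imaginary part is minus that of 'i f, so
    nothing is lost. *)
Definition contour f x y l : R :=
  horint f y x (x + l) - horint f (y + l) x (x + l)
  - (verint f (x + l) y (y + l) - verint f x y (y + l)).

Definition in_square x y l z : bool :=
  (x <= Re z <= x + l) && (y <= Im z <= y + l).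

Lemma continuous_Re_hor f y : continuous f -> continuous (fun t => Re (f (t +i* y)%C)).
Proof.
move=> cf t; apply: (@continuous_comp _ _ _ (fun t => f (t +i* y)%C)).
  by apply: continuous_comp; [exact: continuous_hor|exact: cf].
exact: continuous_Re.
Qed.

Lemma continuous_Im_ver f x : continuous f -> continuous (fun t => Im (f (x +i* t)%C)).
Proof.
move=> cf t; apply: (@continuous_comp _ _ _ (fun t => f (x +i* t)%C)).
  by apply: continuous_comp; [exact: continuous_ver|exact: cf].
exact: continuous_Im.
Qed.

(** The inner sides of the four quarters cancel in pairs. *)
Lemma contour_split f x y l : continuous f -> 0 <= l ->
  contour f x y (l + l) = contour f x y l + contour f (x + l) y l
    + contour f x (y + l) l + contour f (x + l) (y + l) l.
Proof.
move=> cf l0; rewrite /contour !addrA.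
have H b a : horint f b a (a + l + l)
    = horint f b a (a + l) + horint f b (a + l) (a + l + l).
  by apply: segint_cat; rewrite ?lerDl //; exact: continuous_Re_hor.
have V b a : verint f b a (a + l + l)
    = verint f b a (a + l) + verint f b (a + l) (a + l + l).
  by apply: segint_cat; rewrite ?lerDl //; exact: continuous_Im_ver.
rewrite !H !V; ring.
Qed.

(** Opposite sides of the square differ by l or 'i l, so the contribution of the
    affine part a + b z is (Im b) l^2 from each of the two pairs of sides, and
    these two cancel. *)
Lemma contour_affine_bound f (a b : C) x y l eta : continuous f -> 0 <= l ->
  (forall z, in_square x y l z -> `|f z - (a + b * z)| <= eta%:C%C) ->
  `|contour f x y l| <= 4 * eta * l.
Proof.
move=> cf l0 feta.
have xl : x <= x + l by rewrite lerDl.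
have yl : y <= y + l by rewrite lerDl.
have bnd (u : R -> R) c m : continuous u ->
    (forall t, c <= t <= c + l -> `|u t - m| <= 2 * eta) ->
    `|segint u c (c + l) - m * l| <= 2 * eta * l.
  move=> cu um; have cl : c <= c + l by rewrite lerDl.
  have lE : c + l - c = l by rewrite addrAC subrr add0r.
  have lo : (m - 2 * eta) * l <= segint u c (c + l).
    rewrite -{1}lE; apply: segint_ge => // t /um.
    by rewrite ler_norml => /andP[+ _]; lra.
  have hi : segint u c (c + l) <= (m + 2 * eta) * l.
    rewrite -{2}lE; apply: segint_le => // t /um.
    by rewrite ler_norml => /andP[_ +]; lra.
  by rewrite ler_norml; apply/andP; split; lra.
rewrite /contour /horint /verint -!segintB;
  do ?[exact: continuous_Re_hor|exact: continuous_Im_ver].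
pose m := Im b * l.
set I1 := segint _ x _; set I2 := segint _ y _.
have -> : I1 - I2 = (I1 - m * l) - (I2 - m * l) by ring.
apply: le_trans (ler_normB _ _) _.
have -> : 4 * eta * l = 2 * eta * l + 2 * eta * l by ring.
apply: lerD; apply: bnd.
- by move=> t; apply: cvgB; exact: continuous_Re_hor.
- move=> t xt.
  pose z1 : C := (t +i* y)%C; pose z2 : C := (t +i* (y + l))%C.
  have h1 : `|f z1 - (a + b * z1)| <= eta%:C%C.
    by apply: feta; rewrite /in_square /= xt !lexx yl.
  have h2 : `|f z2 - (a + b * z2)| <= eta%:C%C.
    by apply: feta; rewrite /in_square /= xt !lexx yl.
  rewrite mulr_natl mulr2n.
  apply: le_trans (lerD (abs_Re_le h1) (abs_Re_le h2)).
  have -> : Re (f z1) - Re (f z2) - m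
      = Re (f z1 - (a + b * z1)) - Re (f z2 - (a + b * z2)).
    rewrite /m /z1 /z2; move: (f _) (f _) => [p1 p2] [q1 q2].
    by case: (a) (b) => [a1 a2] [b1 b2] /=; ring.
  exact: ler_normB.
- by move=> t; apply: cvgB; exact: continuous_Im_ver.
- move=> t xt.
  pose z1 : C := ((x + l) +i* t)%C; pose z2 : C := (x +i* t)%C.
  have h1 : `|f z1 - (a + b * z1)| <= eta%:C%C.
    by apply: feta; rewrite /in_square /= xt !lexx xl.
  have h2 : `|f z2 - (a + b * z2)| <= eta%:C%C.
    by apply: feta; rewrite /in_square /= xt !lexx xl.
  rewrite mulr_natl mulr2n.
  apply: le_trans (lerD (abs_Im_le h1) (abs_Im_le h2)).
  have -> : Im (f z1) - Im (f z2) - m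
      = Im (f z1 - (a + b * z1)) - Im (f z2 - (a + b * z2)).
    rewrite /m /z1 /z2; move: (f _) (f _) => [p1 p2] [q1 q2].
    by case: (a) (b) => [a1 a2] [b1 b2] /=; ring.
  exact: ler_normB.
Qed.

End Square.

(** * Pointwise complex differentiability *)

Section HolomorphicAt.
Variable C : numClosedFieldType.
Implicit Types (f g : C -> C) (a b z w : C) (S : seq C).
Local Open Scope classical_set_scope.

Definition holomorphic_at f z : Prop := differentiable_in z^' id z f (f z).

Lemma local_coord_id z : local_coord z^' id z.
Proof.
split; first exact: cvg_within.
exact: nbhs_dnbhs_neq.
Qed.

Lemma continuous_punctured f z : f @ z^' --> f z -> {for z, continuous f}.
Proof.
move=> fz; apply/(@cvgrPdist_le _ _ _ (nbhs z)) => e e0.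
have := cvgr_dist_le _ _ fz _ e0; rewrite /dnbhs near_withinE => near1.
near=> w; have [->|wz] := eqVneq w z.
  by rewrite subrr normr0 ltW.
by move: wz; near: w; exact: near1.
Unshelve. all: by end_near. Qed.

Lemma near_neq z a : z != a -> \forall w \near z, w != a.
Proof.
move=> za; have l : (w - a) @[w --> nbhs z] --> z - a.
  exact: (@cvgB _ _ _ (nbhs z) _ id (cst a) z a cvg_id (cvg_cst a)).
have za0 : z - a != 0 by rewrite subr_eq0.
by apply: filterS (cvgr_neq0 _ l za0) => w; rewrite subr_eq0.
Qed.

Lemma near_notin S z : \forall w \near z^', w \notin S.
Proof.
elim: S => [|p S IH]; first exact: nearW.
have np : \forall w \near z^', w != p.
  have [->|zp] := eqVneq z p; first exact: nbhs_dnbhs_neq.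
  by apply: nbhs_dnbhs; exact: near_neq.
by apply: filterS2 np IH => w wp wS; rewrite inE negb_or wp.
Qed.

Lemma exists_notin S : exists a : C, a \notin S.
Proof. by have [a] := filter_ex (near_notin S 0); exists a. Qed.

(** Finite sets have empty interior, so two continuous functions that agree off
    one agree. *)
Lemma eq_off_finite f S (c : C) : continuous f ->
  (forall z, z \notin S -> f z = c) -> forall z, f z = c.
Proof.
move=> cf fS z; have fc : f @ z^' --> c.
  apply: cvg_near_cst; apply: filterS (near_notin S z) => w; exact: fS.
have fz : f @ z^' --> f z by apply: cvg_trans (cf z); apply: cvg_within_filter.
exact: (cvg_unique _ fz fc).
Qed.

(** The quotient (f z - f a) / (z - a), with the derivative of f as its value at
    a.  Differentiability at a is lost, and a joins the exceptional set. *)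
Lemma divided_difference f S a : continuous f ->
  (forall z, z \notin S -> holomorphic_at f z) -> a \notin S ->
  exists h : C -> C, [/\ continuous h,
    forall z, z \notin a :: S -> holomorphic_at h z
  & forall z, f z = f a + (z - a) * h z].
Proof.
move=> cf fS aS; have quotient_cvg (F : set_system C) (FF : Filter F) (u : C -> C) z c l :
    id @ F --> z -> u @ F --> l -> z - a != 0 ->
    (u w - c) / (w - a) @[w --> F] --> (l - c) / (z - a).
  move=> Fz ul za; apply: cvgM; first by apply: cvgB => //; exact: cvg_cst.
  by apply: cvgV => //; apply: cvgB => //; exact: cvg_cst.
have near_cvg (F : set_system C) (FF : Filter F) (u v : C -> C) (l : C) :
    (\forall w \near F, u w = v w) -> u @ F --> l -> v @ F --> l.
  by move=> uv; apply: cvg_trans; apply: near_eq_cvg; apply: filterS uv.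
have [d fd] := fS a aS.
pose h z := if z == a then d else (f z - f a) / (z - a).
have hE z : z != a -> h z = (f z - f a) / (z - a) by rewrite /h => /negPf ->.
have ha : h a = d by rewrite /h eqxx.
exists h; split=> [z|z|z].
- have [->|za] := eqVneq z a.
    apply: continuous_punctured; rewrite ha; apply: cvg_trans fd.
    apply: near_eq_cvg; apply: filterS (nbhs_dnbhs_neq a) => w wa.
    by rewrite hE.
  have za0 : z - a != 0 by rewrite subr_eq0.
  have := quotient_cvg (nbhs z) (nbhs_filter z) f z (f a) (f z) cvg_id (cf z) za0.
  move=> lim; rewrite /continuous_at hE //; apply: (near_cvg (nbhs z) _ _ h _ _ lim).
  by apply: filterS (near_neq za) => w wa; rewrite hE.
- rewrite inE negb_or => /andP[za /fS[e fe]].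
  have za0 : z - a != 0 by rewrite subr_eq0.
  exists ((e - h z) / (z - a)).
  have := quotient_cvg (z^') (dnbhs_filter z) _ z (h z) _ (local_coord_id z).1 fe za0.
  move=> lim; apply: cvg_trans lim; apply: near_eq_cvg.
  apply: filterS2 (nbhs_dnbhs (near_neq za)) (nbhs_dnbhs_neq z) => w wa wz.
  rewrite !hE //; field.
  by rewrite !subr_eq0 wa wz za.
- have [->|za] := eqVneq z a; first by rewrite subrr mul0r addr0.
  by rewrite hE // mulrC divfK ?subr_eq0 // addrC subrK.
Qed.

Lemma holomorphic_atZ f a z :
  holomorphic_at f z -> holomorphic_at (fun w => a * f w) z.
Proof.
move=> fz; rewrite /holomorphic_at -[a * f z]addr0.
suff -> : (fun w => a * f w) = a *: f + cst 0.
  apply: (@differentiable_in_lin _ _ z^' id z) => //.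
  exact: differentiable_in_cst.
by apply/funext => w; rewrite [RHS]addr0.
Qed.

End HolomorphicAt.

(** * Goursat's lemma with finitely many exceptional points *)

Section Goursat.
Variable R : realType.
Local Notation C := R[i].
Implicit Types (f : C -> C) (x y l eps : R) (z : C) (S : seq C).
Local Open Scope classical_set_scope.

Lemma nested_intervals (a b : nat -> R) :
  (forall n, a n <= a n.+1) -> (forall n, b n.+1 <= b n) ->
  (forall n, a n <= b n) -> exists c, forall n, a n <= c <= b n.
Proof.
move=> incr decr ab.
have am m n : (m <= n)%N -> a m <= a n.
  exact: (@homo_leq _ a _ (@lexx _ _) (@le_trans _ _)).
have bm m n : (m <= n)%N -> b n <= b m.
  exact: (@homo_leq _ b (fun x y => y <= x) (@lexx _ _)
    (fun _ _ _ h1 h2 => le_trans h2 h1)).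
have abmn m n : a m <= b n.
  have [mn|/ltnW nm] := leqP m n; first exact: le_trans (am _ _ mn) (ab n).
  exact: le_trans (ab m) (bm _ _ nm).
have range0 : range a !=set0 by exists (a 0%N), 0%N.
have ub n : ubound (range a) (b n) by move=> _ [m _ <-].
have ha : has_sup (range a) by split => //; exists (b 0%N).
exists (sup (range a)) => n; apply/andP; split; last exact: ge_sup.
by apply: sup_upper_bound ha _ _; exists n.
Qed.

Lemma halving_lt (l d : R) : 0 < l -> 0 < d -> exists n, l / 2 ^+ n < d.
Proof.
move=> l0 d0; exists (Num.truncn (l / d)).+1.
rewrite ltr_pdivrMr ?exprn_gt0 // mulrC -ltr_pdivrMr //.
apply: lt_le_trans (truncnS_gt _) _.
by rewrite -natrX ler_nat ltnW // ltn_expl.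
Qed.

(** The tolerance allowed to the contour integral over a square with lower side at
    height y and side l: its area, plus l for every point of S at the height of
    the square.  The second term is what a bounded function can contribute near
    an exceptional point.  Heights are compared with both half-open intervals,
    so that a point at a height shared by two quarters is seen by each of them,
    while the weight stays additive under subdivision. *)
Definition weight S y l : R :=
  l ^+ 2 + \sum_(p <- S) l * ((y <= Im p < y + l)%R%:R + (y < Im p <= y + l)%R%:R).

Lemma weight_split S y l : 0 <= l ->
  weight S y (l + l) = 2 * weight S y l + 2 * weight S (y + l) l.
Proof.
move=> l0; rewrite /weight !mulrDr !mulr_sumr addrACA -big_split /=.
congr (_ + _); first by ring.
apply: eq_bigr => p _; set q := Im p.
have -> : (y <= q < y + (l + l))%R%:R
    = (y <= q < y + l)%R%:R + (y + l <= q < y + l + l)%R%:R :> R.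
  rewrite -natrD addrA; congr (_%:R).
  by case: (ltP q (y + l)) (leP y q) (ltP q (y + l + l)) => [?|?] [?|?] [?|?];
    rewrite /= ?addn0 //; exfalso; lra.
have -> : (y < q <= y + (l + l))%R%:R
    = (y < q <= y + l)%R%:R + (y + l < q <= y + l + l)%R%:R :> R.
  rewrite -natrD addrA; congr (_%:R).
  by case: (leP q (y + l)) (ltP y q) (leP q (y + l + l)) => [?|?] [?|?] [?|?];
    rewrite /= ?addn0 //; exfalso; lra.
by ring.
Qed.

Lemma weight_ge_sq S y l : 0 <= l -> l ^+ 2 <= weight S y l.
Proof.
move=> l0; rewrite lerDl sumr_ge0 // => p _.
by rewrite mulr_ge0 // addr_ge0 ?ler0n.
Qed.

Lemma weight_ge S p y l : 0 < l -> p \in S -> y <= Im p <= y + l ->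
  l <= weight S y l.
Proof.
move=> l0 pS /andP[yp py]; rewrite /weight.
rewrite ler_wpDl ?sqr_ge0 // (big_rem p) //= ler_wpDr //.
  by apply: sumr_ge0 => q _; rewrite mulr_ge0 ?(ltW l0) // addr_ge0 ?ler0n.
rewrite -[leLHS]mulr1 ler_pM2l // yp py andbT /=.
case: (ltP (Im p) (y + l)) => [_|h]; first by rewrite lerDl ler0n.
have -> : y < Im p by lra.
by rewrite add0r.
Qed.

Lemma holomorphic_at_affine f z (eta : R) : holomorphic_at f z -> 0 < eta ->
  exists a b : C, \forall w \near z, `|f w - (a + b * w)| <= eta%:C%C * `|w - z|.
Proof.
move=> [d fd] eta0; exists (f z - d * z), d.
have e0 : (0 : C) < eta%:C%C by rewrite ltcR.
have := cvgr_dist_le _ _ fd _ e0; rewrite /dnbhs near_withinE => near1.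
near=> w; have [->|wz] := eqVneq w z.
  by rewrite subrK !subrr !normr0 mulr0.
have wz0 : w - z != 0 by rewrite subr_eq0.
have -> : f w - (f z - d * z + d * w)
    = - ((d - (f w - f z) / (w - z)) * (w - z)).
  by rewrite mulrBl divfK //; ring.
rewrite normrN normrM ler_wpM2r //.
by move: wz; near: w; exact: near1.
Unshelve. all: by end_near. Qed.

Lemma near_square_sub (P : C -> Prop) z : (\forall w \near z, P w) ->
  exists2 d : R, 0 < d & forall x y l w, l < d -> in_square x y l z ->
    in_square x y l w -> P w.
Proof.
case/nbhs_ballP => _ /= /ltc_real[e e0 ->] Pe.
exists (e / 2) => [|x y l w le zs ws]; first by rewrite divr_gt0.
apply: Pe; rewrite -ball_normE /ball_ /=.
apply: le_lt_trans (norm_le_ReIm _) _; rewrite ltcR ReB ImB.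
move: zs ws => /andP[/andP[? ?] /andP[? ?]] /andP[/andP[? ?] /andP[? ?]].
apply: le_lt_trans (_ : l + l < _); last lra.
by apply: lerD; rewrite ler_norml; apply/andP; split; lra.
Qed.

Lemma in_square_dist x y l z w : in_square x y l z -> in_square x y l w ->
  `|w - z| <= (2 * l)%:C%C.
Proof.
move=> /andP[/andP[? ?] /andP[? ?]] /andP[/andP[? ?] /andP[? ?]].
apply: le_trans (norm_le_ReIm _) _; rewrite lecR ReB ImB mulr_natl mulr2n.
by apply: lerD; rewrite ler_norml; apply/andP; split; lra.
Qed.

(** At a point of differentiability the error of the affine approximation is
    small compared with l, and the integral small compared with l^2; at a point
    of S continuity makes it small compared with l.  The weight dominates
    both. *)
Lemma contour_small f S z eps : continuous f -> 0 < eps ->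
  (z \notin S -> holomorphic_at f z) ->
  exists2 d : R, 0 < d & forall x y l, 0 < l -> l < d -> in_square x y l z ->
    `|contour f x y l| <= eps * weight S y l.
Proof.
move=> cf eps0 fz; case: (boolP (z \in S)) => [zS|/fz hz].
  have e40 : (0 : C) < (eps / 4)%:C%C by rewrite ltcR divr_gt0.
  have near4 : \forall w \near z, `|f z - f w| <= (eps / 4)%:C%C.
    exact: cvgr_dist_le _ _ (cf z) _ e40.
  have [d d0 H] := near_square_sub near4; exists d => // x y l l0 ld zs.
  have := @contour_affine_bound _ f (f z) 0 x y l (eps / 4) cf (ltW l0).
  rewrite (_ : 4 * (eps / 4) = eps); last by field.
  move=> h; apply: le_trans (h _) _.
    move=> w ws; rewrite mul0r addr0 distrC.
    exact: H _ _ _ _ ld zs ws.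
  rewrite ler_pM2l //; apply: weight_ge zS _ => //.
  by have /andP[] := zs.
have eps8 : 0 < eps / 8 by rewrite divr_gt0.
have [a [b /near_square_sub[d d0 H]]] := holomorphic_at_affine hz eps8.
exists d => // x y l l0 ld zs.
have := @contour_affine_bound _ f a b x y l (eps / 8 * (2 * l)) cf (ltW l0).
rewrite (_ : 4 * (eps / 8 * (2 * l)) * l = eps * l ^+ 2); last by field.
move=> h; apply: le_trans (h _) _; last first.
  by rewrite ler_pM2l //; apply: weight_ge_sq; exact: ltW.
move=> w ws; apply: le_trans (H _ _ _ _ ld zs ws) _.
rewrite [leRHS]rmorphM /= ler_wpM2l ?ler0c ?(ltW eps8) //.
exact: in_square_dist zs ws.
Qed.

(** If the integral exceeds eps times the weight on a square, it does so on one of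
    its quarters, because both sides are additive.  Nested quarters shrink to a
    point, where this contradicts [contour_small]. *)
Theorem goursat f S x y l : continuous f -> 0 < l ->
  (forall z, z \notin S -> holomorphic_at f z) -> contour f x y l = 0.
Proof.
move=> cf l0 fS.
suff small eps : 0 < eps -> `|contour f x y l| <= eps * weight S y l.
  apply/eqP; rewrite -normr_eq0; apply/eqP/le_anti; rewrite normr_ge0 andbT.
  have w0 : 0 < weight S y l.
    by apply: lt_le_trans (weight_ge_sq _ _ (ltW l0)); rewrite exprn_gt0.
  apply/ler_addgt0Pl => e e0; rewrite addr0.
  by have := small _ (divr_gt0 e0 w0); rewrite divfK ?gt_eqF.
move=> eps0; rewrite leNgt; apply/negP => large.
pose bad m (p : R * R) := eps * weight S p.2 m < `|contour f p.1 p.2 m|.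
have quarter m p : 0 < m -> bad (m + m) p -> exists q,
    [/\ bad m q, p.1 <= q.1 & q.1 + m <= p.1 + (m + m)]
    /\ (p.2 <= q.2 /\ q.2 + m <= p.2 + (m + m)).
  case: p => [u v] m0; rewrite /bad /= contour_split ?(ltW m0) // => big.
  have [b1|s1] := boolP (bad m (u, v)).
    by exists (u, v); do !split => //=; lra.
  have [b2|s2] := boolP (bad m (u + m, v)).
    by exists (u + m, v); do !split => //=; lra.
  have [b3|s3] := boolP (bad m (u, v + m)).
    by exists (u, v + m); do !split => //=; lra.
  have [b4|s4] := boolP (bad m (u + m, v + m)).
    by exists (u + m, v + m); do !split => //=; lra.
  move: big s1 s2 s3 s4; rewrite /bad /= -!leNgt weight_split ?(ltW m0) //.
  move=> big s1 s2 s3 s4; exfalso; move: big; apply/negP; rewrite -leNgt.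
  apply: le_trans (ler_normD _ _) _.
  apply: le_trans (lerD (ler_normD _ _) s4) _.
  apply: le_trans (lerD (lerD (ler_normD _ _) s3) (lexx _)) _.
  apply: le_trans (lerD (lerD (lerD s1 s2) (lexx _)) (lexx _)) _.
  by rewrite [leRHS]mulrDr; lra.
pose m n : R := l / 2 ^+ n.
have m0 n : 0 < m n by rewrite divr_gt0 ?exprn_gt0.
have mS n : m n = m n.+1 + m n.+1.
  by rewrite /m exprS; field; rewrite expf_neq0.
have [p [p00 pS]] : exists p : nat -> R * R, p 0%N = (x, y) /\ forall n,
    [/\ bad (m n) (p n), (p n).1 <= (p n.+1).1
      & (p n.+1).1 + m n.+1 <= (p n).1 + m n]
    /\ ((p n).2 <= (p n.+1).2 /\ (p n.+1).2 + m n.+1 <= (p n).2 + m n).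
  have next n q : bad (m n) q -> {q' | [/\ bad (m n.+1) q', q.1 <= q'.1
      & q'.1 + m n.+1 <= q.1 + m n]
      /\ (q.2 <= q'.2 /\ q'.2 + m n.+1 <= q.2 + m n)}.
    by move=> bq; apply: cid; rewrite (mS n); apply: quarter => //; rewrite -mS.
  pose fix sq n : {q | bad (m n) q} :=
    if n is n'.+1 then
      let: exist q bq := sq n' in
      let: exist q' bq' := next n' q bq in
      exist _ q' (let: conj (And3 h _ _) _ := bq' in h)
    else exist _ (x, y) (eq_ind_r (fun t => bad t (x, y)) large (divr1 l)).
  exists (fun n => sval (sq n)); split=> // n; rewrite /=.
  by case: (sq n) => q bq /=; case: (next n q bq) => q' [[? ? ?] ?].
have [c hc] := @nested_intervals (fun n => (p n).1) (fun n => (p n).1 + m n)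
  (fun n => let: conj (And3 _ h _) _ := pS n in h)
  (fun n => let: conj (And3 _ _ h) _ := pS n in h)
  (fun n => ltW (ltr_pwDr (m0 n) (lexx _))).
have [d hd] := @nested_intervals (fun n => (p n).2) (fun n => (p n).2 + m n)
  (fun n => let: conj _ (conj h _) := pS n in h)
  (fun n => let: conj _ (conj _ h) := pS n in h)
  (fun n => ltW (ltr_pwDr (m0 n) (lexx _))).
have [r r0 small] := contour_small cf eps0 (fS (c +i* d)%C).
have [n mr] := halving_lt l0 r0.
have := small (p n).1 (p n).2 (m n) (m0 n) mr; rewrite /in_square /= hc hd.
move=> /(_ isT); apply/negP; rewrite -ltNge.
by have [[]] := pS n.
Qed.

End Goursat.

(** * Liouville's theorem for functions of polynomial growth *)

Section Liouville.
Variable R : realType.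
Local Notation C := R[i].
Implicit Types (f g : C -> C) (a b z w : C) (S : seq C).
Local Open Scope classical_set_scope.

Lemma ReD z w : Re (z + w) = Re z + Re w.
Proof. by case: z w => [? ?] [? ?]; reflexivity. Qed.

Lemma ImD z w : Im (z + w) = Im z + Im w.
Proof. by case: z w => [? ?] [? ?]; reflexivity. Qed.

Lemma norm_real (a : C) : exists2 r : R, 0 <= r & `|a| = r%:C%C.
Proof. by exists (Num.sqrt (Re a ^+ 2 + Im a ^+ 2)); rewrite ?sqrtr_ge0 ?normc_def. Qed.

(** On a square around 0 the real part keeps a sign along each horizontal side, and
    the imaginary part along each vertical one; the factor 'i is chosen for this. *)
Lemma re_im_pole (x y : R) : (x != 0) || (y != 0) ->
  Re ('i%C / (4 * (x +i* y)%C)) = y / (4 * (x ^+ 2 + y ^+ 2)) /\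
  Im ('i%C / (4 * (x +i* y)%C)) = x / (4 * (x ^+ 2 + y ^+ 2)).
Proof.
move=> xy0.
have n0 : x ^+ 2 + y ^+ 2 != 0.
  by rewrite paddr_eq0 ?sqr_ge0 // !sqrf_eq0 negb_and.
have -> : 'i%C / (4 * (x +i* y)%C) =
    ((y / (4 * (x ^+ 2 + y ^+ 2))) +i* (x / (4 * (x ^+ 2 + y ^+ 2))))%C.
  have z0 : (4 * (x +i* y)%C : C) != 0.
    rewrite mulf_neq0 ?pnatr_eq0 // eq_complex /= negb_and.
    exact: xy0.
  apply: (mulIf z0); rewrite divfK //.
  have -> : (4 : C) = (4 : R)%:C%C by rewrite rmorph_nat.
  apply/eqP; rewrite eq_complex /=; apply/andP; split; apply/eqP; field => //.
by [].
Qed.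

(** Suppose f b <> 0, and let k be 'i / (4 f b) times the divided difference of f
    at b.  On a large square around b the function k is close to
    - 'i / (4 (z - b)), for which each of the four sides contributes a positive
    amount to the contour integral.  But this integral is 0. *)
Lemma holomorphic_vanish_at f S b : continuous f ->
  (forall z, z \notin S -> holomorphic_at f z) ->
  (forall e : R, 0 < e -> exists r : R, forall z, r%:C%C <= `|z| -> `|f z| <= e%:C%C) ->
  b \notin S -> f b = 0.
Proof.
move=> cf fS decay bS; apply: contraTeq isT => fb0 /=.
have [h [ch hS fh]] := divided_difference cf fS bS.
pose c := f b; have [nc nc0 ncE] := norm_real c; have [nb nb0 nbE] := norm_real b.
have nc_gt0 : 0 < nc by rewrite -ltcR -ncE normr_gt0.
have [r0 hr0] := decay (nc / 4) (divr_gt0 nc_gt0 (ltr0n _ 4)).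
(* For |z - b| >= r this makes |z| >= r0, where f is small. *)
pose r : R := `|r0| + nb + 1; have r_gt0 : 0 < r by rewrite ltr_wpDl // addr_ge0.
pose k z := ('i%C / (4 * c)) * h z.
have ck : continuous k by move=> z; exact: (cvgM (cvg_cst _) (ch z)).
have kS z : z \notin b :: S -> holomorphic_at k z by move/hS; exact: holomorphic_atZ.
have near_pole z : r%:C%C <= `|z - b| ->
    `|k z + 'i%C / (4 * (z - b))| <= ((16 * r)^-1)%:C%C.
  move=> rz.
  have zb0 : 0 < `|z - b| by apply: lt_le_trans rz; rewrite ltcR.
  have zb : z - b != 0 by rewrite -normr_gt0.
  have -> : k z + 'i%C / (4 * (z - b)) = 'i%C * f z / (4 * c * (z - b)).
    by rewrite /k fh -/c; field; rewrite ?zb ?fb0.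
  have fz : `|f z| <= (nc / 4)%:C%C.
    apply: hr0; have := le_trans rz (ler_normB _ _).
    rewrite nbE; have [nz _ ->] := norm_real z; rewrite -rmorphD !lecR /r.
    have := ler_norm r0; lra.
  rewrite !normrM normfV !normrM normc_i mul1r normr_nat.
  rewrite ler_pdivrMr ?mulr_gt0 ?normr_gt0 //.
  apply: le_trans fz _; rewrite ncE.
  apply: (@le_trans _ _ (((16 * r)^-1)%:C%C * (4 * nc%:C%C * r%:C%C))).
    rewrite (_ : 4 = (4 : R)%:C%C); last by rewrite rmorph_nat.
    rewrite -!rmorphM lecR le_eqVlt; apply/orP; left; apply/eqP; field.
    by rewrite gt_eqF.
  rewrite ler_wpM2l ?ler0c ?invr_ge0 ?mulr_ge0 ?(ltW r_gt0) //.
  by rewrite ler_wpM2l ?mulr_ge0 ?ler0c.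
suff : 0 < contour k (Re b - r) (Im b - r) (r + r).
  by rewrite (goursat _ _ ck _ kS) ?ltxx // addr_gt0.
have side (s t : R) : r ^+ 2 <= s ^+ 2 + t ^+ 2 ->
    let z : C := ((Re b + s) +i* (Im b + t))%C in
    `|Re (k z) + t / (4 * (s ^+ 2 + t ^+ 2))| <= (16 * r)^-1 /\
    `|Im (k z) + s / (4 * (s ^+ 2 + t ^+ 2))| <= (16 * r)^-1.
  move=> rst z; have zbE : z - b = (s +i* t)%C.
    apply/eqP; rewrite eq_complex ReB ImB /=.
    by apply/andP; split; apply/eqP; ring.
  have st0 : (s != 0) || (t != 0).
    rewrite -negb_and; apply: contraL rst => /andP[/eqP -> /eqP ->].
    by rewrite -ltNge expr0n /= addr0 exprn_gt0.
  have [reE imE] := re_im_pole st0.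
  have : `|k z + 'i%C / (4 * (z - b))| <= ((16 * r)^-1)%:C%C.
    apply: near_pole; rewrite zbE normc_def lecR /=.
    by rewrite -[leLHS]gtr0_norm // -sqrtr_sqr ler_wsqrtr.
  rewrite zbE => le; move: (abs_Re_le le) (abs_Im_le le).
  by rewrite ReD ImD reE imE.
have pole_ge (N : R) : r ^+ 2 <= N -> N <= 2 * r ^+ 2 -> 1 / (8 * r) <= r / (4 * N).
  move=> rN Nr; have N0 : 0 < N by apply: lt_le_trans rN; rewrite exprn_gt0.
  rewrite ler_pdivrMr ?mulr_gt0 // mulrAC ler_pdivlMr ?mulr_gt0 //.
  by nra.
have small (s : R) : - r <= s <= r -> s ^+ 2 <= r ^+ 2 by move=> /andP[? ?]; nra.
(* The pole contributes at least 1 / (8 r), and the error is at most half of it. *)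
have k16 : 1 / (8 * r) = 2 * ((16 * r)^-1) by field; rewrite gt_eqF.
have c16 : 0 < (16 * r)^-1 by rewrite invr_gt0 mulr_gt0.
have ir : r ^+ 2 = (- r) ^+ 2 by rewrite sqrrN.
have sides (s : R) : - r <= s <= r ->
    [/\ (16 * r)^-1 <= Re (k ((Re b + s) +i* (Im b - r))%C),
        Re (k ((Re b + s) +i* (Im b + r))%C) <= - (16 * r)^-1,
        Im (k ((Re b + r) +i* (Im b + s))%C) <= - (16 * r)^-1
      & (16 * r)^-1 <= Im (k ((Re b - r) +i* (Im b + s))%C)].
  move=> /small sr; have s0 := sqr_ge0 s.
  have g1 : r ^+ 2 <= s ^+ 2 + r ^+ 2 by lra.
  have g2 : r ^+ 2 <= s ^+ 2 + (- r) ^+ 2 by lra.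
  have g3 : r ^+ 2 <= r ^+ 2 + s ^+ 2 by lra.
  have g4 : r ^+ 2 <= (- r) ^+ 2 + s ^+ 2 by lra.
  have [h1 _] := side _ _ g1; have [h2 _] := side _ _ g2.
  have [_ h3] := side _ _ g3; have [_ h4] := side _ _ g4.
  have p1 : 1 / (8 * r) <= r / (4 * (s ^+ 2 + r ^+ 2)).
    by apply: pole_ge => //; clear -sr; lra.
  have p3 : 1 / (8 * r) <= r / (4 * (r ^+ 2 + s ^+ 2)).
    by apply: pole_ge => //; clear -sr; lra.
  move: h1 h2 h3 h4; rewrite -!ir !mulNr !ler_norml.
  move=> /andP[_ h1] /andP[h2 _] /andP[_ h3] /andP[h4 _].
  by clear -h1 h2 h3 h4 p1 p3 k16; split; lra.
have rr : 0 <= r + r by rewrite addr_ge0 // ltW.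
have sE (x : R) : x - r + (r + r) = x + r by ring.
have mid (x t : R) : x - r <= t <= x + r -> - r <= t - x <= r.
  by move=> /andP[? ?]; apply/andP; split; lra.
have tE (x t : R) : t = x + (t - x) by ring.
have le2 (x : R) : x - r <= x + r by lra.
have len (x : R) : x + r - (x - r) = r + r by ring.
have bot : (16 * r)^-1 * (r + r) <= horint k (Im b - r) (Re b - r) (Re b + r).
  rewrite -(len (Re b)); apply: segint_ge (continuous_Re_hor ck) (le2 _) _
    => t /mid/sides[+ _ _ _].
  by rewrite -tE.
have top : horint k (Im b + r) (Re b - r) (Re b + r) <= - (16 * r)^-1 * (r + r).
  rewrite -(len (Re b)); apply: segint_le (continuous_Re_hor ck) (le2 _) _
    => t /mid/sides[_ + _ _].
  by rewrite -tE.
have rgt : verint k (Re b + r) (Im b - r) (Im b + r) <= - (16 * r)^-1 * (r + r).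
  rewrite -(len (Im b)); apply: segint_le (continuous_Im_ver ck) (le2 _) _
    => t /mid/sides[_ _ + _].
  by rewrite -tE.
have lft : (16 * r)^-1 * (r + r) <= verint k (Re b - r) (Im b - r) (Im b + r).
  rewrite -(len (Im b)); apply: segint_ge (continuous_Im_ver ck) (le2 _) _
    => t /mid/sides[_ _ _ +].
  by rewrite -tE.
rewrite /contour !sE.
have : 0 < (16 * r)^-1 * (r + r) by rewrite mulr_gt0 // addr_gt0.
move: bot top rgt lft; rewrite mulNr; lra.
Qed.

Lemma holomorphic_vanish f S : continuous f ->
  (forall z, z \notin S -> holomorphic_at f z) ->
  (forall e : R, 0 < e -> exists r : R, forall z, r%:C%C <= `|z| -> `|f z| <= e%:C%C) ->
  forall z, f z = 0.
Proof.
move=> cf fS decay; apply: (eq_off_finite (S := S)) => // z; exact: holomorphic_vanish_at.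
Qed.

(** A divided difference at a point of differentiability lowers the growth by one
    degree, down to functions that tend to 0 at infinity.  Writing the bound
    with the factor |z| on the left makes these the case N = 0. *)
Theorem liouville f S N (M r : R) : continuous f ->
  (forall z, z \notin S -> holomorphic_at f z) ->
  (forall z, r%:C%C <= `|z| -> `|z| * `|f z| <= M%:C%C * `|z| ^+ N) ->
  exists2 p : {poly C}, (size p <= N)%N & forall z, f z = p.[z].
Proof.
elim: N S M r f => [|N IH] S M r f cf fS growth.
  exists 0; rewrite ?size_poly0 // => z; rewrite horner0.
  apply: (holomorphic_vanish cf fS) => e e0; exists (`|r| + `|M| / e + 1) => w rw.
  have [n n0 nE] := norm_real w; have gw := growth w.
  have {}rw : `|r| + `|M| / e + 1 <= n by rewrite -lecR -nE.
  rewrite nE expr0 mulr1 lecR in gw.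
  have Me : 0 <= `|M| / e by rewrite divr_ge0 // ltW.
  have npos : 0 < n by apply: lt_le_trans rw; rewrite ltr_wpDl // addr_ge0.
  have n0' : (0 : C) < n%:C%C by rewrite ltcR.
  rewrite -(ler_pM2l n0'); apply: le_trans (gw _) _.
    by apply: le_trans rw; have := ler_norm r; lra.
  rewrite -rmorphM lecR; apply: le_trans (ler_norm M) _.
  rewrite -ler_pdivrMr //; have := normr_ge0 r; lra.
have [a aS] := exists_notin S.
have [h [ch hS fh]] := divided_difference cf fS aS.
have [na na0 naE] := norm_real a; have [nf nf0 nfE] := norm_real (f a).
have [|p sp hp] := IH (a :: S) (2 * (`|M| + nf)) (`|r| + 2 * na + 1) h ch hS.
  move=> z rz; have [n n0 nE] := norm_real z.
  have {}rz : `|r| + 2 * na + 1 <= n by rewrite -lecR -nE.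
  have gz := growth z; rewrite nE lecR in gz; rewrite nE.
  have n1 : 1 <= n by have := normr_ge0 r; lra.
  have n0' : (0 : C) < n%:C%C by rewrite ltcR; lra.
  have half : (n / 2)%:C%C <= `|z - a|.
    apply: le_trans (lerB_dist _ _); rewrite nE naE -rmorphB lecR.
    have := normr_ge0 r; lra.
  have nh : (0 : C) < (n / 2)%:C%C by rewrite ltcR; lra.
  have fz : `|f z| <= (`|M| * n ^+ N)%:C%C.
    rewrite -(ler_pM2l n0'); apply: le_trans (gz _) _.
      by have := ler_norm r; lra.
    rewrite -rmorphXn -!rmorphM lecR exprS mulrCA ler_wpM2l //.
    by rewrite ler_wpM2r ?exprn_ge0 ?ler_norm.
  have fza : `|f z - f a| <= ((`|M| + nf) * n ^+ N)%:C%C.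
    apply: le_trans (ler_normB _ _) _; rewrite mulrDl rmorphD; apply: lerD => //.
    by rewrite nfE lecR ler_peMr // exprn_ege1.
  have : (n / 2)%:C%C * `|h z| <= ((`|M| + nf) * n ^+ N)%:C%C.
    apply: le_trans fza; rewrite fh addrC addKr normrM ler_wpM2r //.
  move=> nhz; have two : (2 : R)%:C%C = 2 :> C by rewrite rmorph_nat.
  have -> : n%:C%C * `|h z| = 2 * ((n / 2)%:C%C * `|h z|).
    have nn : n = 2 * (n / 2) by field.
    by rewrite {1}nn rmorphM [X in X * _ * _]two -mulrA.
  have -> : (2 * (`|M| + nf))%:C%C * n%:C%C ^+ N = 2 * ((`|M| + nf) * n ^+ N)%:C%C.
    by rewrite -two -rmorphXn -!rmorphM /= mulrA.
  by rewrite ler_pM2l ?ltr0n.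
exists ((f a)%:P + p * ('X - a%:P)).
  rewrite (leq_trans (size_polyD _ _)) // geq_max.
  rewrite (leq_trans (size_polyC_leq1 _)) //=.
  apply: leq_trans (size_polyMleq _ _) _.
  by rewrite size_XsubC addn2.
by move=> z; rewrite fh hp !hornerE mulrC.
Qed.

End Liouville.

(** * The functions X, Y and 1 / (X - e1) on the curve *)

Section MeromorphicBounded.
Variables (C : numClosedFieldType) (T : Type) (F : set_system T) (t : T -> C).
Context {FF : Filter F}.
Local Open Scope classical_set_scope.

Lemma cvg0_mul_bounded (u v : T -> C) (B : C) :
  u @ F --> 0 -> (\forall q \near F, `|v q| <= B) -> (u q * v q) @[q --> F] --> 0.
Proof.
move=> u0 vB; apply/cvgr0Pnorm_le => e e0.
have B0 : 0 < `|B| + 1 by rewrite ltr_wpDl.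
near=> q; have vq : `|v q| <= B by near: q.
have uq : `|u q| <= e / (`|B| + 1).
  by near: q; apply: cvgr0_norm_le u0 _ _; exact: divr_gt0.
rewrite normrM.
rewrite -[leRHS](divfK (lt0r_neq0 B0)); apply: ler_pM => //.
have Bpos : 0 <= B by apply: le_trans vq.
by rewrite (ger0_norm Bpos); apply: le_trans vq _; rewrite lerDl.
Unshelve. all: by end_near. Qed.

(** One more power of t than is needed for boundedness gives the limit 0, and a
    second one the derivative 0. *)
Lemma meromorphic_bounded (u : T -> C) n (B : C) : t @ F --> 0 ->
  (\forall q \near F, `|t q ^+ n * u q| <= B) -> meromorphic_in F t u.
Proof.
move=> t0 tuB; exists n.+2, 0, 0.
have := cvg0_mul_bounded t0 tuB; apply: cvg_trans; apply: near_eq_cvg.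
apply: nearW => q; rewrite !subr0.
have [->|tq] := eqVneq (t q) 0; first by rewrite !mul0r exprS !mul0r.
by rewrite !exprS; field.
Qed.

Lemma differentiable_in_inv (t0 : C) (f : T -> C) (c : C) :
  f @ F --> c -> c != 0 -> differentiable_in F t t0 f c ->
  differentiable_in F t t0 (fun q => (f q)^-1) c^-1.
Proof.
move=> fc c0 [d fd]; exists (- d / (c * c)).
have lim : (- ((f q - c) / (t q - t0)) / (f q * c)) @[q --> F] --> - d / (c * c).
  apply: cvgM; first exact: cvgN.
  by apply: cvgV; [rewrite mulf_neq0|apply: cvgM => //; exact: cvg_cst].
apply: cvg_trans lim; apply: near_eq_cvg.
apply: filterS (cvgr_neq0 _ fc c0) => q fq.
have [->|tq] := eqVneq (t q) t0; first by rewrite subrr invr0 !mulr0 oppr0 mul0r.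
by field; rewrite fq c0 subr_eq0 tq.
Qed.

End MeromorphicBounded.

Section Curve.
Variables (C : numClosedFieldType) (e1 e2 : C).
Local Notation e3 := (- (e1 + e2)).
Hypotheses (e12 : e1 != e2) (e13 : e1 != e3) (e23 : e2 != e3).
Local Notation point := (curve_point e1 e2).
Local Notation dnbhs_curve := (@curve_dnbhs C e1 e2).
Local Notation infty_curve := (@curve_infty C e1 e2).
Implicit Types (p : C * C) (q : point) (x y : C).
Local Open Scope classical_set_scope.

Local Existing Instance curve_dnbhs_filter.
Lemma infty_filter : Filter (infty_curve).
Proof. exact: curve_infty_filter. Qed.
Local Existing Instance infty_filter.

Lemma curveE q : Yc q ^+ 2 = 4 * (Xc q - e1) * (Xc q - e2) * (Xc q - e3).
Proof. by have /andP[/eqP] := valP q. Qed.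

Lemma val_curveE q : val q = (Xc q, Yc q).
Proof. exact: surjective_pairing. Qed.

Lemma Xc_e1 q : Xc q != e1.
Proof.
apply/eqP => Xe; have /andP[_] := valP q; apply/negP; rewrite negbK.
have := curveE q; rewrite Xe subrr mulr0 !mul0r => /eqP; rewrite sqrf_eq0 => /eqP Y0.
by apply/eqP; rewrite val_curveE Xe Y0.
Qed.

Lemma on_curve_sqr x y : on_curve e1 e2 (x, y) =
  (y ^+ 2 == 4 * (x - e1) * (x - e2) * (x - e3)).
Proof. by []. Qed.

Lemma point_of x y : x != e1 -> on_curve e1 e2 (x, y) ->
  exists2 q : point, Xc q = x & Yc q = y.
Proof.
move=> xe1 xy.
have h : on_curve e1 e2 (x, y) && ((x, y) != (e1, 0)).
  by rewrite xy /=; apply: contra xe1 => /eqP[->].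
by exists (exist _ (x, y) h).
Qed.

Lemma Xc_cvg p : (@Xc C e1 e2) @ dnbhs_curve p --> p.1.
Proof.
move=> U /= hU; exists (fst @^-1` U) => //.
by apply: nbhs_dnbhs; exact: cvg_fst.
Qed.

Lemma Yc_cvg p : (@Yc C e1 e2) @ dnbhs_curve p --> p.2.
Proof.
move=> U /= hU; exists (snd @^-1` U) => //.
by apply: nbhs_dnbhs; exact: cvg_snd.
Qed.

Lemma near_curve_neq p : \forall q \near dnbhs_curve p, (val q : C * C) != p.
Proof.
exists [set x | x != p] => //=.
by apply: filterS (nbhs_dnbhs_neq p) => q.
Qed.

Lemma near_Xc_neq p x : p.1 != x -> \forall q \near dnbhs_curve p, Xc (q : point) != x.
Proof.
move=> px; have l : (Xc (q : point) - x) @[q --> dnbhs_curve p] --> p.1 - x.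
  by apply: cvgB; [exact: Xc_cvg|exact: cvg_cst].
have px0 : p.1 - x != 0 by rewrite subr_eq0.
by apply: filterS (cvgr_neq0 _ l px0) => q; rewrite subr_eq0.
Qed.

Lemma Yc_eq0 q : Yc q = 0 -> Xc q = e2 \/ Xc q = e3.
Proof.
move=> Y0; have := curveE q; rewrite Y0 expr0n /= => /esym/eqP.
rewrite !mulf_eq0 pnatr_eq0 /= !subr_eq0 (negPf (Xc_e1 q)) /=.
by move=> /orP[] /eqP; [left|right].
Qed.

(** Besides (e1, 0), which has been removed, only (e2, 0) and (e3, 0) have Y = 0,
    and they are isolated from one another. *)
Lemma near_Yc_neq0 p : p.2 = 0 -> \forall q \near dnbhs_curve p, Yc (q : point) != 0.
Proof.
move=> p2.
have ne e : \forall q \near dnbhs_curve p, p.1 != e -> Xc (q : point) != e.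
  have [_|pe] := eqVneq p.1 e; first exact: nearW.
  by apply: filterS (near_Xc_neq pe).
apply: filterS3 (near_curve_neq p) (ne e2) (ne e3) => q qp n2 n3.
apply: contra qp => /eqP Y0; rewrite val_curveE Y0 -p2; apply/eqP.
suff -> : Xc q = p.1 by rewrite -surjective_pairing.
case: (Yc_eq0 Y0) => Xe; apply/eqP; apply: contraT; rewrite Xe eq_sym.
  by move/n2; rewrite Xe eqxx.
by move/n3; rewrite Xe eqxx.
Qed.

Lemma local_coord_Yc p : p.2 = 0 -> local_coord (dnbhs_curve p) (@Yc C e1 e2) 0.
Proof. by move=> p2; split; [rewrite -p2; exact: Yc_cvg|exact: near_Yc_neq0]. Qed.

(** Near infinity the three factors of the cubic have the size of X, up to
    factors 1 / 2 and 2, so that Y^2 has the size of X^3. *)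
Lemma infty_bounds (N : C) : 0 <= N -> \forall q \near infty_curve,
  [/\ N <= `|Xc q|, `|Xc q| / 2 <= `|Xc q - e1|,
      `|Xc q| ^+ 3 / 2 <= `|Yc q| ^+ 2 & `|Yc q| ^+ 2 <= 32 * `|Xc q| ^+ 3].
Proof.
move=> N0; pose k := `|e1| + `|e2| + `|e3|.
have k0 : 0 <= k by rewrite !addr_ge0.
have e1k : `|e1| <= k by rewrite /k -addrA lerDl addr_ge0.
have e2k : `|e2| <= k by rewrite /k addrAC lerDr addr_ge0.
have e3k : `|e3| <= k by rewrite /k lerDr addr_ge0.
exists (2 * k + 1 + N) => [|q] /=; first by rewrite ltr_wpDr // ltr_wpDl // mulr_ge0.
set r := `|Xc q| => kr.
have r0 : 0 <= r by exact: normr_ge0.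
have r20 : 0 <= r / 2 by rewrite divr_ge0.
have kr2 : k <= r / 2.
  rewrite ler_pdivlMr // mulrC; apply: le_trans (ltW kr).
  by rewrite -addrA lerDl addr_ge0.
have rE : r = r / 2 + r / 2 by field.
have lo e : `|e| <= k -> r / 2 <= `|Xc q - e|.
  move=> ek; apply: le_trans (lerB_dist _ _); rewrite lerBrDl -lerBrDr.
  by rewrite {1}/r -/r {1}rE addrK (le_trans ek).
have hi e : `|e| <= k -> `|Xc q - e| <= 2 * r.
  move=> ek; apply: le_trans (ler_normB _ _) _; rewrite mulr_natl mulr2n lerD2l.
  apply: le_trans ek _; apply: le_trans kr2 _.
  by rewrite {2}rE lerDl.
have YE : `|Yc q| ^+ 2 = 4 * `|Xc q - e1| * `|Xc q - e2| * `|Xc q - e3|.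
  by rewrite -normrX curveE !normrM normr_nat.
split.
- by apply: le_trans (ltW kr); rewrite lerDr addr_ge0 // mulr_ge0.
- exact: lo.
- rewrite YE (_ : r ^+ 3 / 2 = 4 * (r / 2) * (r / 2) * (r / 2)); last by field.
  have l1 := lo _ e1k; have l2 := lo _ e2k; have l3 := lo _ e3k.
  by apply: ler_pM l3; rewrite ?mulr_ge0 //;
    apply: ler_pM l2; rewrite ?mulr_ge0 // ler_wpM2l.
- rewrite YE (_ : 32 * r ^+ 3 = 4 * (2 * r) * (2 * r) * (2 * r)); last by ring.
  have h1 := hi _ e1k; have h2 := hi _ e2k; have h3 := hi _ e3k.
  by apply: ler_pM h3; rewrite ?mulr_ge0 //;
    apply: ler_pM h2; rewrite ?mulr_ge0 // ler_wpM2l.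
Qed.

Definition Wc q : C := Xc q - e1.

Lemma cubic_slope x0 q : 4 * (Xc q - e1) * (Xc q - e2) * (Xc q - e3)
    - 4 * (x0 - e1) * (x0 - e2) * (x0 - e3)
  = (Xc q - x0) * (4 * ((Xc q - e2) * (Xc q - e3) + (x0 - e1) * (Xc q - e3)
                        + (x0 - e1) * (x0 - e2))).
Proof. by ring. Qed.

(** At a point with Y = 0 the curve is Y^2 = (X - p.1) g with g <> 0, hence
    (X - p.1) / Y = Y / g tends to 0. *)
Lemma differentiable_Xc_torsion p : p.2 = 0 -> p.1 = e2 \/ p.1 = e3 ->
  differentiable_in (dnbhs_curve p) (@Yc C e1 e2) 0 (@Xc C e1 e2) p.1.
Proof.
move=> p2 p1.
have [e [ee1 ee Yfac]] : exists e, [/\ p.1 != e1, p.1 != e &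
    forall q, Yc q ^+ 2 = (Xc q - p.1) * (4 * (Xc q - e1) * (Xc q - e))].
  by case: p1 => ->; [exists e3|exists e2]; split=> [||q]; rewrite ?curveE;
    do ?[by []|by rewrite eq_sym|by ring].
exists 0.
pose g q := 4 * (Xc q - e1) * (Xc q - e).
have g0 : 4 * (p.1 - e1) * (p.1 - e) != 0.
  by rewrite !mulf_neq0 ?pnatr_eq0 ?subr_eq0.
have gl : g @ dnbhs_curve p --> 4 * (p.1 - e1) * (p.1 - e).
  apply: cvgM; last by apply: cvgB; [exact: Xc_cvg|exact: cvg_cst].
  apply: cvgM; first exact: cvg_cst.
  by apply: cvgB; [exact: Xc_cvg|exact: cvg_cst].
have Yl := Yc_cvg (p := p); rewrite p2 in Yl.
have lim : (Yc (q : point) * (g q)^-1) @[q --> dnbhs_curve p]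
    --> 0 * (4 * (p.1 - e1) * (p.1 - e))^-1.
  by apply: cvgM => //; apply: cvgV.
rewrite mul0r in lim; apply: cvg_trans lim; apply: near_eq_cvg.
near=> q; have Yq : Yc (q : point) != 0 by near: q; exact: near_Yc_neq0.
have gq : g q != 0 by near: q; exact: cvgr_neq0 gl g0.
have XE : Xc q - p.1 = Yc q ^+ 2 / g q by rewrite Yfac mulfK.
by rewrite XE subr0; field; rewrite Yq gq.
Unshelve. all: by end_near. Qed.

Lemma local_coord_Xc q0 : Yc q0 != 0 ->
  local_coord (dnbhs_curve (val q0)) (@Xc C e1 e2) (Xc q0).
Proof.
move=> Y0; split; first exact: Xc_cvg.
have l : (Yc q + Yc q0) @[q --> dnbhs_curve (val q0)] --> Yc q0 + Yc q0.
  by apply: cvgD; [exact: Yc_cvg|exact: cvg_cst].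
have s0 : Yc q0 + Yc q0 != 0 by rewrite -mulr2n mulrn_eq0.
near=> q; have qq0 : (val q : C * C) != val q0 by near: q; exact: near_curve_neq.
have s : Yc q + Yc q0 != 0 by near: q; exact: cvgr_neq0 l s0.
apply: contra qq0 => /eqP Xq; rewrite !val_curveE Xq; apply/eqP; congr (_, _).
have /eqP := curveE q; rewrite Xq -curveE eqf_sqr => /orP[/eqP //|].
by rewrite -addr_eq0 (negPf s).
Unshelve. all: by end_near. Qed.

Lemma holomorphic_Xc : holomorphic (@Xc C e1 e2).
Proof.
move=> q0; rewrite /curve_coord; case: ifPn => [/eqP Y0|Y0].
  by rewrite Y0; apply: differentiable_Xc_torsion => //; exact: Yc_eq0.
exact: differentiable_in_coord (local_coord_Xc Y0).
Qed.

Lemma holomorphic_Wc : holomorphic Wc.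
Proof.
move=> q0; have [d Xd] := holomorphic_Xc q0; exists d.
apply: cvg_trans Xd; apply: near_eq_cvg; apply: nearW => q.
by rewrite /Wc opprB addrA subrK.
Qed.

Lemma Wc_neq0 q : Wc q != 0.
Proof. by rewrite subr_eq0 Xc_e1. Qed.

Lemma holomorphic_WcV : holomorphic (fun q => (Wc q)^-1).
Proof.
move=> q0; apply: differentiable_in_inv (holomorphic_Wc q0); last exact: Wc_neq0.
by apply: cvgB; [exact: Xc_cvg|exact: cvg_cst].
Qed.

(** At a point with Y <> 0 the slope of Y is that of the cubic divided by the sum
    of the two values of Y. *)
Lemma holomorphic_Yc : holomorphic (@Yc C e1 e2).
Proof.
move=> q0; rewrite /curve_coord; case: ifPn => [/eqP Y0|Y0].
  by apply: differentiable_in_coord; rewrite Y0; exact: local_coord_Yc.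
pose g q := 4 * ((Xc q - e2) * (Xc q - e3) + (Xc q0 - e1) * (Xc q - e3)
                        + (Xc q0 - e1) * (Xc q0 - e2)).
have Xl e : (Xc q - e) @[q --> dnbhs_curve (val q0)] --> Xc q0 - e.
  by apply: cvgB; [exact: Xc_cvg|exact: cvg_cst].
have gl : g @ dnbhs_curve (val q0) --> g q0.
  apply: cvgM; first exact: cvg_cst.
  apply: cvgD; last exact: cvg_cst.
  apply: cvgD; first exact: cvgM.
  by apply: cvgM => //; exact: cvg_cst.
have l : (Yc q + Yc q0) @[q --> dnbhs_curve (val q0)] --> Yc q0 + Yc q0.
  by apply: cvgD; [exact: Yc_cvg|exact: cvg_cst].
have s0 : Yc q0 + Yc q0 != 0 by rewrite -mulr2n mulrn_eq0.
have [_ nX] := local_coord_Xc Y0; exists (g q0 / (Yc q0 + Yc q0)).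
have lim : (g q / (Yc q + Yc q0)) @[q --> dnbhs_curve (val q0)] --> g q0 / (Yc q0 + Yc q0).
  by apply: cvgM => //; apply: cvgV.
apply: cvg_trans lim; apply: near_eq_cvg.
near=> q; have s : Yc q + Yc q0 != 0 by near: q; exact: cvgr_neq0 l s0.
have Xq : Xc q != Xc q0 by near: q; exact: nX.
have YE : Yc q - Yc q0 = (Xc q - Xc q0) * g q / (Yc q + Yc q0).
  by apply: (canRL (mulfK s)); rewrite -subr_sqr !curveE cubic_slope.
by rewrite YE; field; rewrite s subr_eq0 Xq.
Unshelve. all: by end_near. Qed.

Lemma Yc_sqr_divWc q : Yc q ^+ 2 / Wc q = 4 * (Xc q - e2) * (Xc q - e3).
Proof. by rewrite curveE /Wc; field; exact: Wc_neq0. Qed.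

Let dnbhs1_Xc : (@Xc C e1 e2) @ dnbhs_curve (e1, 0) --> e1.
Proof. exact: Xc_cvg. Qed.

Let dnbhs1_Yc : (@Yc C e1 e2) @ dnbhs_curve (e1, 0) --> (0 : C).
Proof. exact: Yc_cvg. Qed.

Let near_le (F : set_system point) (FF : Filter F) (u : point -> C) (c : C) :
  u @ F --> c -> \forall q \near F, `|u q| <= `|c| + 1.
Proof.
move=> uc; have ltc : `|c| < `|c| + 1 by rewrite ltrDl.
by near=> q; apply: ltW; near: q; apply: cvgr_norm_lt uc _ _.
Unshelve. all: by end_near. Qed.

Lemma infty_coord_cvg : (Xc (q : point) / Yc q) @[q --> infty_curve] --> (0 : C).
Proof.
apply/cvgr0Pnorm_le => e e0; have i0 : 0 <= 2 / e ^+ 2 + 1.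
  by rewrite addr_ge0 // divr_ge0 // exprn_ge0 // ltW.
apply: filterS (infty_bounds i0) => q [Xbig _ Ylo _].
have X0 : 0 < `|Xc q|.
  by apply: lt_le_trans Xbig; rewrite ltr_wpDl // divr_ge0 // exprn_ge0 // ltW.
have Y0 : 0 < `|Yc q| ^+ 2 by apply: lt_le_trans Ylo; rewrite divr_gt0 ?exprn_gt0.
rewrite -(@ler_pXn2r _ 2) ?nnegrE ?normr_ge0 ?(ltW e0) //.
rewrite normrM normfV exprMn exprVn ler_pdivrMr //.
have ee : 0 < e ^+ 2 by rewrite exprn_gt0.
rewrite -ler_pdivrMl //; apply: le_trans Ylo.
have -> : `|Xc q| ^+ 3 / 2 = `|Xc q| / 2 * `|Xc q| ^+ 2 by field.
rewrite ler_pM2r ?exprn_gt0 //.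
rewrite ler_pdivlMr // mulrC; apply: le_trans Xbig.
by rewrite lerDl.
Qed.

Let infty_pos q : 1 <= `|Xc q| -> `|Xc q| ^+ 3 / 2 <= `|Yc q| ^+ 2 ->
  0 < `|Xc q| /\ 0 < `|Yc q|.
Proof.
move=> X1 Ylo; have X0 : 0 < `|Xc q| by apply: lt_le_trans X1.
split=> //; rewrite lt_def normr_ge0 andbT.
apply: contraTneq Ylo => ->; rewrite expr0n /=.
by rewrite lt_geF // divr_gt0 ?exprn_gt0.
Qed.

Lemma elliptic_Wc : elliptic_fun Wc.
Proof.
split; first exact: holomorphic_Wc.
  have Wl : Wc @ dnbhs_curve (e1, 0) --> e1 - e1.
    by apply: cvgB; [exact: dnbhs1_Xc|exact: cvg_cst].
  apply: (@meromorphic_bounded _ _ _ _ _ _ 0 _ dnbhs1_Yc).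
  by apply: filterS (near_le _ Wl) => q uq; rewrite expr0 mul1r; exact: uq.
apply: (@meromorphic_bounded _ _ _ _ _ _ 2 (2 * (1 + `|e1|)) infty_coord_cvg).
apply: filterS (infty_bounds (ler0n _ 1)) => q [X1 _ Ylo _].
have [X0 Y0] := infty_pos X1 Ylo.
have Wle : `|Wc q| <= (1 + `|e1|) * `|Xc q|.
  apply: le_trans (ler_normB _ _) _; rewrite mulrDl mul1r lerD2l.
  by rewrite ler_peMr.
rewrite normrM normrX normrM normfV exprMn exprVn mulrAC.
rewrite ler_pdivrMr ?exprn_gt0 //.
apply: (@le_trans _ _ (2 * (1 + `|e1|) * (`|Xc q| ^+ 3 / 2))); last first.
  by rewrite ler_wpM2l // mulr_ge0 // addr_ge0.
have -> : 2 * (1 + `|e1|) * (`|Xc q| ^+ 3 / 2) = `|Xc q| ^+ 2 * ((1 + `|e1|) * `|Xc q|).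
  by field.
by rewrite ler_wpM2l ?exprn_ge0.
Qed.

Lemma elliptic_WcV : elliptic_fun (fun q => (Wc q)^-1).
Proof.
split; first exact: holomorphic_WcV.
  have gl : (4 * (Xc (q : point) - e2) * (Xc q - e3)) @[q --> dnbhs_curve (e1, 0)]
      --> 4 * (e1 - e2) * (e1 - e3).
    apply: cvgM; last by apply: cvgB; [exact: dnbhs1_Xc|exact: cvg_cst].
    apply: cvgM; first exact: cvg_cst.
    by apply: cvgB; [exact: dnbhs1_Xc|exact: cvg_cst].
  apply: (@meromorphic_bounded _ _ _ _ _ _ 2 _ dnbhs1_Yc).
  by apply: filterS (near_le _ gl) => q uq; rewrite Yc_sqr_divWc; exact: uq.
apply: (@meromorphic_bounded _ _ _ _ _ _ 0 2 infty_coord_cvg).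
apply: filterS (infty_bounds (ler0n _ 1)) => q [X1 Wlo _ _].
rewrite expr0 mul1r normfV -[leRHS]invrK lef_pV2 ?posrE ?normr_gt0 ?Wc_neq0 ?invr_gt0 //.
by apply: le_trans Wlo; rewrite -[leLHS]mul1r ler_wpM2r.
Qed.

Lemma elliptic_Yc : elliptic_fun (@Yc C e1 e2).
Proof.
split; first exact: holomorphic_Yc.
  apply: (@meromorphic_bounded _ _ _ _ _ _ 0 _ dnbhs1_Yc).
  by apply: filterS (near_le _ dnbhs1_Yc) => q uq; rewrite expr0 mul1r; exact: uq.
apply: (@meromorphic_bounded _ _ _ _ _ _ 3 2 infty_coord_cvg).
apply: filterS (infty_bounds (ler0n _ 1)) => q [X1 _ Ylo _].
have [X0 Y0] := infty_pos X1 Ylo.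
have Yn : Yc q != 0 by rewrite -normr_gt0.
have -> : (Xc q / Yc q) ^+ 3 * Yc q = Xc q ^+ 3 / Yc q ^+ 2 by field.
rewrite normrM normfV !normrX ler_pdivrMr ?exprn_gt0 //.
by rewrite -ler_pdivrMl // mulrC.
Qed.

End Curve.

(** * The involution Y -> - Y and descent to the X-line *)

Section Involution.
Variables (C : numClosedFieldType) (T : Type) (F G : set_system T) (s : T -> T).
Context {FF : Filter F} {FG : Filter G}.
Hypothesis sFG : (s @ F --> G)%classic.
Local Open Scope classical_set_scope.

Lemma differentiable_in_comp (a : C) (t u : T -> C) (t0 u0 : C) (f : T -> C) c :
  (forall q, t q - t0 = a * (u (s q) - u0)) ->
  differentiable_in G u u0 f c -> differentiable_in F t t0 (f \o s) c.
Proof.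
move=> tu [d fd]; exists (d * a^-1).
have lim : ((f (s q) - c) / (u (s q) - u0) * a^-1) @[q --> F] --> d * a^-1.
  apply: cvgM; last exact: cvg_cst.
  exact: (cvg_comp s (fun q => (f q - c) / (u q - u0)) sFG fd).
apply: cvg_trans lim; apply: near_eq_cvg; apply: nearW => q.
by rewrite /= tu invfM mulrA mulrAC.
Qed.

Lemma meromorphic_in_comp (t f : T -> C) : (forall q, t (s q) = - t q) ->
  meromorphic_in G t f -> meromorphic_in F t (f \o s).
Proof.
move=> ts [n [c tf]]; exists n, ((-1) ^+ n * c + 0).
have tu q : t q - 0 = -1 * (t (s q) - 0) by rewrite !subr0 ts mulN1r opprK.
apply: eq_differentiable_in (differentiable_in_lin ((-1) ^+ n)
  (differentiable_in_comp tu tf) (@differentiable_in_cst _ _ F t 0 _ 0)) => q.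
rewrite -[LHS]/((-1) ^+ n * (t (s q) ^+ n * f (s q)) + 0) addr0 ts.
by rewrite mulrA -exprMn mulN1r opprK.
Qed.

End Involution.

Section EvenFunctions.
Variables (C : numClosedFieldType) (e1 e2 : C).
Local Notation e3 := (- (e1 + e2)).
Hypotheses (e12 : e1 != e2) (e13 : e1 != e3) (e23 : e2 != e3).
Local Notation point := (curve_point e1 e2).
Local Notation dnbhs_curve := (@curve_dnbhs C e1 e2).
Local Notation infty_curve := (@curve_infty C e1 e2).
Implicit Types (p : C * C) (q : point) (x y : C).
Local Open Scope classical_set_scope.

Local Existing Instance curve_dnbhs_filter.
Local Existing Instance infty_filter.

Fact neg_subproof q : on_curve e1 e2 (Xc q, - Yc q) && ((Xc q, - Yc q) != (e1, 0)).
Proof.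
rewrite on_curve_sqr sqrrN curveE eqxx /=.
by apply: contra (Xc_e1 q) => /eqP[->].
Qed.

Definition neg q : point := exist _ (Xc q, - Yc q) (neg_subproof q).

Lemma same_Xc q q' : Xc q' = Xc q -> q' = q \/ q' = neg q.
Proof.
move=> Xqq; have /eqP := curveE q'; rewrite Xqq -curveE eqf_sqr.
by case/orP => /eqP Yqq; [left|right]; apply: val_inj; rewrite !val_curveE Xqq Yqq.
Qed.

Lemma negK : involutive neg.
Proof. by move=> q; apply: val_inj; rewrite /= opprK val_curveE. Qed.

Lemma neg_cvg x y : neg @ dnbhs_curve (x, y) --> dnbhs_curve (x, - y).
Proof.
move=> P [U /= Uxy UP].
exists [set p : C * C | U (p.1, - p.2)] => [|q Uq]; last exact: UP.
have /nbhs_ballP[e /= e0 Ue] :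
  nbhs (x, - y) [set p : C * C | p != (x, - y) -> U p] by [].
suff : nbhs (x, y) [set p : C * C | p != (x, y) -> U (p.1, - p.2)] by [].
apply/nbhs_ballP; exists e => //= -[u v] [/= xu yv] uv; apply: Ue.
  by split=> //=; move: yv; rewrite -!ball_normE /= -opprD normrN.
by apply: contra uv => /eqP[-> /oppr_inj ->].
Qed.

Lemma neg_infty_cvg : neg @ infty_curve --> infty_curve.
Proof. by move=> P [M /= M0 MP]; exists M => // q Mq; exact: (MP (neg q)). Qed.

(** The involution preserves the coordinate X, and changes the sign of Y and of
    X / Y. *)
Lemma elliptic_neg (f : point -> C) : elliptic_fun f -> elliptic_fun (f \o neg).
Proof.
move=> [fh fe fi]; split.
- move=> q; have := fh (neg q).
  have -> : val (neg q) = (Xc q, - Yc q) by [].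
  have nq : neg @ dnbhs_curve (val q) --> dnbhs_curve (Xc q, - Yc q).
    by rewrite val_curveE; exact: neg_cvg.
  rewrite /curve_coord {1 2}/Yc /= oppr_eq0; case: ifP => _.
    apply: (differentiable_in_comp nq (a := -1)) => q'.
    by rewrite /Yc /=; ring.
  apply: (differentiable_in_comp nq (a := 1)) => q'.
  by rewrite /Xc /= mul1r.
- apply: meromorphic_in_comp fe => //.
  by have := @neg_cvg e1 0; rewrite oppr0.
- apply: meromorphic_in_comp fi; first exact: neg_infty_cvg.
  by move=> q; rewrite /Xc /Yc /= invrN mulrN.
Qed.

Lemma exists_over x : x != e1 -> exists q, Xc q = x.
Proof.
move=> xe1; have [|q Xq _] := @point_of _ e1 e2 x
  (sqrtC (4 * (x - e1) * (x - e2) * (x - e3))) xe1.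
  by rewrite on_curve_sqr sqrtCK.
by exists q.
Qed.

(** Two points with the same X are equal or exchanged by the involution. *)
Lemma even_factor (f : point -> C) : (forall q, f (neg q) = f q) ->
  exists h : C -> C, forall q, f q = h (Xc q).
Proof.
move=> feven; have [x|h hP] := @choice C C (fun x v => forall q, Xc q = x -> f q = v).
  have [->|/exists_over[q <-]] := eqVneq x e1.
    by exists 0 => q Xq; have := Xc_e1 q; rewrite Xq eqxx.
  by exists (f q) => q' /same_Xc[->|->].
by exists h => q; exact: hP.
Qed.

(** X is an open map at every point of the cubic, (e1, 0) included: for x near
    p.1 the product (y - p.2) (y + p.2) is small, where y^2 is the value of the
    cubic at x, so one of the square roots y and - y is close to p.2. *)
Lemma Xc_lift p (P : point -> Prop) : on_curve e1 e2 p ->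
  (\forall q \near dnbhs_curve p, P q) ->
  \forall x \near p.1^', exists2 q, Xc q = x & P q.
Proof.
case: p => x0 y0; rewrite on_curve_sqr => /eqP y0E [U /= hU UP].
have /nbhs_ballP[e /= e0 Ue] :
  nbhs (x0, y0) [set p : C * C | p != (x0, y0) -> U p] by [].
pose g x : C := 4 * (x - e1) * (x - e2) * (x - e3).
have gl : g @ x0^' --> g x0.
  have Xl c : (x - c) @[x --> x0^'] --> x0 - c.
    by apply: cvgB; [exact: (local_coord_id x0).1|exact: cvg_cst].
  by apply: cvgM => //; apply: cvgM => //; apply: cvgM => //; exact: cvg_cst.
have ee : 0 < e * e by rewrite mulr_gt0.
have xl := (local_coord_id x0).1.
have ne1 : \forall x \near x0^', x != e1.
  have [->|ne] := eqVneq x0 e1; first exact: nbhs_dnbhs_neq.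
  exact: (nbhs_dnbhs (near_neq ne)).
near=> x.
have xx0 : x != x0 by near: x; exact: nbhs_dnbhs_neq.
have xe1 : x != e1 by near: x.
have xnear : `|x0 - x| < e by near: x; exact: (cvgr_dist_lt _ _ xl _ e0).
have gnear : `|g x0 - g x| < e * e by near: x; exact: (cvgr_dist_lt _ _ gl _ ee).
have good y : y ^+ 2 = g x -> `|y0 - y| < e -> exists2 q, Xc q = x & P q.
  move=> yE yy0; have xy : on_curve e1 e2 (x, y) by rewrite on_curve_sqr yE.
  have [q Xq Yq] := point_of xe1 xy.
  exists q => //; apply: UP; rewrite /= -[U _]/(U (val q)) val_curveE Xq Yq.
  apply: Ue => //=.
  by apply: contra xx0 => /eqP[->].
pose y := sqrtC (g x); have yE : y ^+ 2 = g x by exact: sqrtCK.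
(* If neither root were within e of y0, the product of distances would be at
   least e^2. *)
have [lt1|ge1] := boolP (`|y0 - y| < e); first exact: (good y yE lt1).
apply: (good (- y)); rewrite ?sqrrN // opprK.
have er : e \is Num.real by exact: gtr0_real.
move: ge1; rewrite -real_leNgt ?normr_real // => ge1.
rewrite real_ltNge ?normr_real //; apply/negP => ge2.
move: gnear; rewrite /g -y0E -/(g x) -yE subr_sqr normrM.
by rewrite le_gtF // ler_pM // ltW.
Unshelve. all: by end_near. Qed.

Lemma cvg_lift p (h : C -> C) (l : C) : on_curve e1 e2 p ->
  h (Xc (q : point)) @[q --> dnbhs_curve p] --> l -> h @ p.1^' --> l.
Proof.
move=> pc hl U /hl /= hU; have := Xc_lift pc hU.
by apply: filterS => x [q <-].
Qed.

End EvenFunctions.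

Arguments neg {C e1 e2} q.

(** * Elliptic functions as Laurent polynomials in X - e1 and Y *)

(** The description of the elliptic functions uses the field only through this
    form of Liouville's theorem. *)
Definition liouville_property (C : numClosedFieldType) : Prop :=
  forall (f : C -> C) (S : seq C) N (M r : C), 0 <= M -> 0 <= r ->
    (continuous f)%classic -> (forall z, z \notin S -> holomorphic_at f z) ->
    (forall z, r <= `|z| -> `|z| * `|f z| <= M * `|z| ^+ N) ->
    exists p : {poly C}, forall z, f z = p.[z].

Section Laurent.
Variables (C : numClosedFieldType) (e1 e2 : C).
Local Notation e3 := (- (e1 + e2)).
Hypotheses (e12 : e1 != e2) (e13 : e1 != e3) (e23 : e2 != e3).
Hypothesis liouvilleC : liouville_property C.
Local Notation point := (curve_point e1 e2).
Local Notation dnbhs_curve := (@curve_dnbhs C e1 e2).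
Local Notation infty_curve := (@curve_infty C e1 e2).
Implicit Types (p : C * C) (q : point) (x y : C) (f : point -> C).
Local Open Scope classical_set_scope.

Local Existing Instance curve_dnbhs_filter.
Local Existing Instance infty_filter.

Lemma holomorphic_cvg f q0 : holomorphic f -> f @ dnbhs_curve (val q0) --> f q0.
Proof.
move=> /(_ q0) fq; apply: differentiable_in_cvg fq.
rewrite /curve_coord; case: ifPn => [/eqP Y0|Y0]; last exact: local_coord_Xc.
by rewrite Y0; exact: local_coord_Yc.
Qed.

(** Near (e1, 0) the function w is Y^2 up to a nonvanishing factor, so a power of
    w absorbs the pole, and more. *)
Lemma pole_order f : meromorphic_in (dnbhs_curve (e1, 0)) (@Yc C e1 e2) f ->
  exists m, (Wc q ^+ m * f q) @[q --> dnbhs_curve (e1, 0)] --> (0 : C).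
Proof.
move=> [n [c tf]]; exists n.+1.
have lc : local_coord (dnbhs_curve (e1, 0)) (@Yc C e1 e2) 0 by exact: local_coord_Yc.
have Yf : (Yc q ^+ n * f q) @[q --> dnbhs_curve (e1, 0)] --> c.
  exact: differentiable_in_cvg lc _ _ tf.
have [Yl _] := lc.
pose g q := 4 * (Xc q - e2) * (Xc q - e3).
have g0 : 4 * (e1 - e2) * (e1 - e3) != 0.
  by rewrite !mulf_neq0 ?pnatr_eq0 ?subr_eq0.
have gl : g @ dnbhs_curve (e1, 0) --> 4 * (e1 - e2) * (e1 - e3).
  have Xl := @Xc_cvg C e1 e2 (e1, 0).
  apply: cvgM; last by apply: cvgB; [exact: Xl|exact: cvg_cst].
  apply: cvgM; first exact: cvg_cst.
  by apply: cvgB; [exact: Xl|exact: cvg_cst].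
have gV : (fun q => (g q)^-1 ^+ n.+1) @ dnbhs_curve (e1, 0) -->
    (4 * (e1 - e2) * (e1 - e3))^-1 ^+ n.+1.
  elim: n.+1 => [|k IH]; first exact: cvg_cst.
  rewrite exprS; under eq_fun do rewrite exprS.
  by apply: cvgM IH; exact: cvgV.
have Yn : (fun q : point => Yc q ^+ n.+1) @ dnbhs_curve (e1, 0) --> (0 : C) ^+ n.+1.
  elim: n.+1 => [|k IH]; first exact: cvg_cst.
  by rewrite exprS; under eq_fun do rewrite exprS; exact: cvgM.
have lim : (Yc q * Yc q ^+ n.+1 * (Yc q ^+ n * f q) * (g q)^-1 ^+ n.+1)
    @[q --> dnbhs_curve (e1, 0)]
    --> 0 * 0 ^+ n.+1 * c * (4 * (e1 - e2) * (e1 - e3))^-1 ^+ n.+1.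
  by apply: cvgM gV; apply: cvgM Yf; exact: cvgM.
rewrite !mul0r in lim; apply: cvg_trans lim; apply: near_eq_cvg.
near=> q; have gq : g q != 0 by near: q; exact: cvgr_neq0 gl g0.
have WE : Wc q = Yc q ^+ 2 / g q.
  by apply: (canRL (mulfK gq)); rewrite curveE /Wc /g; ring.
have -> : Wc q ^+ n.+1 = Yc q * Yc q ^+ n.+1 * Yc q ^+ n * (g q)^-1 ^+ n.+1.
  rewrite WE exprMn -exprM -exprS -exprD; congr (Yc q ^+ _ * _).
  by rewrite mul2n -addnn addSn addnS.
by rewrite !mulrA mulrAC.
Unshelve. all: by end_near. Qed.

(** At infinity |Y / X| is at most |X|, because Y^2 has the size of X^3. *)
Lemma polynomial_growth f :
  meromorphic_in infty_curve (fun q => Xc q / Yc q) f ->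
  exists n (B : C), [/\ 0 <= B & \forall q \near infty_curve,
    [/\ 1 <= `|Xc q| & `|f q| <= B * `|Xc q| ^+ n]].
Proof.
move=> [n [c tf]]; exists n, (`|c| + 1); split; first by rewrite addr_ge0.
have lc : local_coord infty_curve (fun q : point => Xc q / Yc q) 0.
  split; first exact: infty_coord_cvg.
  apply: filterS (@infty_bounds C e1 e2 1 ler01) => q [X1 _ Ylo _].
  have X0 : 0 < `|Xc q| by apply: lt_le_trans X1.
  have Y0 : 0 < `|Yc q| ^+ 2 by apply: lt_le_trans Ylo; rewrite divr_gt0 ?exprn_gt0.
  rewrite mulf_neq0 ?invr_eq0 -?normr_gt0 //.
  by rewrite normr_gt0; apply: contraTneq Y0 => ->; rewrite normr0 expr0n ltxx.
have Yf : ((Xc q / Yc q) ^+ n * f q) @[q --> infty_curve] --> c.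
  exact: differentiable_in_cvg lc _ _ tf.
have clt : `|c| < `|c| + 1 by rewrite ltrDl.
have i32 : (0 : C) <= 32 by exact: ler0n.
near=> q.
have tq : Xc q / Yc q != 0 by near: q; case: lc.
have fq : `|(Xc q / Yc q) ^+ n * f q| <= `|c| + 1.
  by apply: ltW; near: q; apply: cvgr_norm_lt Yf _ clt.
have [X32 _ Ylo Yhi] : [/\ 32 <= `|Xc q|, `|Xc q| / 2 <= `|Xc q - e1|,
  `|Xc q| ^+ 3 / 2 <= `|Yc q| ^+ 2 & `|Yc q| ^+ 2 <= 32 * `|Xc q| ^+ 3].
  by near: q; exact: infty_bounds.
have X1 : 1 <= `|Xc q| by apply: le_trans X32; rewrite ler1n.
split=> //.
have X0 : 0 < `|Xc q| by apply: lt_le_trans X1.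
have YX : `|Yc q / Xc q| <= `|Xc q|.
  rewrite normrM normfV ler_pdivrMr // -(@ler_pXn2r _ 2) ?nnegrE ?mulr_ge0 //.
  apply: le_trans Yhi _.
  have -> : (`|Xc q| * `|Xc q|) ^+ 2 = `|Xc q| * `|Xc q| ^+ 3 by ring.
  by rewrite ler_wpM2r ?exprn_ge0.
have -> : f q = (Xc q / Yc q) ^+ n * f q * (Yc q / Xc q) ^+ n.
  by rewrite mulrAC -exprMn -[Yc q / Xc q]invf_div divff // expr1n mul1r.
by rewrite normrM normrX ler_pM ?exprn_ge0 // lerXn2r ?nnegrE.
Unshelve. all: by end_near. Qed.

Let on_curve_val q : on_curve e1 e2 (val q).
Proof. by have /andP[] := valP q. Qed.

(** The points with Y = 0 have local coordinate Y, not X; there the function h is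
    only seen to be continuous. *)
Let even_descent f h : (forall q, f q = h (Xc q)) -> holomorphic f ->
  (forall x, x != e1 -> h @ x^' --> h x) /\
  (forall x, x \notin [:: e1; e2; e3] -> holomorphic_at h x).
Proof.
move=> fh fhol; split=> x.
  move=> /(@exists_over C e1 e2)[q0 <-].
  apply: (@cvg_lift C e1 e2 (val q0) h (h (Xc q0)) (on_curve_val q0)).
  have := holomorphic_cvg (q0 := q0) fhol; rewrite fh.
  by rewrite (_ : f = h \o @Xc C e1 e2) //; apply/funext => q; exact: fh.
rewrite !inE !negb_or => /and3P[xe1 xe2 xe3].
have [q0 Xq0] := @exists_over C e1 e2 x xe1.
have Y0 : Yc q0 != 0.
  by apply/eqP => /Yc_eq0[] Xe; [move: xe2|move: xe3]; rewrite -Xq0 Xe eqxx.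
have [d fd] := fhol q0; exists d.
rewrite -Xq0; apply: (@cvg_lift C e1 e2 (val q0)
  (fun y => (h y - h (Xc q0)) / (y - Xc q0)) d (on_curve_val q0)).
apply: cvg_trans fd; apply: near_eq_cvg; apply: nearW => q.
by rewrite /curve_coord (negPf Y0) !fh.
Qed.

(** The function w^m h, extended by 0 at e1, satisfies the assumptions of
    [liouville_property] with exceptional points e1, e2, e3. *)
Lemma even_laurent f : elliptic_fun f -> (forall q, f (neg q) = f q) ->
  exists m (P : {poly C}), forall q, Wc q ^+ m * f q = P.[Xc q].
Proof.
move=> [fhol fpole finfty] feven; have [h fh] := even_factor feven.
have [hcvg hhol] := even_descent fh fhol.
have [m flim] := pole_order fpole; exists m.
pose H x := if x == e1 then 0 else (x - e1) ^+ m * h x.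
have H1 : H e1 = 0 by rewrite /H eqxx.
have HE x : x != e1 -> H x = (x - e1) ^+ m * h x by rewrite /H => /negPf ->.
suff [P HP] : exists P : {poly C}, forall z, H z = P.[z].
  by exists P => q; rewrite -HP HE ?Xc_e1 // fh.
have powl x : (fun y => (y - e1) ^+ m) @ x^' --> (x - e1) ^+ m.
  have l : (y - e1) @[y --> x^'] --> x - e1.
    by apply: cvgB; [exact: (local_coord_id x).1|exact: cvg_cst].
  elim: m {flim H H1 HE} => [|k IH]; first exact: cvg_cst.
  by rewrite exprS; under eq_fun do rewrite exprS; exact: cvgM.
have powd x : differentiable_in x^' id x (fun y => (y - e1) ^+ m) ((x - e1) ^+ m).
  have id1 : differentiable_in x^' id x (fun y => y - e1) (x - e1).
    have [d hd] := differentiable_in_coord (local_coord_id x); exists d.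
    apply: cvg_trans hd; apply: near_eq_cvg; apply: nearW => y.
    by rewrite /= opprB addrA subrK.
  elim: m {flim H H1 HE powl} => [|k IH]; first exact: differentiable_in_cst.
  rewrite exprS; apply: eq_differentiable_in
    (differentiable_inM (local_coord_id x) id1 IH) => y.
  by rewrite exprS.
have near_H x : x != e1 -> \forall y \near x^', (y - e1) ^+ m * h y = H y.
  by move=> xe1; apply: filterS (nbhs_dnbhs (near_neq xe1)) => y /HE ->.
have Hcont : continuous H.
  move=> x; apply: continuous_punctured.
  have [->|xe1] := eqVneq x e1; last first.
    rewrite HE //; apply: cvg_trans (near_eq_cvg (near_H x xe1)) _.
    by apply: cvgM; [exact: powl|exact: hcvg].
  rewrite H1; have on1 : on_curve e1 e2 (e1, 0).
    by rewrite on_curve_sqr subrr mulr0 !mul0r expr0n.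
  apply: (@cvg_lift C e1 e2 (e1, 0) H 0 on1).
  apply: cvg_trans flim; apply: near_eq_cvg; apply: nearW => q.
  by rewrite HE ?Xc_e1 // fh.
have Hhol x : x \notin [:: e1; e2; e3] -> holomorphic_at H x.
  move=> xe; have xe1 : x != e1 by apply: contraNneq xe => ->; rewrite inE eqxx.
  have [d hd] := @differentiable_inM C C x^' id x _ (local_coord_id x)
    (fun y => (y - e1) ^+ m) ((x - e1) ^+ m) h (h x) (powd x) (hhol x xe).
  exists d; apply: cvg_trans hd; apply: near_eq_cvg.
  by apply: filterS (near_H x xe1) => y <-; rewrite HE.
have [n [B [B0 [M /= M0 fB]]]] := polynomial_growth finfty.
apply: (liouvilleC (S := [:: e1; e2; e3]) (M := (1 + `|e1|) ^+ m * B)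
  (r := M + `|e1| + 1) (N := (m + n).+1)) => //.
- by rewrite mulr_ge0 // exprn_ge0 // addr_ge0.
- by rewrite !addr_ge0 // ltW.
move=> z rz.
have Mz : M < `|z|.
  by apply: lt_le_trans rz; rewrite -addrA ltrDl ltr_wpDl.
have ze1 : z != e1.
  apply: contraTneq rz => ->; rewrite lt_geF // addrAC addrC ltrDl.
  by rewrite addr_gt0.
have [q Xq] := @exists_over C e1 e2 z ze1.
have [|X1 fz] := fB q; first by rewrite /= Xq.
rewrite HE // -Xq -fh normrM normrX -/(Wc q) exprS [leRHS]mulrCA ler_wpM2l //.
rewrite exprD mulrACA ler_pM ?exprn_ge0 // -exprMn lerXn2r ?nnegrE ?mulr_ge0 ?addr_ge0 //.
apply: le_trans (ler_normB _ _) _; rewrite mulrDl mul1r lerD2l.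
by rewrite ler_peMr.
Qed.

(** The product f Y is even, and vanishes where Y does, that is at X = e2 and
    X = e3.  Its polynomial is therefore divisible by (X - e2) (X - e3), which
    is Y^2 / (4 w). *)
Lemma odd_laurent f : elliptic_fun f -> (forall q, f (neg q) = - f q) ->
  exists m (P : {poly C}), forall q, Wc q ^+ m * f q = P.[Xc q] * Yc q.
Proof.
move=> fell fodd; have Yell : elliptic_fun (@Yc C e1 e2) by exact: elliptic_Yc.
have [||m [P HP]] := @even_laurent (f * @Yc C e1 e2).
- exact: elliptic_funM.
- by move=> q; rewrite -[LHS]/(f (neg q) * - Yc q) fodd mulrNN.
have root_at e : e != e1 -> 4 * (e - e1) * (e - e2) * (e - e3) = 0 -> root P e.
  move=> ee1 e0; have [q Xq] := @exists_over C e1 e2 e ee1.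
  have Y0 : Yc q = 0 by apply/eqP; rewrite -sqrf_eq0 curveE Xq e0.
  by rewrite /root -Xq -HP -[(f * _) q]/(f q * Yc q) Y0 !mulr0.
have /factor_theorem[P1 PE] : root P e2.
  by apply: root_at; [rewrite eq_sym|rewrite subrr mulr0 mul0r].
have /factor_theorem[P2 P1E] : root P1 e3.
  have : root P e3 by apply: root_at; [rewrite eq_sym|rewrite subrr mulr0].
  by rewrite PE rootM root_XsubC [e3 == _]eq_sym (negPf e23) orbF.
(* The factor 1 / 4 comes from the leading coefficient of the cubic. *)
exists m.+1, (4^-1 *: P2) => q.
have [Y0|Y0] := eqVneq (Yc q) 0.
  have fq : f q = 0.
    have nq : neg q = q by apply: val_inj; rewrite [RHS]val_curveE /= Y0 oppr0.
    have := fodd q; rewrite nq => /eqP; rewrite -addr_eq0 -mulr2n mulrn_eq0 /=.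
    by move/eqP.
  by rewrite fq Y0 !mulr0.
have HPq : Wc q ^+ m * (f q * Yc q) = P.[Xc q] := HP q.
have -> : Wc q ^+ m.+1 * f q = Wc q * P.[Xc q] / Yc q.
  by rewrite -HPq exprS; field.
rewrite PE P1E !hornerM hornerZ !hornerXsubC; apply: (mulIf Y0).
rewrite divfK // -[RHS]mulrA -expr2.
by rewrite curveE /Wc; field.
Qed.

Theorem elliptic_fun_laurent f : elliptic_fun f -> exists m (P Q : {poly C}), forall q,
  Wc q ^+ m * f q = P.[Wc q] + Q.[Wc q] * Yc q.
Proof.
move=> fell; have fneg := elliptic_neg fell.
have half_even : elliptic_fun (1 *: f + (f \o neg)) by exact: elliptic_fun_lin.
have half_odd : elliptic_fun (-1 *: (f \o neg) + f) by exact: elliptic_fun_lin.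
have [q|m [P HP]] := even_laurent half_even.
  by rewrite -[LHS]/(1 * f (neg q) + f (neg (neg q)))
    -[RHS]/(1 * f q + f (neg q)) negK !mul1r addrC.
have [q|n [Q HQ]] := odd_laurent half_odd.
  by rewrite -[LHS]/(-1 * f (neg (neg q)) + f (neg q))
    -[RHS]/(- (-1 * f (neg q) + f q)) negK; ring.
pose shift (S : {poly C}) := S \Po ('X + e1%:P).
have shiftE (S : {poly C}) q : (shift S).[Wc q] = S.[Xc q].
  by rewrite /shift horner_comp hornerD hornerX hornerC subrK.
(* The sum of w^m (f + f o neg) and w^n (f - f o neg), brought to the exponent
   m + n, is 2 w^(m+n) f. *)
exists (m + n)%N, (2^-1 *: ('X ^+ n * shift P)), (2^-1 *: ('X ^+ m * shift Q)) => q.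
rewrite !hornerZ !hornerM !hornerXn !shiftE -mulrA -[_ * Q.[_] * _]mulrA.
rewrite -(HQ q) -(HP q) -[(_ + _) q]/(1 * f q + f (neg q)).
rewrite -[(_ *: (f \o neg) + _) q]/(-1 * f (neg q) + f q) exprD.
by field.
Qed.

End Laurent.

(** * Lie brackets from a graded multiplication rule *)

Lemma oddzD (n m : int) : oddz (n + m) = oddz n (+) oddz m.
Proof. rewrite /oddz; lia. Qed.

Lemma malg_A_ind (K : comNzRingType) (P : malg int K -> Prop) :
  (forall n, P (A n)) -> (forall c f h, P f -> P h -> P (c *: f + h)) ->
  forall f, P f.
Proof.
move=> PA Plin f; have P0 : P 0 by rewrite -[0](addNr (A 0)) -scaleN1r; apply: Plin.
rewrite [f]monalgE; elim: (enum_fset _) => [|n r IHr]; first by rewrite big_nil.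
rewrite big_cons; set c := mcoeff _ _.
suff -> : mkmalgU n c = c *: A n :> malg _ K by exact: Plin.
by apply/malgP => k; rewrite mcoeffZ !mcoeffU mulr_natr.
Qed.

(** The generators t x n stand for x A_n.  The ring S of scalars differs from the
    base ring K of g so that the same computation applies to g (x) K[z, 1/z] and
    to its extension to K[e]. *)
Section CurrentBracket.
Variables (S K : comNzRingType) (g : lmodType K) (M : lmodType S).
Variables (br : g -> g -> g) (t : g -> int -> M) (B : M -> M -> M) (c1 c2 : S).
Hypothesis g_lie : lie_bracket br.
Hypothesis t_add : forall n x y, t (x + y) n = t x n + t y n.
Hypothesis t_span : forall P : M -> Prop, (forall x n, P (t x n)) ->
  (forall c u v, P u -> P v -> P (c *: u + v)) -> forall u, P u.
Hypotheses (Bl : forall v, linear (B^~ v)) (Br : forall u, linear (B u)).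

Let poly_t x (n : int) := t x n + c1 *: t x (n - 2) + c2 *: t x (n - 4).

Hypothesis BE : forall x y n m, B (t x n) (t y m) =
  if oddz n && oddz m then poly_t (br x y) (n + m) else t (br x y) (n + m).

Let t0 n : t 0 n = 0.
Proof. by apply: (addrI (t 0 n)); rewrite -t_add !addr0. Qed.

Let tN x n : t (- x) n = - t x n.
Proof. by apply/eqP; rewrite -addr_eq0 -t_add addNr t0. Qed.

Let brC x y : br y x = - br x y.
Proof.
have [l r alt _] := g_lie; apply/eqP; rewrite -addr_eq0.
have := alt (x + y); have := l (x + y) 1 x y; rewrite !scale1r => ->.
have := r x 1 x y; rewrite !scale1r => ->; have := r y 1 x y; rewrite !scale1r => ->.
by rewrite !alt add0r addr0 addrC => ->.
Qed.

Let BDr u v w : B u (v + w) = B u v + B u w.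
Proof. by have := Br u 1 v w; rewrite !scale1r. Qed.

Let B0r u : B u 0 = 0.
Proof. by apply: (addrI (B u 0)); rewrite -BDr !addr0. Qed.

Let BZr c u v : B u (c *: v) = c *: B u v.
Proof. by have := Br u c v 0; rewrite addr0 B0r addr0. Qed.

Let BC u v : B u v + B v u = 0.
Proof.
elim/t_span: u => [x n|c u u' IHu IHu']; last first.
  by rewrite Bl Br addrACA -scalerDr IHu IHu' scaler0 addr0.
elim/t_span: v => [y m|c v v' IHv IHv']; last first.
  by rewrite Bl Br addrACA -scalerDr IHv IHv' scaler0 addr0.
rewrite !BE andbC [m + n]addrC brC; case: ifP => _; last by rewrite tN addNr.
by rewrite /poly_t !tN !scalerN -!opprD addNr.
Qed.

(** A correction appears as soon as two of the three indices are odd; all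
    corrections shift an index by an even number, so it appears only once. *)
Let B_iter x y z n m k : B (t x n) (B (t y m) (t z k)) =
  if [|| oddz n && oddz m, oddz m && oddz k | oddz k && oddz n]
  then poly_t (br x (br y z)) (n + m + k) else t (br x (br y z)) (n + m + k).
Proof.
rewrite !BE; have e2 (l : int) : oddz (l - 2) = oddz l by rewrite /oddz; lia.
have e4 (l : int) : oddz (l - 4) = oddz l by rewrite /oddz; lia.
case om: (oddz m); case ok: (oddz k); case on: (oddz n);
  rewrite /= ?BDr ?BZr ?BE ?e2 ?e4 ?oddzD ?om ?ok ?on //= /poly_t ?addrA //.
Qed.

Lemma current_lie_bracket : lie_bracket B.
Proof.
split=> //.
  elim/t_span => [x n|c u v hu hv].
    have := BE x x n n; case: g_lie => _ _ -> _ ->.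
    by rewrite /poly_t !t0 !scaler0 !addr0 if_same.
  by rewrite Bl !Br hu hv addr0 !scaler0 add0r -scalerDr BC scaler0.
have lin_sum c (a b d a' b' d' : M) : a + b + d = 0 -> a' + b' + d' = 0 ->
    (c *: a + a') + (c *: b + b') + (c *: d + d') = 0.
  move=> h h'; transitivity (c *: (a + b + d) + (a' + b' + d')).
    by rewrite !scalerDr [RHS]addrACA [X in _ = X + _]addrACA.
  by rewrite h h' scaler0 addr0.
move=> u v w.
elim/t_span: u => [x n|c u u' IH IH']; last first.
  by rewrite !(Bl, Br); exact: lin_sum.
elim/t_span: v => [y m|c v v' IH IH']; last first.
  by rewrite !(Bl, Br); exact: lin_sum.
elim/t_span: w => [z k|c w w' IH IH']; last first.
  by rewrite !(Bl, Br); exact: lin_sum.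
rewrite !B_iter; have [_ _ _ jacobi] := g_lie.
have -> : m + k + n = n + m + k by rewrite addrC addrA.
have -> : k + n + m = n + m + k by rewrite [k + n]addrC addrAC.
have -> : [|| oddz m && oddz k, oddz k && oddz n | oddz n && oddz m]
    = [|| oddz n && oddz m, oddz m && oddz k | oddz k && oddz n].
  by case: (oddz n); case: (oddz m); case: (oddz k).
have -> : [|| oddz k && oddz n, oddz n && oddz m | oddz m && oddz k]
    = [|| oddz n && oddz m, oddz m && oddz k | oddz k && oddz n].
  by case: (oddz n); case: (oddz m); case: (oddz k).
have tJ l : t (br x (br y z)) l + t (br y (br z x)) l + t (br z (br x y)) l = 0.
  by rewrite -!t_add jacobi t0.
case: ifP => _; last exact: tJ.
have := lin_sum c2 _ _ _ _ _ _ (tJ (n + m + k - 4))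
  (lin_sum c1 _ _ _ _ _ _ (tJ (n + m + k - 2)) (tJ (n + m + k))).
rewrite /poly_t => <-.
by rewrite ![c1 *: _ + _]addrC ![c2 *: _ + _]addrC.
Qed.

End CurrentBracket.

(** * Two-parameter current brackets and their deformation *)

Section Table.
Variable K : comNzRingType.
Variables (g : lmodType K) (br : g -> g -> g).
Hypothesis g_lie : lie_bracket br.
Implicit Types (c : K) (n m : int) (x y : g).
Local Notation V := (malg int K).
Local Notation L := (tensor g V).

Definition table c1 c2 n m : V :=
  if oddz n && oddz m then A (n + m) + c1 *: A (n + m - 2) + c2 *: A (n + m - 4)
  else A (n + m).

Definition current_bracket c1 c2 : L -> L -> L :=
  tensor_bracket br (basis_mul (table c1 c2)).

Let br_l := lie_linear_l g_lie.
Let br_r := lie_linear_r g_lie.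

Lemma tensDr (U W : lmodType K) (u : U) (v w : W) : u ⊗ (v + w) = u ⊗ v + u ⊗ w.
Proof. by have := tens_linear_r u 1 v w; rewrite !scale1r. Qed.

Lemma tensDl (U W : lmodType K) (u v : U) (w : W) : (u + v) ⊗ w = u ⊗ w + v ⊗ w.
Proof. by have := tens_linear_l w 1 u v; rewrite !scale1r. Qed.

Lemma tens0r (U W : lmodType K) (u : U) : u ⊗ (0 : W) = 0.
Proof. by apply: (addrI (u ⊗ 0)); rewrite -tensDr !addr0. Qed.

Lemma tensZr (U W : lmodType K) c (u : U) (v : W) : u ⊗ (c *: v) = c *: (u ⊗ v).
Proof.
by have := tens_linear_r u c v 0; rewrite tens0r !addr0.
Qed.

Lemma tensZl (U W : lmodType K) c (u : U) (v : W) : (c *: u) ⊗ v = c *: (u ⊗ v).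
Proof.
have z : (0 : U) ⊗ v = 0 by apply: (addrI (0 ⊗ v)); rewrite -tensDl !addr0.
by have := tens_linear_l v c u 0; rewrite z !addr0.
Qed.

Lemma current_bracket_gen c1 c2 x y n m :
  current_bracket c1 c2 (x ⊗ A n) (y ⊗ A m) =
  if oddz n && oddz m then
    br x y ⊗ A (n + m) + c1 *: (br x y ⊗ A (n + m - 2))
    + c2 *: (br x y ⊗ A (n + m - 4))
  else br x y ⊗ A (n + m).
Proof.
rewrite /current_bracket tensor_bracket_tens //; try exact: basis_mul_linear_l;
  try exact: basis_mul_linear_r.
rewrite basis_mulA /table; case: ifP => // _.
by rewrite !tensDr !tensZr.
Qed.

Lemma current_span (P : L -> Prop) : (forall x n, P (x ⊗ A n)) ->
  (forall c u v, P u -> P v -> P (c *: u + v)) -> forall u, P u.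
Proof.
move=> Pgen Plin; apply: tensor_ind; last exact: Plin.
move=> x; apply: (@malg_A_ind K (fun f => P (x ⊗ f))); first exact: Pgen.
by move=> c f h Pf Ph; rewrite tens_linear_r; exact: Plin.
Qed.

Lemma current_bracket_linear_l c1 c2 v : linear ((current_bracket c1 c2)^~ v).
Proof.
by apply: tensor_bracket_linear_l => // f;
  [exact: basis_mul_linear_l|exact: basis_mul_linear_r].
Qed.

Lemma current_bracket_linear_r c1 c2 u : linear (current_bracket c1 c2 u).
Proof.
by apply: tensor_bracket_linear_r => // f;
  [exact: basis_mul_linear_l|exact: basis_mul_linear_r].
Qed.

Lemma current_bracket_lie c1 c2 : lie_bracket (current_bracket c1 c2).
Proof.
apply: (@current_lie_bracket _ _ _ _ br (fun x n => x ⊗ A n) _ c1 c2 g_lie).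
- by move=> n x y; rewrite tensDl.
- exact: current_span.
- exact: current_bracket_linear_l.
- exact: current_bracket_linear_r.
- exact: current_bracket_gen.
Qed.

Lemma classical_bracketE : current_bracket 0 0 = classical_bracket br.
Proof.
rewrite /current_bracket /classical_bracket; congr (tensor_bracket br (basis_mul _)).
apply/funext => n; apply/funext => m; rewrite /table /classical_table.
by rewrite !scale0r !addr0 if_same.
Qed.

Lemma family_bracketE e1 e2 : family_bracket br e1 e2 =
  current_bracket (3 * e1) ((e1 - e2) * (2 * e1 + e2)).
Proof. by []. Qed.

End Table.

Lemma tensor_eq (K : comNzRingType) (U V W : lmodType K) (f h : tensor U V -> W) :
  linear f -> linear h -> (forall u v, f (u ⊗ v) = h (u ⊗ v)) -> f =1 h.
Proof.
by move=> fl hl fh; apply: tensor_ind => // c s t fs ft; rewrite fl hl fs ft.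
Qed.

Lemma linear_additive (K : comNzRingType) (V W : lmodType K) (f : V -> W) :
  linear f -> {morph f : u v / u + v}.
Proof. by move=> fl u v; have := fl 1 u v; rewrite !scale1r. Qed.

Lemma linear_scale (K : comNzRingType) (V W : lmodType K) (f : V -> W) c u :
  linear f -> f (c *: u) = c *: f u.
Proof.
move=> fl; have f0 : f 0 = 0.
  by apply: (addrI (f 0)); rewrite -(linear_additive fl) !addr0.
by have := fl c u 0; rewrite f0 !addr0.
Qed.

Lemma linear_comp (K : comNzRingType) (U V W : lmodType K) (f : V -> W) (h : U -> V) :
  linear f -> linear h -> linear (f \o h).
Proof. by move=> fl hl c u v; rewrite /= hl fl. Qed.

Lemma linear_combination (K : comNzRingType) (V W : lmodType K) (a b : K)
  (f1 f2 f3 : V -> W) : linear f1 -> linear f2 -> linear f3 ->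
  linear (fun u => f1 u + a *: f2 u + b *: f3 u).
Proof.
move=> l1 l2 l3 c u v; rewrite l1 l2 l3 !scalerDr !scalerA ![_ * c]mulrC.
by rewrite [RHS]addrACA [X in _ = X + _]addrACA.
Qed.

(** The coefficients c1, c2 are replaced by polynomials p1, p2 in e. *)
Section Deformation.
Variable K : comNzRingType.
Variables (g : lmodType K) (br : g -> g -> g).
Hypothesis g_lie : lie_bracket br.
Local Notation L := (tensor g (malg int K)).
Local Notation E := (scalar_ext {poly K} L).
Variables (p1 p2 : {poly K}).

Let br_l := lie_linear_l g_lie.
Let br_r := lie_linear_r g_lie.

Let t x n : E := (1 : {poly K}) ⊗ (x ⊗ A n : L).

Let gen_table (d : int) n m : malg int K := if oddz n && oddz m then A (n + m - d) else 0.

Let coef_bracket (tab : int -> int -> malg int K) : E -> E -> E :=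
  tensor_bracket (@GRing.mul {poly K}) (tensor_bracket br (basis_mul tab)).

(** The three brackets are K[e]-bilinear extensions of brackets over K, one for
    each of the terms A_(n+m), A_(n+m-2) and A_(n+m-4). *)
Definition poly_bracket (u v : E) : E :=
  coef_bracket (@classical_table K) u v + p1 *: coef_bracket (gen_table 2) u v
  + p2 *: coef_bracket (gen_table 4) u v.

Let mul_l (q : {poly K}) : linear (GRing.mul^~ q).
Proof. by move=> c a b; rewrite mulrDl scalerAl. Qed.

Let mul_r (q : {poly K}) : linear (GRing.mul q).
Proof. by move=> c a b; rewrite mulrDr scalerAr. Qed.

Let tb_l tab v : linear (fun u => tensor_bracket br (basis_mul tab) u v).
Proof.
by apply: tensor_bracket_linear_l => // f;
  [exact: basis_mul_linear_l|exact: basis_mul_linear_r].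
Qed.

Let tb_r tab u : linear (tensor_bracket br (basis_mul tab) u).
Proof.
by apply: tensor_bracket_linear_r => // f;
  [exact: basis_mul_linear_l|exact: basis_mul_linear_r].
Qed.

Let cb_lK tab v :
  linear (fun u : tensor {poly K} L => coef_bracket tab u v : tensor {poly K} L).
Proof. exact: tensor_bracket_linear_l. Qed.

Let cb_rK tab u :
  linear (coef_bracket tab u : tensor {poly K} L -> tensor {poly K} L).
Proof. exact: tensor_bracket_linear_r. Qed.

Let cb_tens tab (p q : {poly K}) (u v : L) : coef_bracket tab (p ⊗ u) (q ⊗ v) =
  (p * q) ⊗ tensor_bracket br (basis_mul tab) u v :> tensor {poly K} L.
Proof. exact: tensor_bracket_tens. Qed.

Lemma ext_scale_lin (p : {poly K}) (c : K) (u v : tensor {poly K} L) :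
  ext_scale p (c *: u + v) = c *: (ext_scale p u : tensor {poly K} L) + ext_scale p v.
Proof.
have l (x : L) : linear (fun q : {poly K} => (p * q) ⊗ x : tensor {poly K} L).
  by move=> d q1 q2; rewrite mulrDr -scalerAr tens_linear_l.
have r (q : {poly K}) : linear (fun x : L => (p * q) ⊗ x : tensor {poly K} L).
  exact: tens_linear_r.
exact: (tensor_lift_linear l r).
Qed.

Let cb_Zl tab (p : {poly K}) (u v : E) :
  coef_bracket tab (p *: u) v = p *: coef_bracket tab u v.
Proof.
pose T := tensor {poly K} L.
have scl : linear (ext_scale p : T -> T) by exact: ext_scale_lin.
apply: (@tensor_eq K {poly K} L T (fun u => coef_bracket tab (ext_scale p u) v)
  (fun u => ext_scale p (coef_bracket tab u v))) => [||q l].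
- exact: (linear_comp (cb_lK tab v) scl).
- exact: (linear_comp scl (cb_lK tab v)).
apply: (@tensor_eq K {poly K} L T (coef_bracket tab (ext_scale p (q ⊗ l)))
  (fun v => ext_scale p (coef_bracket tab (q ⊗ l) v))) => [||q' l'].
- exact: cb_rK.
- exact: (linear_comp scl (cb_rK tab (q ⊗ l))).
set b := tensor_bracket br (basis_mul tab) l l'.
have lhs : coef_bracket tab (ext_scale p (q ⊗ l)) (q' ⊗ l') = (p * q * q') ⊗ b :> T.
  exact: (etrans (congr1 (fun z : T => coef_bracket tab z (q' ⊗ l'))
    (ext_scale_tens p q l)) (cb_tens tab (p * q) q' l l')).
have rhs : ext_scale p (coef_bracket tab (q ⊗ l) (q' ⊗ l')) = (p * (q * q')) ⊗ b :> T.
  exact: (etrans (congr1 (ext_scale p) (cb_tens tab q q' l l'))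
    (ext_scale_tens p (q * q') b)).
exact: (etrans lhs (etrans (congr1 (fun z => z ⊗ b) (esym (mulrA p q q'))) (esym rhs))).
Qed.

Let cb_Zr tab (p : {poly K}) (u v : E) :
  coef_bracket tab u (p *: v) = p *: coef_bracket tab u v.
Proof.
pose T := tensor {poly K} L.
have scl : linear (ext_scale p : T -> T) by exact: ext_scale_lin.
apply: (@tensor_eq K {poly K} L T (fun u => coef_bracket tab u (ext_scale p v))
  (fun u => ext_scale p (coef_bracket tab u v))) => [||q l].
- exact: cb_lK.
- exact: (linear_comp scl (cb_lK tab v)).
apply: (@tensor_eq K {poly K} L T (fun v => coef_bracket tab (q ⊗ l) (ext_scale p v))
  (fun v => ext_scale p (coef_bracket tab (q ⊗ l) v))) => [||q' l'].
- exact: (linear_comp (cb_rK tab (q ⊗ l)) scl).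
- exact: (linear_comp scl (cb_rK tab (q ⊗ l))).
set b := tensor_bracket br (basis_mul tab) l l'.
have lhs : coef_bracket tab (q ⊗ l) (ext_scale p (q' ⊗ l')) = (q * (p * q')) ⊗ b :> T.
  exact: (etrans (congr1 (fun z : T => coef_bracket tab (q ⊗ l) z)
    (ext_scale_tens p q' l')) (cb_tens tab q (p * q') l l')).
have rhs : ext_scale p (coef_bracket tab (q ⊗ l) (q' ⊗ l')) = (p * (q * q')) ⊗ b :> T.
  exact: (etrans (congr1 (ext_scale p) (cb_tens tab q q' l l'))
    (ext_scale_tens p (q * q') b)).
exact: (etrans lhs (etrans (congr1 (fun z => z ⊗ b) (mulrCA q p q')) (esym rhs))).
Qed.

Let cb_l tab v : linear (fun u : E => coef_bracket tab u v).
Proof.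
move=> p u u'; rewrite -(cb_Zl tab p u v).
exact: (linear_additive (cb_lK tab v) (p *: u) u').
Qed.

Let cb_r tab u : linear (coef_bracket tab u).
Proof.
move=> p v v'; rewrite -(cb_Zr tab p u v).
exact: (linear_additive (cb_rK tab u) (p *: v) v').
Qed.

Lemma poly_bracket_linear_l v : linear (poly_bracket^~ v).
Proof. exact: (linear_combination p1 p2 (cb_l _ v) (cb_l _ v) (cb_l _ v)). Qed.

Lemma poly_bracket_linear_r u : linear (poly_bracket u).
Proof. exact: (linear_combination p1 p2 (cb_r _ u) (cb_r _ u) (cb_r _ u)). Qed.

Lemma poly_span (P : E -> Prop) : (forall x n, P (t x n)) ->
  (forall c u v, P u -> P v -> P (c *: u + v)) -> forall u, P u.
Proof.
move=> Pgen Plin.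
pose T := tensor {poly K} L.
have scaleK (c : K) (u : T) : c *: u = ext_scale c%:P u.
  apply: (@tensor_eq K {poly K} L T ( *:%R c) (ext_scale c%:P)) => [||q l].
  - exact: scaler_linear.
  - exact: ext_scale_lin.
  apply: (etrans (esym (tensZl c q l))); rewrite -mul_polyC.
  exact: (esym (ext_scale_tens c%:P q l)).
have P1 (l : L) : P ((1 : {poly K}) ⊗ l).
  apply: (@current_span K g (fun l => P ((1 : {poly K}) ⊗ l))).
    exact: Pgen.
  move=> c u v Pu Pv.
  have -> : (1 : {poly K}) ⊗ (c *: u + v) = ext_scale c%:P (1 ⊗ u) + 1 ⊗ v :> T.
    apply: (etrans (tens_linear_r (1 : {poly K}) c u v)).
    exact: (congr1 (fun z => z + (1 ⊗ v : T)) (scaleK c (1 ⊗ u))).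
  exact: (Plin c%:P (1 ⊗ u) (1 ⊗ v) Pu Pv).
have P0 : P 0.
  have := Plin (-1) _ _ (P1 0) (P1 0).
  by rewrite (scaleN1r (1 ⊗ 0 : E)) (addNr (1 ⊗ 0 : E)).
apply: (@tensor_ind K {poly K} L P) => [p l|c u v Pu Pv].
  have -> : p ⊗ l = ext_scale p (1 ⊗ l) + 0 :> T.
    rewrite addr0; apply: (etrans _ (esym (ext_scale_tens p 1 l))).
    by rewrite mulr1.
  exact: (Plin p _ _ (P1 l) P0).
by rewrite (scaleK c u); exact: (Plin c%:P u v Pu Pv).
Qed.

Lemma poly_bracket_gen x y n m : poly_bracket (t x n) (t y m) =
  if oddz n && oddz m then
    t (br x y) (n + m) + p1 *: t (br x y) (n + m - 2) + p2 *: t (br x y) (n + m - 4)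
  else t (br x y) (n + m).
Proof.
have gen tab : coef_bracket tab (t x n) (t y m) = 1 ⊗ (br x y ⊗ tab n m : L) :> E.
  have tbE : tensor_bracket br (basis_mul tab) (x ⊗ A n) (y ⊗ A m)
      = br x y ⊗ tab n m.
    rewrite (tensor_bracket_tens br_l br_r (basis_mul_linear_l tab)
      (basis_mul_linear_r tab)).
    by rewrite basis_mulA.
  apply: (etrans (cb_tens tab 1 1 (x ⊗ A n) (y ⊗ A m))).
  exact: (congr2 tens (mulr1 (1 : {poly K})) tbE).
have gen0 : (1 : {poly K}) ⊗ (br x y ⊗ 0 : L) = 0 :> E.
  exact: (etrans (congr1 (tens 1) (tens0r _ (br x y))) (tens0r L 1)).
rewrite /poly_bracket !gen /gen_table /classical_table; case: ifP => // _.
have add0 (a z : E) : z = 0 -> a + p1 *: z + p2 *: z = a.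
  by move=> ->; rewrite !scaler0 !addr0.
exact: add0 gen0.
Qed.

Lemma poly_bracket_lie : lie_bracket poly_bracket.
Proof.
apply: (@current_lie_bracket _ _ _ _ br t _ p1 p2 g_lie).
- move=> n x y.
  exact: (etrans (congr1 (tens 1) (tensDl x y (A n))) (tensDr _ _ _)).
- exact: poly_span.
- exact: poly_bracket_linear_l.
- exact: poly_bracket_linear_r.
- exact: poly_bracket_gen.
Qed.

Lemma eval_atZ (a : K) (p : {poly K}) (u : E) :
  eval_at a (p *: u) = p.[a] *: eval_at a u.
Proof.
pose T := tensor {poly K} L.
apply: (@tensor_eq K {poly K} L L (fun u => eval_at a (ext_scale p u))
  (fun u => p.[a] *: eval_at a u)) => [||q l].
- exact: (linear_comp (@eval_at_linear K L a) (ext_scale_lin p)).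
- exact: (linear_comp (@scaler_linear K L p.[a]) (@eval_at_linear K L a)).
apply: (etrans (congr1 (@eval_at K L a) (ext_scale_tens p q l))).
apply: (etrans (eval_at_tens a (p * q) l)).
by rewrite (eval_at_tens a q l) hornerM_comm ?scalerA //; exact: mulrC.
Qed.

Lemma eval_at_lin (a : K) (p : {poly K}) (u v : E) :
  eval_at a (p *: u + v) = p.[a] *: eval_at a u + eval_at a v.
Proof.
by rewrite -eval_atZ; exact: (linear_additive (@eval_at_linear K L a)).
Qed.

Lemma eval_at_t (a : K) x n : eval_at a (t x n) = x ⊗ A n.
Proof. by rewrite eval_at_tens hornerC scale1r. Qed.

(** Both sides are semilinear in u and v for evaluation at a, so it suffices to
    compare them on generators. *)
Lemma poly_bracket_eval a u v : eval_at a (poly_bracket u v) =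
  current_bracket br p1.[a] p2.[a] (eval_at a u) (eval_at a v).
Proof.
pose bl := current_bracket_linear_l g_lie p1.[a] p2.[a].
pose brr := current_bracket_linear_r g_lie p1.[a] p2.[a].
pose F := current_bracket br p1.[a] p2.[a]; pose ev := @eval_at K L a.
move: u; apply: poly_span => [x n|c u u' hu hu']; last first.
  apply: (etrans (congr1 ev (poly_bracket_linear_l v c u u'))).
  apply: (etrans (eval_at_lin a c (poly_bracket u v) (poly_bracket u' v))).
  apply: (etrans (congr2 (fun y z : L => c.[a] *: y + z) hu hu')).
  apply: (etrans (esym (bl (ev v) c.[a] (ev u) (ev u')))).
  exact: (congr1 (fun z => F z (ev v)) (esym (eval_at_lin a c u u'))).
move: v; apply: poly_span => [y m|c v v' hv hv']; last first.
  apply: (etrans (congr1 ev (poly_bracket_linear_r (t x n) c v v'))).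
  apply: (etrans (eval_at_lin a c (poly_bracket (t x n) v) (poly_bracket (t x n) v'))).
  apply: (etrans (congr2 (fun y z : L => c.[a] *: y + z) hv hv')).
  apply: (etrans (esym (brr (ev (t x n)) c.[a] (ev v) (ev v')))).
  exact: (congr1 (F (ev (t x n))) (esym (eval_at_lin a c v v'))).
apply: (etrans (congr1 ev (poly_bracket_gen x y n m))).
apply: (etrans _ (esym (congr2 F (eval_at_t a x n) (eval_at_t a y m)))).
apply: (etrans _ (esym (current_bracket_gen g_lie p1.[a] p2.[a] x y n m))).
case: (oddz n && oddz m); last exact: eval_at_t.
have evZ p z k : ev (p *: t z k) = p.[a] *: (z ⊗ A k).
  exact: (etrans (eval_atZ a p (t z k)) (congr1 ( *:%R p.[a]) (eval_at_t a z k))).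
have evD (y1 y2 : E) : ev (y1 + y2) = ev y1 + ev y2.
  exact: (linear_additive (@eval_at_linear K L a)).
apply: (etrans (evD _ _)); apply: (congr2 +%R _ (evZ p2 _ _)).
apply: (etrans (evD _ _)); exact: (congr2 +%R (eval_at_t a _ _) (evZ p1 _ _)).
Qed.

Lemma poly_bracket_deformation : p1.[0] = 0 -> p2.[0] = 0 ->
  is_deformation (classical_bracket br) poly_bracket.
Proof.
move=> p10 p20.
have clE : current_bracket br p1.[0] p2.[0] = classical_bracket br.
  by rewrite p10 p20 classical_bracketE.
apply: IsDeformation => [|u v|l]; first exact: poly_bracket_lie.
  apply: (etrans (poly_bracket_eval 0 u v)).
  exact: (congr1 (fun F : L -> L -> L => F (eval_at 0 u) (eval_at 0 v)) clE).
exists ((1 : {poly K}) ⊗ l); apply: (etrans (eval_at_tens 0 1 l)).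
by rewrite hornerC scale1r.
Qed.

End Deformation.

Section Isomorphism.
Variables (K : comNzRingType) (g : lmodType K) (br : g -> g -> g).
Hypothesis g_lie : lie_bracket br.
Variables (V W : lmodType K) (mV : V -> V -> V) (mW : W -> W -> W).
Hypotheses (mV_l : forall h, linear (mV^~ h)) (mV_r : forall f, linear (mV f)).
Hypotheses (mW_l : forall h, linear (mW^~ h)) (mW_r : forall f, linear (mW f)).

Let br_l := lie_linear_l g_lie.
Let br_r := lie_linear_r g_lie.

Definition tensor_map (U U' : lmodType K) (f : U -> U') : tensor g U -> tensor g U' :=
  tensor_lift (fun x u => x ⊗ f u).

Lemma tensor_map_tens (U U' : lmodType K) (f : U -> U') x u :
  linear f -> tensor_map f (x ⊗ u) = x ⊗ f u.
Proof.
move=> fl; apply: tensor_lift_tens => [w|y]; first exact: tens_linear_l.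
by move=> c u1 u2; rewrite fl tens_linear_r.
Qed.

Lemma tensor_map_linear (U U' : lmodType K) (f : U -> U') :
  linear f -> linear (tensor_map f).
Proof.
move=> fl; apply: tensor_lift_linear => [w|y]; first exact: tens_linear_l.
by move=> c u1 u2; rewrite fl tens_linear_r.
Qed.

Lemma tensor_mapK (U U' : lmodType K) (f : U -> U') (f' : U' -> U) :
  linear f -> linear f' -> cancel f f' -> cancel (tensor_map f) (tensor_map f').
Proof.
move=> fl fl' fK; apply: tensor_eq => [||x u].
- exact: linear_comp (tensor_map_linear fl') (tensor_map_linear fl).
- by move=> c u v.
by rewrite !tensor_map_tens ?fK.
Qed.

Lemma lie_isomorphic_tensor (f : V -> W) : linear f -> bijective f ->
  (forall u v, f (mV u v) = mW (f u) (f v)) ->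
  lie_isomorphic (tensor_bracket br mV) (tensor_bracket br mW).
Proof.
move=> fl [f' fK f'K] fM.
have fl' : linear f'.
  by move=> c u v; apply: (can_inj fK); rewrite fl !f'K.
pose Phi : {linear tensor g V -> tensor g W} :=
  HB.pack (tensor_map f)
    (GRing.isLinear.Build _ _ _ _ (tensor_map f) (tensor_map_linear fl)).
exists Phi; first by exists (tensor_map f'); exact: tensor_mapK.
have bVl v : linear (fun u => tensor_bracket br mV u v) by exact: tensor_bracket_linear_l.
have bVr u : linear (tensor_bracket br mV u) by exact: tensor_bracket_linear_r.
have bWl v : linear (fun u => tensor_bracket br mW u v) by exact: tensor_bracket_linear_l.
have bWr u : linear (tensor_bracket br mW u) by exact: tensor_bracket_linear_r.
have ml := tensor_map_linear fl.
move=> u v; rewrite -[LHS]/(tensor_map f (tensor_bracket br mV u v))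
  -[RHS]/(tensor_bracket br mW (tensor_map f u) (tensor_map f v)).
move: u; apply: (tensor_eq (linear_comp ml (bVl v))
  (linear_comp (bWl (tensor_map f v)) ml)) => x u /=.
move: v; apply: (tensor_eq (linear_comp ml (bVr (x ⊗ u)))
  (linear_comp (bWr (tensor_map f (x ⊗ u))) ml)) => y v /=.
by rewrite !tensor_map_tens // !tensor_bracket_tens // tensor_map_tens // fM.
Qed.

End Isomorphism.

(** * Bases and independence *)

Section BasisMap.
Variables (K : comNzRingType) (W : lmodType K) (b : int -> W).
Local Notation V := (malg int K).

Definition basis_map (f : V) : W := \sum_(n <- msupp f) mcoeff n f *: b n.

Lemma basis_mapEw (f : V) (d : {fset int}) : (msupp f `<=` d)%fset ->
  basis_map f = \sum_(n <- d) mcoeff n f *: b n.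
Proof.
move=> sd; apply: big_fset_incl => // n _ nn.
by rewrite mcoeff_outdom // scale0r.
Qed.

Lemma basis_map_linear : linear basis_map.
Proof.
move=> c f h; set d := (msupp f `|` msupp h)%fset.
have sf : (msupp f `<=` d)%fset by apply: fsubsetUl.
have sh : (msupp h `<=` d)%fset by apply: fsubsetUr.
rewrite (basis_mapEw sf) (basis_mapEw sh) (@basis_mapEw _ d); last first.
  by apply: (fsubset_trans (msuppD_le _ _)); apply: fsetUSS => //; exact: msuppZ_le.
rewrite scaler_sumr -big_split; apply: eq_bigr => n _ /=.
by rewrite mcoeffD mcoeffZ scalerDl scalerA.
Qed.

Lemma basis_mapA n : basis_map (A n) = b n.
Proof. by rewrite /basis_map msuppU oner_eq0 big_seq_fset1 mcoeffUU scale1r. Qed.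

Lemma eq_basis (f h : V -> W) : linear f -> linear h ->
  (forall n, f (A n) = h (A n)) -> f =1 h.
Proof.
by move=> fl hl fh; apply: malg_A_ind => // c u v fu fv; rewrite fl hl fu fv.
Qed.

End BasisMap.

Lemma basis_morphism (K : comNzRingType) (W : lmodType K) (f : malg int K -> W)
  (c : int -> int -> malg int K) (m : W -> W -> W) :
  linear f -> (forall w, linear (m^~ w)) -> (forall w, linear (m w)) ->
  (forall i j, f (c i j) = m (f (A i)) (f (A j))) ->
  forall u v, f (basis_mul c u v) = m (f u) (f v).
Proof.
move=> fl ml mr fc u v; move: u.
apply: (@eq_basis K W (fun u => f (basis_mul c u v)) (fun u => m (f u) (f v))).
- exact: linear_comp fl (basis_mul_linear_l c v).
- exact: linear_comp (ml (f v)) fl.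
move=> i; move: v.
apply: (@eq_basis K W (fun v => f (basis_mul c (A i) v)) (fun v => m (f (A i)) (f v))).
- exact: linear_comp fl (basis_mul_linear_r c (A i)).
- exact: linear_comp (mr (f (A i))) fl.
by move=> j; rewrite basis_mulA.
Qed.

(** The isomorphism is A_n |-> l^n A_n. *)
Lemma current_rescale (K : fieldType) (g : lmodType K) (br : g -> g -> g)
  (g_lie : lie_bracket br) (c1 c2 l : K) : l != 0 ->
  lie_isomorphic (current_bracket br (l ^+ 2 * c1) (l ^+ 4 * c2))
                 (current_bracket br c1 c2).
Proof.
move=> l0; pose f (k : K) := basis_map (fun n => k ^ n *: A n : malg int K).
have fl k : linear (f k) by exact: basis_map_linear.
have fA k n : f k (A n) = k ^ n *: A n by exact: basis_mapA.
have fK k : k != 0 -> cancel (f k) (f k^-1).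
  move=> k0; apply: eq_basis => [||n]; first exact: (linear_comp (fl _) (fl k)).
    by move=> c u v.
  by rewrite fA (linear_scale _ _ (fl _)) fA scalerA -expfzMl divff ?exp1rz ?scale1r.
have fbij : bijective (f l).
  by exists (f l^-1); [exact: fK|rewrite -{2}[l]invrK; apply: fK; rewrite invr_eq0].
have ml c := @basis_mul_linear_l K c; have mr c := @basis_mul_linear_r K c.
apply: (lie_isomorphic_tensor g_lie (ml _) (mr _) (ml _) (mr _) (fl l) fbij).
apply: (basis_morphism (fl l) (ml _) (mr _)) => i j.
have fZ k n c : f k (c *: A n) = (c * k ^ n) *: A n.
  by rewrite (linear_scale _ _ (fl k)) fA scalerA.
have fD k u v : f k (u + v) = f k u + f k v by exact: (linear_additive (fl k)).
have mZ (c : int -> int -> malg int K) u v a b :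
    basis_mul c (a *: u) (b *: v) = (a * b) *: basis_mul c u v.
  by rewrite (linear_scale _ _ (ml c _)) (linear_scale _ _ (mr c _)) scalerA.
have scale3 (W : lmodType K) (x y z : W) w s1 s2 s3 d1 d2 :
    s1 = w -> s2 = w * d1 -> s3 = w * d2 ->
    s1 *: x + s2 *: y + s3 *: z = w *: (x + d1 *: y + d2 *: z).
  by move=> -> -> ->; rewrite !scalerDr !scalerA.
have lin3 k d1 d2 p q r : f k (A p + d1 *: A q + d2 *: A r)
    = k ^ p *: A p + (d1 * k ^ q) *: A q + (d2 * k ^ r) *: A r.
  by rewrite (fD k _ (d2 *: A r)) (fD k _ (d1 *: A q)) fA !fZ.
have rhs : basis_mul (table c1 c2) (f l (A i)) (f l (A j))
    = (l ^ i * l ^ j) *: table c1 c2 i j.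
  by rewrite (fA l i) (fA l j) mZ basis_mulA.
apply: etrans (esym rhs); rewrite /table; case: (oddz i && oddz j); last first.
  by rewrite (fA l (i + j)) expfzDr.
have l2 : l ^ (- 2) = (l ^+ 2)^-1 by [].
have l4 : l ^ (- 4) = (l ^+ 4)^-1 by [].
apply: (etrans (lin3 _ _ _ _ _ _)); apply: scale3; rewrite !expfzDr // ?l2 ?l4.
  by field.
by field.
Qed.

Lemma poly_zero_off (C : numClosedFieldType) (S : seq C) (p : {poly C}) :
  (forall x, x \notin S -> p.[x] = 0) -> p = 0.
Proof.
move=> pS; pose D := \prod_(s <- S) ('X - s%:P).
have D0 : D != 0 by rewrite monic_neq0 // monic_prod_XsubC.
suff : p * D = 0 by move/eqP; rewrite mulf_eq0 (negPf D0) orbF => /eqP.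
apply/eqP; apply: contraT => pD0.
have := max_poly_roots pD0 (rs := [seq i%:R : C | i <- iota 0 (size (p * D))]).
rewrite size_map size_iota ltnn; apply.
  apply/allP => x _; rewrite /root hornerM; apply/eqP.
  have [xS|/pS ->] := boolP (x \in S); last by rewrite mul0r.
  suff -> : D.[x] = 0 by rewrite mulr0.
  by apply/eqP; move: xS; rewrite -root_prod_XsubC.
by rewrite map_inj_uniq ?iota_uniq // => i j /eqP; rewrite eqr_nat => /eqP.
Qed.

(** A power of w clears the denominators, and a polynomial with infinitely many
    zeros is 0; the injectivity of k on P prevents the monomials from merging. *)
Lemma laurent_independent (C : numClosedFieldType) (S : seq C) (r : seq int)
  (a : int -> C) (k : int -> int) (P : pred int) : uniq r ->
  {in P &, injective k} ->
  (forall w, w != 0 -> w \notin S -> \sum_(n <- r | P n) a n * w ^ k n = 0) ->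
  forall n, n \in r -> P n -> a n = 0.
Proof.
(* The exponent N is large enough for all k m + N to be nonnegative. *)
move=> ur kinj holomorphic_vanish n nr Pn; pose N := (\sum_(m <- r) `|k m|)%N.
pose e m := `|(k m + N%:Z)%R|%N.
have eE m : m \in r -> (e m)%:Z = k m + N%:Z.
  move=> mr; rewrite /e gez0_abs //.
  have : (`|k m| <= N)%N by rewrite /N (big_rem m) //= leq_addr.
  lia.
have p0 : \sum_(m <- r | P m) a m *: 'X^(e m) = 0 :> {poly C}.
  apply: (poly_zero_off (S := 0 :: S)) => w; rewrite inE negb_or => /andP[w0 wS].
  rewrite horner_sum; transitivity (\sum_(m <- r | P m) a m * w ^ k m * w ^+ N).
    rewrite [LHS]big_seq_cond [RHS]big_seq_cond; apply: eq_bigr => m /andP[mr _].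
    by rewrite hornerZ hornerXn -mulrA !exprnP -expfzDr // eE.
  by rewrite -mulr_suml holomorphic_vanish // mul0r.
have := congr1 (fun p : {poly C} => p`_(e n)) p0; rewrite coef0 coef_sum.
rewrite big_mkcond (bigD1_seq n) //= Pn coefZ coefXn eqxx mulr1.
rewrite big_seq_cond big1 ?addr0 // => m /andP[mr mn]; case: ifP => // Pm.
rewrite coefZ coefXn.
suff /negPf -> : e n != e m by rewrite mulr0.
apply: contra mn => /eqP enm; apply/eqP; apply: kinj => //.
have := eE _ nr; rewrite enm eE //; exact: addIr.
Qed.

Lemma oddz_half (n : int) : n = (n %/ 2)%Z * 2 + (oddz n)%:Z.
Proof. rewrite /oddz; lia. Qed.

Section EllipticBasis.
Variables (C : numClosedFieldType) (e1 e2 : C).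
Local Notation e3 := (- (e1 + e2)).
Local Notation point := (curve_point e1 e2).
Local Notation alg := (elliptic_algebra e1 e2).
Local Notation V := (malg int C).
Implicit Types (q : point) (n : int).

(** The function that plays the part of A_n; halving rounds down, so that
    n = 2k + 1 gives Y w^(k-1) / 2. *)
Definition basis_fun n q : C :=
  if oddz n then 2^-1 * Yc q * Wc q ^ ((n %/ 2)%Z - 1) else Wc q ^ (n %/ 2)%Z.

Lemma basis_fun_even (k : int) q : basis_fun (k * 2) q = Wc q ^ k.
Proof.
have -> : basis_fun (k * 2) q = Wc q ^ (k * 2 %/ 2)%Z.
  by rewrite /basis_fun (_ : oddz _ = false) // /oddz; lia.
by rewrite mulzK.
Qed.

Lemma basis_fun_odd (k : int) q :
  basis_fun (k * 2 + 1) q = 2^-1 * Yc q * Wc q ^ (k - 1).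
Proof.
rewrite /basis_fun (_ : oddz _ = true); last by rewrite /oddz; lia.
by rewrite (_ : ((k * 2 + 1) %/ 2)%Z = k) //; lia.
Qed.

Hypotheses (e12 : e1 != e2) (e13 : e1 != e3) (e23 : e2 != e3).

Lemma elliptic_funX (f : point -> C) (n : nat) : elliptic_fun f ->
  elliptic_fun (fun q => f q ^+ n).
Proof.
move=> fe; elim: n => [|n IH]; first exact: (elliptic_fun_cst e1 e2 1).
have := elliptic_funM fe IH.
by rewrite (_ : f * _ = fun q => f q ^+ n.+1) //; apply/funext => q; rewrite exprS.
Qed.

Lemma elliptic_Wc_expz (k : int) : elliptic_fun (fun q : point => Wc q ^ k).
Proof.
case: k => k; first by have := elliptic_funX k (elliptic_Wc e12 e13 e23).
rewrite (_ : (fun q => _) = fun q => (Wc q)^-1 ^+ k.+1).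
  by apply: elliptic_funX; exact: elliptic_WcV.
by apply/funext => q; rewrite NegzE -exprz_inv.
Qed.

Lemma elliptic_basis_fun n : basis_fun n \in elliptic_pred (e1 := e1) (e2 := e2).
Proof.
apply/asboolP; case on: (oddz n); last first.
  rewrite (_ : basis_fun n = fun q => Wc q ^ (n %/ 2)%Z).
    exact: elliptic_Wc_expz.
  by apply/funext => q; rewrite /basis_fun on.
have Ye : elliptic_fun (@Yc C e1 e2) by exact: elliptic_Yc.
have := elliptic_funM (elliptic_fun_cst e1 e2 2^-1)
  (elliptic_funM Ye (elliptic_Wc_expz ((n %/ 2)%Z - 1))).
rewrite (_ : _ * _ = basis_fun n) //.
by apply/funext => q; rewrite /basis_fun on -mulrA.
Qed.

Definition elliptic_basis n : alg := EllipticAlgebra (elliptic_basis_fun n).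

End EllipticBasis.

(** * The elliptic current algebra as a member of the family *)

Section EllipticIso.
Variables (C : numClosedFieldType) (e1 e2 : C).
Local Notation e3 := (- (e1 + e2)).
Hypotheses (e12 : e1 != e2) (e13 : e1 != e3) (e23 : e2 != e3).
Hypothesis liouvilleC : liouville_property C.
Local Notation point := (curve_point e1 e2).
Local Notation alg := (elliptic_algebra e1 e2).
Local Notation V := (malg int C).
Implicit Types (q : point) (n : int).

Definition elliptic_map : V -> alg := basis_map (elliptic_basis e12 e13 e23).

Lemma elliptic_map_linear : linear elliptic_map.
Proof. exact: basis_map_linear. Qed.

Let evalq q (f : alg) : C^o := f q.

Let evalq_linear q : linear (evalq q).
Proof. by []. Qed.

Lemma elliptic_mapE v q : elliptic_map v q = \sum_(n <- msupp v) mcoeff n v * basis_fun n q.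
Proof.
move: v; apply: (@eq_basis C C^o (fun v => elliptic_map v q : C^o)
  (basis_map (fun n => basis_fun n q : C^o))) => [||n].
- exact: (linear_comp (evalq_linear q) elliptic_map_linear).
- exact: basis_map_linear.
by rewrite basis_mapA /elliptic_map basis_mapA.
Qed.

Lemma elliptic_mul_linear_l (h : alg) : linear (@elliptic_mul C e1 e2 ^~ h).
Proof.
move=> c f f'; apply: val_inj; apply/funext => q.
rewrite -[LHS]/((c * f q + f' q) * h q) -[RHS]/(c * (f q * h q) + f' q * h q).
by rewrite mulrDl mulrA.
Qed.

Lemma elliptic_mul_linear_r (f : alg) : linear (@elliptic_mul C e1 e2 f).
Proof.
move=> c h h'; apply: val_inj; apply/funext => q.
rewrite -[LHS]/(f q * (c * h q + h' q)) -[RHS]/(c * (f q * h q) + f q * h' q).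
by rewrite mulrDr mulrCA.
Qed.

(** Only the case of two odd indices is not a matter of exponents: there
    (Y / 2)^2 = w (w + e1 - e2) (w + e1 - e3), and the coefficients of the
    product of the last two factors are 1, 3 e1 and (e1 - e2) (2 e1 + e2). *)
Lemma elliptic_map_mul u v :
  elliptic_map (basis_mul (table (3 * e1) ((e1 - e2) * (2 * e1 + e2))) u v)
  = elliptic_mul (elliptic_map u) (elliptic_map v).
Proof.
move: u v; apply: (basis_morphism elliptic_map_linear elliptic_mul_linear_l
  elliptic_mul_linear_r) => i j.
have mapA n : elliptic_map (A n) = elliptic_basis e12 e13 e23 n by exact: basis_mapA.
have mapAq n q : elliptic_map (A n) q = basis_fun n q by rewrite mapA.
apply: val_inj; apply/funext => q.
rewrite -[RHS]/(elliptic_map (A i) q * elliptic_map (A j) q) !mapAq.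
rewrite -[LHS]/(elliptic_map (table (3 * e1) ((e1 - e2) * (2 * e1 + e2)) i j) q).
have mapD (u v : V) : elliptic_map (u + v) q = elliptic_map u q + elliptic_map v q.
  by rewrite (linear_additive elliptic_map_linear).
have mapZ c (u : V) : elliptic_map (c *: u) q = c * elliptic_map u q.
  by rewrite (linear_scale _ _ elliptic_map_linear).
have W0 : Wc q != 0 by exact: Wc_neq0.
rewrite /table; move: (oddz_half i) (oddz_half j).
set a := (i %/ 2)%Z; set b := (j %/ 2)%Z.
case: (oddz i); case: (oddz j) => /= -> ->; rewrite ?addr0.
- rewrite !mapD !mapZ !mapAq !basis_fun_odd.
  have -> : a * 2 + 1 + (b * 2 + 1) = (a + b + 1) * 2 by ring.
  have -> : (a + b + 1) * 2 - 2 = (a + b) * 2 by ring.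
  have -> : (a + b + 1) * 2 - 4 = (a + b - 1) * 2 by ring.
  have Y2 : Yc q * Yc q = 4 * Wc q * (Wc q + (e1 - e2)) * (Wc q + (e1 - e3)).
    by rewrite -expr2 curveE /Wc; ring.
  have -> : 2^-1 * Yc q * Wc q ^ (a - 1) * (2^-1 * Yc q * Wc q ^ (b - 1))
      = 4^-1 * (Yc q * Yc q) * Wc q ^ (a - 1) * Wc q ^ (b - 1) by field.
  rewrite Y2 !basis_fun_even !expfzDr // expr1z -exprz_inv expr1z.
  by field.
- rewrite mapAq (_ : a * 2 + 1 + b * 2 = (a + b) * 2 + 1); last by ring.
  rewrite !basis_fun_odd basis_fun_even !expfzDr //; ring.
- rewrite mapAq (_ : a * 2 + (b * 2 + 1) = (a + b) * 2 + 1); last by ring.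
  rewrite !basis_fun_odd basis_fun_even !expfzDr //; ring.
- rewrite mapAq (_ : a * 2 + b * 2 = (a + b) * 2); last by ring.
  by rewrite !basis_fun_even expfzDr.
Qed.

(** The values at (X, Y) and (X, - Y) separate the even basis functions from the
    odd ones, and each of the two families consists of distinct powers of w, up
    to the common factor Y / 2. *)
Lemma elliptic_map_inj : injective elliptic_map.
Proof.
suff ker v : elliptic_map v = 0 -> v = 0.
  move=> u v uv; apply/eqP; rewrite -subr_eq0; apply/eqP/ker.
  rewrite addrC -scaleN1r elliptic_map_linear uv scaleN1r addNr //.
move=> v0; pose r := enum_fset (msupp v).
have ur : uniq r by exact: fset_uniq.
pose even q := \sum_(n <- r | ~~ oddz n) mcoeff n v * Wc q ^ (n %/ 2)%Z.
pose odd q := \sum_(n <- r | oddz n) mcoeff n v * Wc q ^ ((n %/ 2)%Z - 1).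
have split q : even q + 2^-1 * Yc q * odd q = 0.
  have := elliptic_mapE v q; rewrite v0 -[LHS]/(0 : C) => ->.
  rewrite (bigID oddz) /= addrC; congr (_ + _).
    by apply: eq_bigr => n /negPf on; rewrite /basis_fun on.
  rewrite mulr_sumr; apply: eq_bigr => n on; rewrite /basis_fun on.
  by rewrite mulrCA.
have negE q : even (neg q) = even q /\ odd (neg q) = odd q by [].
have even0 q : even q = 0.
  have s1 := split q; have := split (neg q); have [-> ->] := negE q.
  rewrite -[Yc (neg q)]/(- Yc q) => s2.
  have : 2 * even q = 0 by rewrite -[RHS]addr0 -{1}s1 -s2; ring.
  by move/eqP; rewrite mulf_eq0 pnatr_eq0 /= => /eqP.
have odd0 q : Yc q != 0 -> odd q = 0.
  move=> Y0; have := split q; rewrite even0 add0r => /eqP.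
  by rewrite !mulf_eq0 (negPf Y0) invr_eq0 pnatr_eq0 /= => /eqP.
have over w : w != 0 -> exists2 q : point, Wc q = w & Xc q = w + e1.
  move=> w0; have [|q Xq] := @exists_over C e1 e2 (w + e1).
    by rewrite -subr_eq0 addrK.
  by exists q => //; rewrite /Wc Xq addrK.
have half_inj (b : bool) (k : int) : {in [pred n | oddz n == b] &,
    injective (fun n => (n %/ 2)%Z - k)}.
  move=> n m; rewrite !inE => /eqP on /eqP om /addIr nm.
  by rewrite (oddz_half n) (oddz_half m) on om nm.
apply/malgP => n; rewrite mcoeff0.
have [nr|nr] := boolP (n \in msupp v); last by rewrite mcoeff_outdom.
case on: (oddz n).
  apply: (@laurent_independent C [:: e2 - e1; e3 - e1] r (fun n => mcoeff n v)
    (fun n => (n %/ 2)%Z - 1) oddz ur _ _ n nr on).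
    move=> m k om ok; apply: (@half_inj true 1); rewrite inE; exact/eqP.
  move=> w w0; rewrite !inE negb_or => /andP[w2 w3].
  have [q Wq _] := over w w0; rewrite -Wq; apply: odd0.
  apply/eqP => /Yc_eq0[] Xe; [move: w2|move: w3];
    by rewrite -Wq /Wc Xe eqxx.
apply: (@laurent_independent C [::] r (fun n => mcoeff n v)
  (fun n => (n %/ 2)%Z) (fun n => ~~ oddz n) ur _ _ n nr (negbT on)).
  move=> m k om ok mk; apply: (@half_inj false 0); rewrite ?inE ?subr0 ?mk //.
    by rewrite (negPf om).
  by rewrite (negPf ok).
by move=> w w0 _; have [q <- _] := over w w0; exact: even0.
Qed.

Lemma elliptic_map_surj f : exists v, elliptic_map v = f.
Proof.
have fe : elliptic_fun f by apply/asboolP; exact: elliptic_valP.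
have [m [P [Q PQ]]] := elliptic_fun_laurent e12 e13 e23 liouvilleC fe.
pose lin : {linear V -> alg} :=
  HB.pack elliptic_map (GRing.isLinear.Build _ _ _ _ elliptic_map elliptic_map_linear).
pose v : V := \sum_(i < size P) P`_i *: A ((i%:Z - m%:Z) * 2)
  + \sum_(i < size Q) (2 * Q`_i) *: A ((i%:Z - m%:Z + 1) * 2 + 1).
exists v; apply: val_inj; apply/funext => q.
have W0 : Wc q != 0 by exact: Wc_neq0.
have mapZ c n : elliptic_map (c *: A n) q = c * basis_fun n q.
  rewrite (linear_scale _ _ elliptic_map_linear).
  by rewrite -[LHS]/(c * elliptic_map (A n) q) /elliptic_map basis_mapA.
have WE (k : nat) : Wc q ^ (k%:Z - m%:Z) = Wc q ^+ k / Wc q ^+ m.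
  by rewrite expfzDr // -exprnP -exprnN.
have sum_q (I : finType) (u : I -> V) :
    elliptic_map (\sum_i u i) q = \sum_i elliptic_map (u i) q.
  rewrite -[LHS]/(elliptic_val (lin (\sum_i u i)) q) linear_sum.
  exact: (big_morph (evalq q) (id1 := 0) (op1 := +%R)).
rewrite -[RHS]/(f q) (linear_additive elliptic_map_linear).
rewrite -[LHS]/(elliptic_map (\sum_(i < size P) P`_i *: A ((i%:Z - m%:Z) * 2)) q
  + elliptic_map (\sum_(i < size Q) (2 * Q`_i) *: A ((i%:Z - m%:Z + 1) * 2 + 1)) q).
apply: (mulfI (expf_neq0 m W0)); rewrite PQ !sum_q mulrDr !mulr_sumr.
rewrite !horner_coef mulr_suml; congr (_ + _); apply: eq_bigr => i _.
  by rewrite mapZ basis_fun_even WE; field; exact: expf_neq0.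
by rewrite mapZ basis_fun_odd addrK WE; field; exact: expf_neq0.
Qed.

Lemma elliptic_iso (g : lmodType C) (br : g -> g -> g) : lie_bracket br ->
  is_elliptic_current_algebra br (family_bracket br e1 e2).
Proof.
move=> g_lie; exists e1, e2; split=> //.
have [inv invK] := choice elliptic_map_surj.
have bij : bijective elliptic_map.
  by exists inv => // v; apply: elliptic_map_inj; rewrite invK.
have := @lie_isomorphic_tensor C g br g_lie V alg _ _ (basis_mul_linear_l _)
  (basis_mul_linear_r _) elliptic_mul_linear_l elliptic_mul_linear_r elliptic_map
  elliptic_map_linear bij elliptic_map_mul.
exact.
Qed.

End EllipticIso.

(** * The families on the lines D_s *)

Lemma liouville_complex (R : realType) : liouville_property R[i].
Proof.
move=> f S N M r M0 r0 cf hf growth.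
have [m mE] : exists m : R, M = m%:C%C by apply/complex_realP; exact: ger0_real.
have [t tE] : exists t : R, r = t%:C%C by apply/complex_realP; exact: ger0_real.
have := @liouville R f S N m t cf hf; rewrite -mE -tE => /(_ growth)[p _ fp].
by exists p.
Qed.

Section LineFamily.
Variables (C : comNzRingType) (s : option C).

Definition line_c1 (e : C) : C := if s is Some _ then 3 * e else 0.

Definition line_c2 (e : C) : C :=
  if s is Some s0 then e ^+ 2 * (1 - s0) * (2 + s0) else - e.

Definition line_p1 : {poly C} := if s is Some _ then 3 *: 'X else 0.

Definition line_p2 : {poly C} :=
  if s is Some s0 then ((1 - s0) * (2 + s0)) *: 'X^2 else - 'X.

Lemma line_p1E e : line_p1.[e] = line_c1 e.
Proof.
by rewrite /line_p1 /line_c1; case: s => [s0|]; rewrite ?horner0 // hornerZ hornerX.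
Qed.

Lemma line_p2E e : line_p2.[e] = line_c2 e.
Proof.
rewrite /line_p2 /line_c2; case: s => [s0|]; last by rewrite hornerN hornerX.
by rewrite hornerZ hornerXn mulrC mulrA.
Qed.

Lemma line_c1_0 : line_c1 0 = 0.
Proof. by rewrite /line_c1; case: s => [s0|]; rewrite ?mulr0. Qed.

Lemma line_c2_0 : line_c2 0 = 0.
Proof.
by rewrite /line_c2; case: s => [s0|]; rewrite ?oppr0 // expr0n !mul0r.
Qed.

Lemma family_bracket_line (g : lmodType C) (br : g -> g -> g) e1 e2 :
  line s e1 e2 -> current_bracket br (line_c1 (line_param s e1 e2))
                                     (line_c2 (line_param s e1 e2))
                = family_bracket br e1 e2.
Proof.
move=> on_line; rewrite family_bracketE.
have -> : line_c1 (line_param s e1 e2) = 3 * e1.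
  by move: on_line; rewrite /line_c1 /line; case: s => [//|] ->; rewrite mulr0.
have -> // : line_c2 (line_param s e1 e2) = (e1 - e2) * (2 * e1 + e2).
by move: on_line; rewrite /line_c2 /line; case: s => [s0|] /= ->; ring.
Qed.

End LineFamily.

(** The three differences of e1, e2, e3 are e times 1 - s, 2 + s and 1 + 2 s; for
    s = infinity the roots are 0 and the two square roots of e. *)
Lemma line_distinct (C : numClosedFieldType) (s : option C) (e : C) : e != 0 ->
  s != Some 1 -> s != Some (- (1 / 2)) -> s != Some (- 2) ->
  exists e1 e2, [/\ line s e1 e2, line_param s e1 e2 = e
    & [/\ e1 != e2, e1 != - (e1 + e2) & e2 != - (e1 + e2)]].
Proof.
move=> e0; case: s => [s|] s1 s12 s2 /=; last first.
  have r0 : sqrtC e != 0 by rewrite sqrtC_eq0.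
  exists 0, (sqrtC e); split; rewrite ?sqrtCK //.
  split; rewrite ?add0r 1?eq_sym ?oppr_eq0 //.
  by rewrite eq_sym -addr_eq0 -mulr2n mulrn_eq0.
exists e, (s * e); split=> //.
have se a b c : c != 0 -> a - b = c * e -> a != b.
  by move=> c0 ab; rewrite -subr_eq0 ab mulf_neq0.
split.
- apply: (se _ _ (1 - s)); last by ring.
  by rewrite subr_eq0; apply: contra s1 => /eqP <-.
- apply: (se _ _ (2 + s)); last by ring.
  by rewrite addrC -[2]opprK subr_eq0; apply: contra s2 => /eqP <-.
- apply: (se _ _ (1 + 2 * s)); last by ring.
  apply: contra s12 => /eqP h; apply/eqP; congr Some.
  have -> : s = (1 + 2 * s) / 2 - 1 / 2 by field.
  by rewrite h mul0r add0r.
Qed.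

(** The weights of c1 and c2 are 2 and 4; e has weight 2 on D_s for s finite, and
    weight 4 for s = infinity. *)
Lemma line_rescale (C : numClosedFieldType) (s : option C) (e e' : C) :
  e != 0 -> e' != 0 -> exists2 l, l != 0 &
  line_c1 s e = l ^+ 2 * line_c1 s e' /\ line_c2 s e = l ^+ 4 * line_c2 s e'.
Proof.
move=> e0 e'0; pose r := sqrtC (e / e'); have r2 : r ^+ 2 = e / e' by exact: sqrtCK.
have r0 : r != 0 by rewrite sqrtC_eq0 mulf_neq0 ?invr_eq0.
case: s => [s|]; rewrite /line_c1 /line_c2; last first.
  exists (sqrtC r); first by rewrite sqrtC_eq0.
  rewrite mulr0; split=> //.
  by rewrite -[4%N]/(2 * 2)%N exprM sqrtCK r2; field.
exists r => //; rewrite -[4%N]/(2 * 2)%N exprM r2.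
by split; field.
Qed.

(* F e is the bracket of the member with parameter e of the restriction to D_s;
   s = None stands for s = infinity. *)
Theorem corollary4p3 (R : realType) (g : vectType R[i]) (br : g -> g -> g)
    (g_lie : lie_bracket br) (s : option R[i]) :
  exists F : R[i] -> tensor g (malg int R[i]) -> tensor g (malg int R[i]) ->
             tensor g (malg int R[i]),
    [/\ (forall e1 e2, line s e1 e2 ->
           F (line_param s e1 e2) = family_bracket br e1 e2),
        (forall e, lie_bracket (F e)),
        (F 0 = classical_bracket br /\
         exists2 B, is_deformation (classical_bracket br) B &
           forall e u v, eval_at e (B u v) = F e (eval_at e u) (eval_at e v))
      & [/\ (forall e x y n m,
               F e (x ⊗ A n) (y ⊗ A m) =
               if oddz n && oddz m then
                 match s with
                 | Some s =>
                     br x y ⊗ A (n + m) + (3 * e) *: (br x y ⊗ A (n + m - 2))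
                     + (e ^+ 2 * (1 - s) * (2 + s)) *: (br x y ⊗ A (n + m - 4))
                 | None =>
                     br x y ⊗ A (n + m) - e *: (br x y ⊗ A (n + m - 4))
                 end
               else br x y ⊗ A (n + m)),
             (s != Some 1 -> s != Some (- (1 / 2)) -> s != Some (- 2) ->
              forall e, e != 0 -> is_elliptic_current_algebra br (F e))
           & (forall e e', e != 0 -> e' != 0 ->
              lie_isomorphic (F e) (F e'))]].
Proof.
pose F e := current_bracket br (line_c1 s e) (line_c2 s e).
have F_line e1 e2 : line s e1 e2 ->
    F (line_param s e1 e2) = family_bracket br e1 e2.
  exact: family_bracket_line.
exists F; split; first exact: F_line.
- by move=> e; exact: current_bracket_lie.
- split; first by rewrite /F line_c1_0 line_c2_0 classical_bracketE.
  exists (poly_bracket br (line_p1 s) (line_p2 s)).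
    apply: (poly_bracket_deformation g_lie).
      by rewrite line_p1E line_c1_0.
    by rewrite line_p2E line_c2_0.
  move=> e u v; apply: (etrans (poly_bracket_eval g_lie _ _ e u v)).
  by rewrite /F line_p1E line_p2E.
split.
- move=> e x y n m; rewrite /F (current_bracket_gen g_lie) /line_c1 /line_c2.
  case: s {F F_line} => [s0|]; first exact: erefl.
  have drop (V : lmodType R[i]) (a b c : V) : a + 0 *: b + (- e) *: c = a - e *: c.
    by rewrite scale0r addr0 scaleNr.
  by rewrite drop.
- move=> s1 s12 s2 e e0.
  have [e1 [e2 [on_line <- [e12 e13 e23]]]] := line_distinct e0 s1 s12 s2.
  by rewrite F_line //; apply: elliptic_iso => //; exact: liouville_complex.
- move=> e e' e0 e'0.
  have [l l0 [le1 le2]] := line_rescale s e0 e'0; rewrite /F le1 le2.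
  exact: current_rescale.
Qed.
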